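(* Let $W$ be an admissible interaction potential and assume that the convexity modulus $\lambda_0$ defined in the context satisfies $\lambda_0>0$. Set $$x^\infty:=E\left[\sum_{j=1}^n\frac{p_j}{m_j}\right]^{-1}\in\mathbb{R}^d,\qquad \mu^\infty:=(p_1\delta_{x^\infty},\ldots,p_n\delta_{x^\infty}).$$ Then $\mu^\infty$ is the unique minimizer of $\mathcal{W}$ on $\mathscr{P}$ and the unique stationary state of the interaction system on $\mathscr{P}$. It is globally asymptotically stable: for every $\mu^0\in\mathscr{P}$, the gradient flow solution $\mu$ with initial datum $\mu^0$ converges exponentially fast in $(\mathscr{P},\mathbf{W}_{\mathscr{P}})$ at rate $\lambda_0$ to $\mu^\infty$, i.e. $\mathbf{W}_{\mathscr{P}}(\mu(t),\mu^\infty)\le e^{-\lambda_0t}\,\mathbf{W}_{\mathscr{P}}(\mu^0,\mu^\infty)$ for all $t\ge0$.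
   Context: Let $d,n\in\mathbb{N}$, $m_1,\ldots,m_n>0$, $p_1,\ldots,p_n>0$, $E\in\mathbb{R}^d$ be fixed. Admissible interaction potential: a map $W:\mathbb{R}^d\to\mathbb{R}^{n\times n}$ such that $W(z)$ is a symmetric matrix for each $z$; $W_{ij}\in C^1(\mathbb{R}^d;\mathbb{R})$ for all $i,j$; $W(z)=W(-z)$ for all $z$; there is a matrix $\overline W\in\mathbb{R}^{n\times n}$ with $|W_{ij}(z)|\le\overline W_{ij}(1+|z|^2)$ for all $z,i,j$; and there is a symmetric matrix $\kappa\in\mathbb{R}^{n\times n}$ (the convexity matrix, fixed) such that $z\mapsto W_{ij}(z)-\frac12\kappa_{ij}|z|^2$ is convex for all $i,j$. Interaction system: $\partial_t\mu_i=\mathrm{div}\big[m_i\mu_i\nabla\big(\sum_{j=1}^nW_{ij}*\mu_j\big)\big]$, $i=1,\ldots,n$. It holds in the sense of distributions if for all $i$ and all $\varphi\in C_c^\infty((0,\infty)\times\mathbb{R}^d)$: $\int_0^\infty\int_{\mathbb{R}^d}\big(\partial_t\varphi(t,x)-m_i\nabla\varphi(t,x)\cdot\sum_{j=1}^n\int\nabla W_{ij}(x-y)\,\mathrm{d}\mu_j(t,y)\big)\mathrm{d}\mu_i(t,x)\,\mathrm{d}t=0$. A stationary state is an element of $\mathscr{P}$ which, as a constant curve in time, solves the interaction system in the sense of distributions. $\mathscr{P}$ is the set of $n$-tuples $\mu=(\mu_1,\ldots,\mu_n)$ of nonnegative Borel measures on $\mathbb{R}^d$ with $\mu_j(\mathbb{R}^d)=p_j$,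 finite second moments, and $\sum_{j=1}^n\frac1{m_j}\int_{\mathbb{R}^d}x\,\mathrm{d}\mu_j(x)=E$. The distance on $\mathscr{P}$ is $$\mathbf{W}_{\mathscr{P}}(\mu^0,\mu^1)=\Big[\sum_{j=1}^n\frac1{m_j}\inf\Big\{\int|x-y|^2\,\mathrm{d}\gamma_j(x,y):\gamma_j\in\Gamma(\mu^0_j,\mu^1_j)\Big\}\Big]^{1/2},$$ where $\Gamma(\mu^0_j,\mu^1_j)$ is the set of finite Borel measures on $\mathbb{R}^d\times\mathbb{R}^d$ with marginals $\mu_j^0,\mu_j^1$. The interaction energy is $\mathcal{W}(\mu)=\frac12\sum_{i,j=1}^n\int\int W_{ij}(x-y)\,\mathrm{d}\mu_i(x)\,\mathrm{d}\mu_j(y)$. $AC^2_{\mathrm{loc}}([0,\infty);(X,\mathbf{d}))$ is the set of curves $\mu:[0,\infty)\to X$ such that for each $T>0$ there is $\varphi\in L^2([0,T])$ with $\mathbf{d}(\mu(s),\mu(t))\le\int_s^t\varphi(r)\,\mathrm{d}r$ for $0\le s\le t\le T$. The gradient flow solution with initial datum $\mu^0\in\mathscr{P}$ is the (existing and unique) curve in $AC^2_{\mathrm{loc}}([0,\infty);(\mathscr{P},\mathbf{W}_{\mathscr{P}}))$ with $\mu(0)=\mu^0$ for which the interaction system holds in the sense of distributions. Convexity modulus $\lambda_0$: if $n>1$, with $\eta_i:=\min_{j\neq i}\kappa_{ij}m_j$, $$\lambda_0:=\min_{i\in\{1,\ldots,n\}}\left[p_i\min(0,m_i\kappa_{ii}-\eta_i)+\frac12\sum_{j=1}^n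 p_j\left(\eta_j+\eta_i\frac{m_i}{m_j}\right)\right];$$ if $n=1$, $\lambda_0:=m_1\kappa_{11}p_1$. *)

(* Defs.v *)
From HB Require Import structures.
From mathcomp Require Import all_boot all_order all_algebra.
From mathcomp Require Import all_classical all_reals all_analysis.

Set Implicit Arguments.
Unset Strict Implicit.
Unset Printing Implicit Defensive.

Import Order.TTheory GRing.Theory Num.Theory.
Import numFieldNormedType.Exports.

Local Open Scope classical_set_scope.
Local Open Scope ring_scope.

(* R^d with its Borel sigma-algebra.  The norm that the library puts on
   'rV[R]_d is the sup norm; it is only used here through its topology and
   through differentiability, and |x|^2 is always [sqnorm x]. *)
Notation borel_rV R d := (g_sigma_algebraType (@open 'rV[R]_d)).
Notation measure_rV R d := {measure set (borel_rV R d) -> \bar R}.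

Section Euclidean.
Context {R : realType} {d : nat}.
Implicit Types x y : 'rV[R]_d.

Definition dotv x y : R := \sum_(k < d) x 0 k * y 0 k.

Definition sqnorm x : R := dotv x x.

Definition grad (f : 'rV[R]_d -> R) x : 'rV[R]_d :=
  \row_(k < d) 'D_(delta_mx 0 k) f x.

Definition C1 (f : 'rV[R]_d -> R) : Prop :=
  (forall x, differentiable f x) /\ continuous (grad f).

End Euclidean.

Section Smooth.
Context {R : realType} {V : normedModType R}.

Fixpoint Ck (k : nat) (f : V -> R) : Prop :=
  match k with
  | 0 => continuous f
  | k.+1 => (forall x, differentiable f x) /\
            (forall v, Ck k (fun x => 'D_v f x))
  end.

Definition smooth (f : V -> R) : Prop := forall k, Ck k f.

Definition tsupport (f : V -> R) : set V := closure [set z | f z != 0].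

End Smooth.

(* C_c^oo((0,oo) x R^d), its elements being extended by 0 to R x R^d. *)
Definition test_function (R : realType) (d : nat)
    (phi : R * 'rV[R]_d -> R) : Prop :=
  [/\ smooth phi, compact (tsupport phi) &
      tsupport phi `<=` [set z | 0 < z.1]].

Definition dt (R : realType) (d : nat) (phi : R * 'rV[R]_d -> R)
    (t : R) (x : 'rV[R]_d) : R :=
  derive1 (fun s => phi (s, x)) t.

Definition gradx (R : realType) (d : nat) (phi : R * 'rV[R]_d -> R)
    (t : R) (x : 'rV[R]_d) : 'rV[R]_d :=
  grad (fun z => phi (t, z)) x.

Record admissible (R : realType) (d n : nat)
    (W : 'rV[R]_d -> 'M[R]_n) (kappa : 'M[R]_n) : Prop := Admissible {
  W_sym : forall z, (W z)^T = W z ;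
  W_C1 : forall i j, C1 (fun z => W z i j) ;
  W_even : forall z, W (- z) = W z ;
  W_growth : exists Wbar : 'M[R]_n,
    forall z i j, `|W z i j| <= Wbar i j * (1 + sqnorm z) ;
  kappa_sym : kappa^T = kappa ;
  W_convex : forall i j,
    convex_function (E := 'rV[R]_d) setT
      (fun z => W z i j - 2^-1 * kappa i j * sqnorm z)
}.

Section Species.
Context {R : realType} {d n : nat}.
Implicit Types (m p : 'I_n -> R) (E : 'rV[R]_d).
Implicit Types (mu nu : 'I_n -> measure_rV R d).
Implicit Types (W : 'rV[R]_d -> 'M[R]_n) (kappa : 'M[R]_n).

(* A library measure is a function on all subsets, with no constraint outside
   the sigma-algebra, so measures are compared on Borel sets only. *)
Definition same_measures mu nu : Prop :=
  forall j (A : set (borel_rV R d)), measurable A -> mu j A = nu j A.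

Definition in_P m p E mu : Prop :=
  [/\ forall j, mu j setT = (p j)%:E,
      forall j, (\int[mu j]_x (sqnorm x)%:E < +oo)%E &
      \sum_(j < n) (m j)^-1 *:
        (\row_(k < d) \int[mu j]_x ((x : 'rV[R]_d) 0 k)) = E].

(* The product sigma-algebra on R^d x R^d is its Borel sigma-algebra. *)
Definition couplings (mu0 mu1 : measure_rV R d) :
    set {finite_measure set (borel_rV R d * borel_rV R d)%type -> \bar R} :=
  [set gamma | forall A : set (borel_rV R d), measurable A ->
     gamma (fst @^-1` A) = mu0 A /\ gamma (snd @^-1` A) = mu1 A].

Definition transport_cost (mu0 mu1 : measure_rV R d) : \bar R :=
  ereal_inf [set (\int[gamma]_z (sqnorm (z.1 - z.2 : 'rV[R]_d))%:E)%E
            | gamma in couplings mu0 mu1].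

(* On P every transport cost is finite, so that [fine] loses nothing. *)
Definition WP m mu0 mu1 : R :=
  Num.sqrt (\sum_(j < n) (m j)^-1 * fine (transport_cost (mu0 j) (mu1 j))).

Definition energy W mu : R :=
  2^-1 * \sum_(i < n) \sum_(j < n)
    \int[mu j]_y \int[mu i]_x W ((x : 'rV[R]_d) - y) i j.

(* sum_j (nabla W_ij) * mu_j *)
Definition drift W mu (i : 'I_n) (x : 'rV[R]_d) : 'rV[R]_d :=
  \sum_(j < n) \row_(k < d)
    \int[mu j]_y (grad (fun z => W z i j) (x - (y : 'rV[R]_d)) 0 k).

Definition solves m W (mu : R -> 'I_n -> measure_rV R d) : Prop :=
  forall (i : 'I_n) (phi : R * 'rV[R]_d -> R), test_function phi ->
    \int[lebesgue_measure]_(t in `]0, +oo[)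
      \int[mu t i]_x
        (dt phi t x - m i * dotv (gradx phi t x) (drift W (mu t) i x)) = 0.

Definition stationary m p E W mu : Prop :=
  in_P m p E mu /\ solves m W (fun=> mu).

Definition minimizer m p E W mu : Prop :=
  in_P m p E mu /\ forall nu, in_P m p E nu -> energy W mu <= energy W nu.

(* Curves on [0, oo) are functions of a real t whose values at t < 0 are
   ignored. *)
Definition AC2_loc m (mu : R -> 'I_n -> measure_rV R d) : Prop :=
  forall T : R, 0 < T -> exists phi : R -> R,
    [/\ measurable_fun `[0, T] phi,
        (\int[lebesgue_measure]_(r in `[0%R, T]) ((phi r) ^+ 2)%:E < +oo)%E &
        forall s t, 0 <= s -> s <= t -> t <= T ->
          WP m (mu s) (mu t) <= \int[lebesgue_measure]_(r in `[s, t]) phi r].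

Definition gradient_flow m p E W mu0
    (mu : R -> 'I_n -> measure_rV R d) : Prop :=
  [/\ forall t, 0 <= t -> in_P m p E (mu t),
      AC2_loc m mu,
      same_measures (mu 0) mu0 &
      solves m W mu].

Definition x_infty m p E : 'rV[R]_d := (\sum_(j < n) p j / m j)^-1 *: E.

Definition mu_infty m p (hp : forall j, 0 < p j) E : 'I_n -> measure_rV R d :=
  fun j => mscale (NngNum (ltW (hp j)))
             (dirac (x_infty m p E : borel_rV R d)).

End Species.

Section ConvexityModulus.
Context {R : realType} {n : nat}.
Implicit Types (m p : 'I_n -> R) (kappa : 'M[R]_n).

(* Minimum of a finite family over indices satisfying P, which must be
   satisfiable: +oo is only the neutral element of [mine]. *)
Definition minR (P : pred 'I_n) (F : 'I_n -> R) : R :=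
  fine (\big[mine/+oo%E]_(i < n | P i) (F i)%:E).

Definition eta m kappa (i : 'I_n) : R :=
  minR (fun j => j != i) (fun j => kappa i j * m j).

(* For n = 1 the sum of the second branch has exactly one term. *)
Definition lambda0 m p kappa : R :=
  if (1 < n)%N then
    minR xpredT (fun i =>
      p i * Num.min 0 (m i * kappa i i - eta m kappa i) +
      2^-1 * \sum_(j < n)
        p j * (eta m kappa j + eta m kappa i * (m i / m j)))
  else \sum_(i < n) m i * kappa i i * p i.

End ConvexityModulus.

(* Main.v *)
(* Let L mu = sum_j 1/m_j int |x - x_infty|^2 dmu_j, the squared distance of mu to
   mu_infty.  Since kappa_ij >= (eta_i / m_j + eta_j / m_i) / 2 off the diagonal
   and since the weighted centre of mass is fixed, which cancels the products of
   first moments,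
     sum_ij kappa_ij int int |x - y|^2 dmu_i(x) dmu_j(y) >= 2 lambda0 L mu.
   An even W_ij with W_ij - kappa_ij |z|^2 / 2 convex satisfies
   W_ij z >= W_ij 0 + kappa_ij |z|^2 / 2 and z . grad W_ij z >= kappa_ij |z|^2.
   The first bound gives energy mu >= energy mu_infty + lambda0 L mu / 2.  The
   second one gives (L mu)' <= - 2 lambda0 L mu weakly along a solution: test with
   a(t) times a truncation of |x - x_infty|^2, remove the truncation by dominated
   convergence, and conclude by choosing a.  A stationary state is a constant
   solution, so that the decay forces L = 0. *)

From HB Require Import structures.
Require Import Defs.
From mathcomp Require Import all_boot all_order all_algebra.
From mathcomp Require Import all_classical all_reals all_analysis.
From mathcomp Require Import unstable measurable_realfun ring lra.

Set Implicit Arguments.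
Unset Strict Implicit.
Unset Printing Implicit Defensive.

Import Order.TTheory GRing.Theory Num.Theory.
Import numFieldNormedType.Exports.

Local Open Scope classical_set_scope.
Local Open Scope ring_scope.

(** * Smooth functions *)

(** Admissible test functions are smooth with compact support in positive times, so the square is
    truncated in space and the weight localised in time by functions built from e^(-1/x). The
    truncation has to stay until after the time integration: the curve is controlled in time only
    through transport costs, and these control integrals of continuous kernels of subquadratic
    growth. The truncated kernel is of this kind, since its vector field is bounded and
    semiconvexity with the quadratic bound on [W] limits the growth of [grad W]. The limit kernel is
    quadratic; its time integrand is reached as a dominated pointwise limit. In the dissipation,
    exchanging the two particles turns 2 (x - x_infty) . grad W_ij (x - y) into (x - y) . grad W_ij
    (x - y), while the weights 1/m_i cancel the mobilities. The factor e^(2 lambda0 t) in the time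
    weight turns decay into monotonicity. Finally, all couplings with a multiple of a Dirac mass
    have the same cost, which identifies the distance to [mu_infty] with a second moment. *)

Section SmoothClosure.
Context {R : realType} {V : normedModType R}.
Implicit Types (f g : V -> R) (k : nat).

Lemma Ck_continuous k f : Ck k f -> continuous f.
Proof.
by case: k => [//|k [df _]] x; exact: differentiable_continuous.
Qed.

Lemma CkS k f : Ck k.+1 f -> Ck k f.
Proof.
elim: k f => [f|k IH f [df Df]]; first exact: (@Ck_continuous 1).
by split => // v; apply: IH; exact: Df.
Qed.

Lemma smooth_differentiable f x : smooth f -> differentiable f x.
Proof. by move=> /(_ 1) []. Qed.

Lemma smooth_derive f v : smooth f -> smooth (fun x => 'D_v f x).
Proof. by move=> sf k; have [_] := sf k.+1; exact. Qed.

Lemma Ck_cst k (c : R) : Ck k (fun _ : V => c).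
Proof.
elim: k c => [c|k IH c]; first exact: cst_continuous.
split=> [x|v]; first exact: differentiable_cst.
suff -> : (fun x : V => 'D_v (cst c) x) = fun=> 0 by exact: IH.
by apply/funext => x; rewrite derive_cst.
Qed.

Lemma CkD k f g : Ck k f -> Ck k g -> Ck k (fun x => f x + g x).
Proof.
elim: k f g => [f g cf cg x|k IH f g [df Df] [dg Dg]].
  by apply: cvgD; [exact: cf|exact: cg].
split=> [x|v]; first exact: (differentiableD (df x) (dg x)).
suff -> : (fun x => 'D_v (f + g) x) = fun x => 'D_v f x + 'D_v g x.
  by apply: IH; [exact: Df|exact: Dg].
by apply/funext => x; rewrite deriveD//; exact: diff_derivable.
Qed.

Lemma CkM k f g : Ck k f -> Ck k g -> Ck k (fun x => f x * g x).
Proof.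
elim: k f g => [f g cf cg x|k IH f g [df Df] [dg Dg]].
  by apply: cvgM; [exact: cf|exact: cg].
split=> [x|v]; first exact: (differentiableM (df x) (dg x)).
suff -> : (fun x => 'D_v (f * g) x) = fun x => f x * 'D_v g x + g x * 'D_v f x.
  by apply: CkD; apply: IH; [|exact: Dg| |exact: Df]; exact: CkS.
by apply/funext => x; rewrite deriveM//; exact: diff_derivable.
Qed.

Lemma Ck_linear k (u : {linear V -> R}) : continuous u -> Ck k u.
Proof.
move=> cu; case: k => [//|k]; split=> [x|v]; first exact: linear_differentiable.
suff -> : (fun x => 'D_v u x) = fun=> u v by exact: Ck_cst.
by apply/funext => x; rewrite deriveE ?diff_lin//; exact: linear_differentiable.
Qed.

Lemma derive_comp1 (g : R -> R) (u : V -> R) (x v : V) :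
  derivable g (u x) 1 -> differentiable u x ->
  'D_v (fun y => g (u y)) x = 'D_v u x * 'D_1 g (u x).
Proof.
move=> /derivable1_diffP dg du.
rewrite (deriveE _ (differentiable_comp du dg)) diff_comp//= diff1E//.
by rewrite derive1E (deriveE _ du).
Qed.

(** The outer function comes with the tower [G] of its successive derivatives: differentiating the
    composition replaces [G j] by [G j.+1], so the induction on the order needs all [j] at once. *)
Lemma smooth_comp (G : nat -> R -> R) (u : V -> R) :
  (forall j (x : R), is_derive x 1 (G j) (G j.+1 x)) -> smooth u ->
  smooth (fun x => G 0%N (u x)).
Proof.
move=> dG su k; move: 0%N => j.
have dGu i x : differentiable (G i) (u x) by apply/derivable1_diffP; case: (dG i (u x)).
have dfu i x : differentiable (fun y => G i (u y)) x.
  by apply: (differentiable_comp (smooth_differentiable x su) (dGu i x)).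
elim: k j => [|k IH] j; first by move=> x; exact: differentiable_continuous.
split=> [//|v].
suff -> : (fun x => 'D_v (fun y => G j (u y)) x) =
    fun x => 'D_v u x * G j.+1 (u x).
  by apply: CkM (IH _); exact: smooth_derive.
apply/funext => x; have ? : derivable (G j) (u x) 1 by exact/derivable1_diffP.
rewrite derive_comp1//; last exact: smooth_differentiable.
by have [_ ->] := dG j (u x).
Qed.

Lemma smooth_cst (c : R) : smooth (fun _ : V => c).
Proof. by move=> k; exact: Ck_cst. Qed.

Lemma smoothD f g : smooth f -> smooth g -> smooth (fun x => f x + g x).
Proof. by move=> sf sg k; exact: CkD. Qed.

Lemma smoothM f g : smooth f -> smooth g -> smooth (fun x => f x * g x).
Proof. by move=> sf sg k; exact: CkM. Qed.

Lemma smoothB f g : smooth f -> smooth g -> smooth (fun x => f x - g x).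
Proof.
move=> sf sg; suff -> : (fun x => f x - g x) = fun x => f x + (-1) * g x.
  by apply: smoothD => //; apply: smoothM => //; exact: smooth_cst.
by apply/funext => x; rewrite mulN1r.
Qed.

Lemma Ck_sum (I : Type) (s : seq I) k (f : I -> V -> R) :
  (forall i, Ck k (f i)) -> Ck k (fun x => \sum_(i <- s) f i x).
Proof.
move=> sf; elim: s => [|i s IH].
  by under eq_fun do rewrite big_nil; exact: Ck_cst.
by under eq_fun do rewrite big_cons; exact: CkD.
Qed.

Lemma smooth_sum (I : Type) (s : seq I) (f : I -> V -> R) :
  (forall i, smooth (f i)) -> smooth (fun x => \sum_(i <- s) f i x).
Proof. by move=> sf k; apply: Ck_sum => i; exact: sf. Qed.

End SmoothClosure.

(** * Functions that are flat at the origin *)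

Section FlatFunction.
Context {R : realType}.
Implicit Types (p : {poly R}) (x : R).

(** The whole family p(1/x) e^(-1/x) is introduced because, unlike e^(-1/x) alone, it is stable
    under differentiation. *)
Definition flat p x : R := if 0 < x then p.[x^-1] * expR (- x^-1) else 0.

(** With y = 1/x, so that dy/dx = -y^2, the derivative of p(y) e^(-y) is y^2 (p(y) - p'(y))
    e^(-y). *)
Definition flat_next p : {poly R} := 'X^2 * (p - p^`()).

Lemma poly_bound p : exists2 C, 0 <= C & forall y, 1 <= y ->
  `|p.[y]| <= C * y ^+ (size p).
Proof.
exists (\sum_(i < size p) `|p`_i|); first exact: sumr_ge0.
move=> y y1; rewrite horner_coef mulr_suml.
apply: (le_trans (ler_norm_sum _ _ _)); apply: ler_sum => i _.
have y0 : 0 <= y by apply: le_trans y1.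
rewrite normrM ler_wpM2l// ger0_norm ?exprn_ge0//.
by rewrite ler_weXn2l// ltnW.
Qed.

(** The exponential series gives e^y >= y^(s+2) / (s+2)! with s the size of p: s powers absorb the
    polynomial and the other two leave x^2, one power more than the difference quotient at 0
    consumes. *)
Lemma flat_bound p : exists2 C, 0 <= C & forall x, 0 < x -> x <= 1 ->
  `|flat p x| <= C * x ^+ 2.
Proof.
have [C C0 HC] := poly_bound p.
exists (C * ((size p).+2)`!%:R); first by rewrite mulr_ge0.
move=> x x0 x1; rewrite /flat x0.
set y := x^-1; have y1 : 1 <= y by rewrite invf_ge1.
have y0 : 0 < y by apply: lt_le_trans y1.
rewrite normrM (ger0_norm (expR_ge0 _)) expRN.
have He := le_trans (ler_wpDl ler01 (lexx _)) (@expR_ge1Dxn _ _ (size p).+1 (ltW y0)).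
have Hx : x = y^-1 by rewrite invrK.
rewrite ler_pdivrMr ?expR_gt0// (le_trans (HC _ y1))//.
rewrite -!mulrA ler_wpM2l//.
move: He; rewrite ler_pdivrMr ?ltr0n ?fact_gt0// => He.
rewrite Hx -(ler_pM2l (x := y ^+ 2)) ?exprn_gt0//.
rewrite -exprD add2n (le_trans He)//.
rewrite le_eqVlt; apply/orP; left; apply/eqP; field; exact: lt0r_neq0.
Qed.

Lemma flat_le0 p x : x <= 0 -> flat p x = 0.
Proof. by rewrite /flat ltNge => ->. Qed.

Lemma is_derive_flat p x : is_derive x 1 (flat p) (flat (flat_next p) x).
Proof.
have [x0|x0|->] := ltgtP x 0.
- rewrite (flat_le0 _ (ltW x0)).
  apply: (@near_eq_is_derive _ _ _ (cst 0)).
  near=> z; rewrite flat_le0//; apply: ltW; near: z; exact: lt_nbhsl.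
- apply: (@near_eq_is_derive R R R (fun z : R => p.[z^-1] * expR (- z^-1))).
    by near=> z; rewrite /flat ifT//; near: z; exact: lt_nbhsr.
  have xn0 : x != 0 by exact: lt0r_neq0.
  have dV : is_derive x 1 (fun z : R => z^-1) (- x ^- 2).
    have := @is_deriveV R id x 1 1 xn0 (is_derive_id (x : R) (1 : R)).
    by rewrite /= -[_ *: 1]/(_ * 1) mulr1.
  have dP := is_derive1_comp (is_derive_poly p x^-1) dV.
  have dE := @is_derive1_comp R expR (fun z => - z^-1) x _ _
    (is_derive_expR (- x^-1)) (is_deriveN dV).
  apply: is_derive_eq (is_deriveM dP dE) _.
  rewrite /flat x0 /flat_next !hornerE /= -![_ *: _]/(_ * _).
  by rewrite exprVn; field.
- rewrite (_ : flat (flat_next p) 0 = 0) ?flat_le0//.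
  have [C C0 HC] := flat_bound p.
  (* At 0 the quotient vanishes for h <= 0 and is at most C h for 0 < h <= 1, by quadratic
     flatness. *)
  have d0 : h^-1 *: (flat p (h *: 1 + 0) - flat p 0) @[h --> 0^'] --> (0 : R).
    apply/cvgrPdist_le => e e0; near=> h.
    rewrite sub0r normrN (flat_le0 _ (lexx _)) subr0 addr0.
    rewrite -![_ *: _]/(_ * _) mulr1.
    have [h0|h0] := leP h 0; first by rewrite flat_le0// mulr0 normr0 ltW.
    have h1 : h <= 1.
      rewrite (le_trans (ler_norm _))//; near: h.
      by apply: dnbhs0_le.
    rewrite normrM normfV (gtr0_norm h0) mulrC ler_pdivrMr//.
    apply: (le_trans (HC _ h0 h1)); rewrite expr2 mulrA ler_wpM2r ?(ltW h0)//.
    have he : h <= e / (C + 1).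
      rewrite (le_trans (ler_norm _))//; near: h.
      by apply: dnbhs0_le; rewrite divr_gt0// ltr_wpDl.
    rewrite (le_trans (ler_wpM2l C0 he))// mulrA ler_pdivrMr ?ltr_wpDl//.
    by rewrite mulrC ler_wpM2l ?lerDl// ltW.
  by apply: DeriveDef; [apply/cvg_ex; exists 0|exact: cvg_lim d0].
Unshelve. all: by end_near.
Qed.

Definition flat_poly (j : nat) : {poly R} := iter j flat_next 1.

Lemma is_derive_flat_poly j x :
  is_derive x 1 (flat (flat_poly j)) (flat (flat_poly j.+1) x).
Proof. exact: is_derive_flat. Qed.

End FlatFunction.

(** * Steps and cut-offs on the line *)

Section SmoothLine.
Context {R : realType}.
Implicit Types (f : R -> R) (x : R).

Lemma smooth_comp1 {V : normedModType R} f (u : V -> R) :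
  smooth f -> smooth u -> smooth (fun z => f (u z)).
Proof.
move=> sf su; pose G j := iter j (fun (h : R -> R) x => 'D_1 h x) f.
have sG j : smooth (G j) by elim: j => // j IH; exact: (@smooth_derive R R (G j) 1 IH).
apply: (@smooth_comp _ _ G) su => j x.
by apply: derivableP; apply: diff_derivable; exact: smooth_differentiable.
Qed.

Lemma smooth_id : smooth (fun x : R => x).
Proof.
move=> k; apply: (@Ck_linear _ _ k (idfun : {linear R -> R})).
by move=> x; exact: cvg_id.
Qed.

Lemma smooth_expR : smooth (expR : R -> R).
Proof.
by apply: (@smooth_comp _ _ (fun=> expR) id); exact: smooth_id.
Qed.

Lemma smooth_flat : smooth (flat (1 : {poly R})).
Proof.
apply: (@smooth_comp _ _ (fun j => flat (flat_poly j)) id); last exact: smooth_id.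
by move=> j x; exact: is_derive_flat_poly.
Qed.

Lemma continuous_smooth {V : normedModType R} (h : V -> R) : smooth h -> continuous h.
Proof. by move=> /(_ 0%N). Qed.

Lemma derive_near_cst f x (c : R) : (\near x, f x = c) -> 'D_1 f x = 0.
Proof.
move=> fc; have [] // := @near_eq_is_derive R R R (cst c) f x 1 0 _ (is_derive_cst _ _ _).
by near=> z; rewrite /cst; apply/esym; near: z.
Unshelve. all: by end_near.
Qed.

Lemma derive_ge0 f x : {homo f : x y / x <= y} -> derivable f x 1 -> 0 <= 'D_1 f x.
Proof.
move=> ndf df; apply: limr_ge => //.
near=> h; rewrite -![_ *: _]/(_ * _) mulr1.
have [h0|h0] := leP 0 h; first by rewrite mulr_ge0 ?invr_ge0// subr_ge0 ndf// lerDr.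
by rewrite mulr_le0// ?invr_le0 ?(ltW h0)// subr_le0 ndf// gerDr ltW.
Unshelve. all: by end_near.
Qed.

Definition bmp : R -> R := flat 1.

Lemma bmpE x : 0 < x -> bmp x = expR (- x^-1).
Proof. by move=> x0; rewrite /bmp /flat x0 hornerC mul1r. Qed.

Lemma bmp_le0 x : x <= 0 -> bmp x = 0. Proof. exact: flat_le0. Qed.

Lemma bmp_gt0 x : 0 < x -> 0 < bmp x.
Proof. by move=> x0; rewrite bmpE// expR_gt0. Qed.

Lemma bmp_ge0 x : 0 <= bmp x.
Proof. by have [/bmp_gt0/ltW//|/bmp_le0->] := ltP 0 x. Qed.

Lemma bmp_homo : {homo bmp : x y / x <= y}.
Proof.
move=> x y xy; have [x0|/bmp_le0->] := ltP 0 x; last exact: bmp_ge0.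
have y0 := lt_le_trans x0 xy.
by rewrite !bmpE// ler_expR lerN2 lef_pV2.
Qed.

(** Nesting [bmp] in itself gives a smooth transition whose monotonicity is that of a composition.
    The plateau reached from 1 on is [bmp 1] rather than 1; only its positivity will matter. *)
Definition step x := bmp 1 - bmp (1 - bmp x / bmp 1).

Lemma step_homo : {homo step : x y / x <= y}.
Proof.
move=> x y xy; rewrite /step lerD2l lerN2; apply: bmp_homo.
by rewrite lerD2l lerN2 ler_wpM2r ?invr_ge0 ?bmp_ge0// bmp_homo.
Qed.

Lemma step_le0 x : x <= 0 -> step x = 0.
Proof. by move=> x0; rewrite /step (bmp_le0 x0) mul0r subr0 subrr. Qed.

Lemma step_ge1 x : 1 <= x -> step x = bmp 1.
Proof.
move=> x1; rewrite /step [X in _ - X]bmp_le0 ?subr0//.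
by rewrite subr_le0 ler_pdivlMr ?bmp_gt0// mul1r bmp_homo.
Qed.

Lemma smooth_step : smooth step.
Proof.
apply: smoothB; first exact: smooth_cst.
apply: (@smooth_comp1 R bmp); first exact: smooth_flat.
apply: smoothB; first exact: smooth_cst.
by apply: smoothM; [exact: smooth_flat|exact: smooth_cst].
Qed.

Lemma derive_step_ge0 x : 0 <= 'D_1 step x.
Proof.
apply: derive_ge0; first exact: step_homo.
by apply: diff_derivable; exact: (smooth_differentiable _ smooth_step).
Qed.

Lemma derive_step_out x : x < 0 \/ 1 < x -> 'D_1 step x = 0.
Proof.
case=> [x0|x1].
  apply: (@derive_near_cst _ _ 0); near=> z; rewrite step_le0// ltW//; near: z.
  exact: lt_nbhsl.
apply: (@derive_near_cst _ _ (bmp 1)); near=> z; rewrite step_ge1// ltW//; near: z.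
exact: lt_nbhsr.
Unshelve. all: by end_near.
Qed.

(** There is no plateau near 0: the arguments tend to 0 with the truncation parameter, where
    continuity and the value 1 at 0 suffice. *)
Definition cutoff x := bmp (1 - x) / bmp 1.

Lemma smooth_cutoff : smooth cutoff.
Proof.
apply: smoothM; last exact: smooth_cst.
apply: (@smooth_comp1 R bmp); first exact: smooth_flat.
by apply: smoothB; [exact: smooth_cst|exact: smooth_id].
Qed.

Lemma cutoff0 : cutoff 0 = 1.
Proof. by rewrite /cutoff subr0 divff// gt_eqF// bmp_gt0. Qed.

Lemma cutoff_ge0 x : 0 <= cutoff x.
Proof. by rewrite /cutoff divr_ge0// bmp_ge0. Qed.

Lemma cutoff_le1 x : 0 <= x -> cutoff x <= 1.
Proof.
by move=> x0; rewrite /cutoff ler_pdivrMr ?bmp_gt0// mul1r bmp_homo// gerBl.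
Qed.

Lemma cutoff_ge1 x : 1 <= x -> cutoff x = 0.
Proof. by move=> x1; rewrite /cutoff bmp_le0 ?mul0r// subr_le0. Qed.

(** A truncated identity, with slope 1 at 0 and zero from 1 on: th^-1 tid(th s) tends to s, and its
    slope to 1, as th tends to 0. *)
Definition tid x := x * cutoff x.

Lemma smooth_tid : smooth tid.
Proof. by apply: smoothM; [exact: smooth_id|exact: smooth_cutoff]. Qed.

Lemma derive_tid0 : 'D_1 tid 0 = 1.
Proof.
have dc : derivable cutoff 0 1.
  by apply: diff_derivable; exact: (smooth_differentiable _ smooth_cutoff).
rewrite (_ : tid = id * cutoff)// deriveM//.
by rewrite derive_id cutoff0 scale0r add0r -[_ *: _]/(_ * _) mulr1.
Qed.

Lemma derive_tid_out x : 1 < x -> 'D_1 tid x = 0.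
Proof.
move=> x1; apply: (@derive_near_cst _ _ 0); near=> z.
rewrite /tid cutoff_ge1 ?mulr0// ltW//; near: z; exact: lt_nbhsr.
Unshelve. all: by end_near.
Qed.

Lemma derive_tid_bound : exists2 K, 0 <= K & forall x, 0 <= x -> `|'D_1 tid x| <= K.
Proof.
have cD : continuous (fun x => `|'D_1 tid x|).
  move=> x; apply: (@continuous_comp _ _ _ (fun x => 'D_1 tid x) Num.norm).
    exact: (continuous_smooth (@smooth_derive R R tid 1 smooth_tid)).
  exact: norm_continuous.
have [c _ Hc] := @EVT_max R (fun x => `|'D_1 tid x|) 0 1 ler01 (continuous_subspaceT cD).
exists `|'D_1 tid c| => // x x0.
have [x1|x1] := leP x 1; first by apply: Hc; rewrite in_itv/= x0.
by rewrite derive_tid_out// normr0.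
Qed.

End SmoothLine.

(** * Borel measures on R^d *)

Section BorelVectors.
Context {R : realType} {d : nat}.
Notation BV := (borel_rV R d).

Lemma measurable_continuous_rV (f : 'rV[R]_d -> R) :
  continuous f -> measurable_fun setT (f : BV -> R).
Proof.
move=> /continuousP cf.
apply: (measurability _ (RGenOpens.measurableE R)).
move=> _ [_ [a [b ->] <-]]; rewrite setTI; apply: sub_sigma_algebra.
exact/cf/interval_open.
Qed.

Lemma measurable_open_rV (A : set 'rV[R]_d) : open A -> measurable (A : set BV).
Proof. by move=> oA; exact: sub_sigma_algebra. Qed.

Lemma measurable_set1_rV (x : 'rV[R]_d) : measurable ([set x] : set BV).
Proof.
rewrite -[X in measurable X]setCK; apply: measurableC.
apply: measurable_open_rV; apply: closed_openC.
exact/accessible_closed_set1/hausdorff_accessible/norm_hausdorff.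
Qed.

Let ratball (q : 'rV[rat]_d * rat) : set 'rV[R]_d :=
  [set x | forall k, `|x 0 k - ratr (q.1 0 k)| < ratr q.2].

(** Second countability, by cubes with rational centre and radius. It reduces the Borel
    measurability of a vector-valued map to that of its coordinates. *)
Lemma open_rV_rat_balls (U : set 'rV[R]_d) : open U ->
  U = \bigcup_q (if `[< ratball q `<=` U >] then ratball q else set0).
Proof.
move=> oU; apply/seteqP; split=> [x Ux|x [q _]]; last by case: ifPn => // /asboolP; exact.
have /nbhs_ballP[e /= e0 eU] : nbhs x U by exact: open_nbhs_nbhs.
(* A cube of radius r < e/2 whose centre lies within r of x in each coordinate stays in the sup-norm
   ball of radius e about x. *)
have [r] := @rat_in_itvoo R 0 (e / 2) (divr_gt0 e0 (ltr0n R 2)).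
rewrite in_itv/= => /andP[r0 re].
have /choice[q Hq] : forall k : 'I_d, exists q : rat, `|x 0 k - ratr q| < ratr r.
  move=> k; have xr : x 0 k - ratr r < x 0 k + ratr r by rewrite ltrD2l gtrN.
  have [q] := rat_in_itvoo xr.
  rewrite in_itv/= => /andP[q1 q2]; exists q.
  by rewrite distrC ltr_norml; apply/andP; split; lra.
exists (\row_k q k, r) => //; case: ifPn => [_ k|/asboolP[y Hy]].
  by rewrite /= mxE.
apply: eU; rewrite mx_norm_ball /ball_ /= [`|_|]mx_normrE.
apply/bigmax_ltP; split => // -[i k] _ /=; rewrite ord1 !mxE.
have := Hy k; have := Hq k; rewrite /= mxE => H1 H2.
rewrite -(subrKA (ratr (q k))) (le_lt_trans (ler_normD _ _))//.
by rewrite (distrC (ratr _)) (splitr e) ltrD// (lt_trans _ re).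
Qed.

Lemma measurable_fun_rV d1 (T : measurableType d1) (f : T -> 'rV[R]_d) :
  (forall k, measurable_fun setT (fun z => f z 0 k)) ->
  measurable_fun setT (f : T -> BV).
Proof.
move=> mf; apply: (@measurability _ _ T BV setT f (@open _) erefl).
move=> _ [U oU <-]; rewrite setTI (open_rV_rat_balls oU) preimage_bigcup.
apply: countable_bigcupT_measurable => // q.
case: ifPn => _; last by rewrite preimage_set0; exact: measurable0.
rewrite (_ : _ @^-1` _ =
    \bigcap_(k in [set: 'I_d]) [set z | `|f z 0 k - ratr (q.1 0 k)| < ratr q.2]).
  apply: fin_bigcap_measurable => // k _.
  have mh : measurable_fun setT (fun z => `|f z 0 k - ratr (q.1 0 k)|).
    by apply: measurableT_comp => //; exact: measurable_funB.
  have := mh measurableT _ (measurable_itv `]-oo, ratr q.2[).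
  by rewrite setTI set_itvE.
by apply/seteqP; split=> z /= Hz k => [_|]; exact: Hz.
Qed.

Lemma measurable_coord (k : 'I_d) : measurable_fun setT (fun x : BV => (x : 'rV[R]_d) 0 k).
Proof. by apply: measurable_continuous_rV; exact: coord_continuous. Qed.

Lemma measurable_dotv d1 (T : measurableType d1) (f g : T -> 'rV[R]_d) :
  measurable_fun setT (f : T -> BV) -> measurable_fun setT (g : T -> BV) ->
  measurable_fun setT (fun z => dotv (f z) (g z)).
Proof.
move=> mf mg; apply: measurable_sum => k; apply: measurable_funM.
  exact: (measurableT_comp (measurable_coord k) mf).
exact: (measurableT_comp (measurable_coord k) mg).
Qed.

Lemma measurable_sub_rV d1 (T : measurableType d1) (f g : T -> 'rV[R]_d) :
  measurable_fun setT (f : T -> BV) -> measurable_fun setT (g : T -> BV) ->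
  measurable_fun setT ((fun z => f z - g z) : T -> BV).
Proof.
move=> mf mg; apply: measurable_fun_rV => k; under eq_fun do rewrite !mxE.
apply: measurable_funB.
  exact: (measurableT_comp (measurable_coord k) mf).
exact: (measurableT_comp (measurable_coord k) mg).
Qed.

Lemma measurable_sqnorm d1 (T : measurableType d1) (f : T -> 'rV[R]_d) :
  measurable_fun setT (f : T -> BV) -> measurable_fun setT (fun z => sqnorm (f z)).
Proof. by move=> mf; exact: measurable_dotv. Qed.

End BorelVectors.

(** * Finite measures, image measures and products *)

Section FiniteMeasure.
Context d (T : measurableType d) (R : realType) (mu : {measure set T -> \bar R}).
Hypothesis muT : (mu setT < +oo)%E.

(** The finiteness proof is an argument of the name, so that the finite-measure structure can be
    attached to a measure that has it only under a hypothesis. *)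
Definition finite_of of (mu setT < +oo)%E : set T -> \bar R := mu.
Notation nu := (finite_of muT).

HB.instance Definition _ := isMeasure.Build _ _ _ nu (measure0 mu)
  (measure_ge0 mu) (@measure_semi_sigma_additive _ _ _ mu).

Let nu_fin : fin_num_fun nu.
Proof.
move=> A mA; rewrite ge0_fin_numE ?measure_ge0//.
by apply: le_lt_trans muT; apply: le_measure; rewrite ?inE.
Qed.

HB.instance Definition _ := Measure_isFinite.Build _ _ _ nu nu_fin.

Definition finm : {finite_measure set T -> \bar R} := nu.

Lemma finmE : finm = mu :> (set T -> \bar R). Proof. by []. Qed.

End FiniteMeasure.

Section Integrability.
Context d (T : measurableType d) (R : realType).
Implicit Types (mu : {measure set T -> \bar R}) (f g : T -> R).

Lemma integrable_dominated mu f g : measurable_fun setT f ->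
  (forall x, `|f x| <= g x) -> mu.-integrable setT (EFin \o g) ->
  mu.-integrable setT (EFin \o f).
Proof.
move=> mf fg; apply: le_integrable => //; first exact/measurable_EFinP.
by move=> x _ /=; rewrite lee_fin (le_trans (fg x))// ler_norm.
Qed.

Lemma ge0_integrable mu f : measurable_fun setT f -> (forall x, 0 <= f x) ->
  (\int[mu]_x (f x)%:E < +oo)%E -> mu.-integrable setT (EFin \o f).
Proof.
move=> mf f0 fo; apply/integrableP; split; first exact/measurable_EFinP.
by under eq_integral do rewrite /= ger0_norm//.
Qed.

Lemma Rintegral_sum_in mu D (I : Type) (s : seq I) (h : I -> T -> R) :
  measurable D -> (forall i, mu.-integrable D (EFin \o h i)) ->
  \int[mu]_(x in D) (\sum_(i <- s) h i x) = \sum_(i <- s) \int[mu]_(x in D) (h i x).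
Proof.
move=> mD ih; elim: s => [|i s IH].
  rewrite big_nil; under eq_Rintegral do rewrite big_nil.
  by rewrite Rintegral_cst// mul0r.
rewrite big_cons -IH -RintegralD//; last first.
  have := @integrable_sum _ _ _ mu D mD _ s xpredT
    (fun i x => (h i x)%:E) (fun i _ => ih i).
  by apply: eq_integrable => // x _ /=; rewrite sumEFin.
by under eq_Rintegral do rewrite big_cons.
Qed.

Lemma Rintegral_sum mu (I : Type) (s : seq I) (h : I -> T -> R) :
  (forall i, mu.-integrable setT (EFin \o h i)) ->
  \int[mu]_x (\sum_(i <- s) h i x) = \sum_(i <- s) \int[mu]_x (h i x).
Proof. exact: Rintegral_sum_in. Qed.

Lemma integrableD_R mu f g : mu.-integrable setT (EFin \o f) ->
  mu.-integrable setT (EFin \o g) ->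
  mu.-integrable setT (EFin \o (fun x => f x + g x)).
Proof. by move=> If Ig; exact: (integrableD measurableT If Ig). Qed.

Lemma integrableZ_R mu (c : R) f : mu.-integrable setT (EFin \o f) ->
  mu.-integrable setT (EFin \o (fun x => c * f x)).
Proof. by move=> If; exact: (integrableZl measurableT c If). Qed.

Lemma integrable_sum_R mu (I : Type) (s : seq I) (h : I -> T -> R) :
  (forall i, mu.-integrable setT (EFin \o h i)) ->
  mu.-integrable setT (EFin \o (fun x => \sum_(i <- s) h i x)).
Proof.
move=> ih; have := @integrable_sum _ _ _ mu setT measurableT _ s xpredT
    (fun i x => (h i x)%:E) (fun i _ => ih i).
by apply: eq_integrable => // x _ /=; rewrite sumEFin.
Qed.

End Integrability.

Section Pushforward.
Context d1 d2 (T1 : measurableType d1) (T2 : measurableType d2) (R : realType).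
Variables (mu : {measure set T1 -> \bar R}) (nu : {measure set T2 -> \bar R}).
Variable (phi : T1 -> T2).
Hypothesis mphi : measurable_fun setT phi.
Hypothesis nuE : forall A, measurable A -> nu A = mu (phi @^-1` A).

Lemma image_integral_ge0 (f : T2 -> R) : measurable_fun setT f ->
  (forall x, 0 <= f x) ->
  (\int[nu]_x (f x)%:E = \int[mu]_x (f (phi x))%:E)%E.
Proof.
move=> mf f0; rewrite (eq_measure_integral (pushforward mu phi)).
  rewrite ge0_integral_pushforward//; first exact/measurable_EFinP.
  by move=> x _; rewrite lee_fin.
by move=> A mA _; exact: nuE.
Qed.

Lemma image_integrable (f : T2 -> R) : nu.-integrable setT (EFin \o f) ->
  mu.-integrable setT (EFin \o (f \o phi)).
Proof.
move=> /integrableP[/measurable_EFinP mf foo]; apply/integrableP; split.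
  by apply/measurable_EFinP; exact: measurableT_comp.
rewrite /= in foo *.
rewrite -(@image_integral_ge0 (fun x => `|f x|))//.
exact: measurableT_comp.
Qed.

Lemma image_Rintegral (f : T2 -> R) : nu.-integrable setT (EFin \o f) ->
  \int[nu]_x f x = \int[mu]_x f (phi x).
Proof.
move=> If; have mf := measurable_int _ If.
rewrite /Rintegral (eq_measure_integral (pushforward mu phi)); last first.
  by move=> A mA _; exact: nuE.
by rewrite integral_pushforward//; exact: image_integrable.
Qed.

End Pushforward.

Section ProductIntegrals.
Context d1 d2 (T1 : measurableType d1) (T2 : measurableType d2) (R : realType).
Variables (m1 : {finite_measure set T1 -> \bar R}).
Variables (m2 : {finite_measure set T2 -> \bar R}).
Implicit Types f : T1 * T2 -> R.

Lemma prod_integrable_fst (g : T1 -> R) : m1.-integrable setT (EFin \o g) ->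
  (m1 \x m2)%E.-integrable setT (EFin \o (fun z => g z.1)).
Proof.
move=> /integrableP[mg goo]; have mg' : measurable_fun setT g by exact/measurable_EFinP.
apply/integrable12ltyP.
  by apply/measurable_EFinP; exact: (measurableT_comp mg').
under eq_integral do rewrite /= integral_cst//.
rewrite ge0_integralZr//; last first.
  by apply/measurable_EFinP; exact: measurableT_comp.
have I0 : (0 <= \int[m1]_x `|g x|%:E)%E by exact: integral_ge0.
rewrite -ge0_fin_numE ?mule_ge0// fin_numM// ?fin_num_measure//.
by rewrite ge0_fin_numE.
Qed.

Lemma prod_integrable_snd (g : T2 -> R) : m2.-integrable setT (EFin \o g) ->
  (m1 \x m2)%E.-integrable setT (EFin \o (fun z => g z.2)).
Proof.
move=> /integrableP[mg goo]; have mg' : measurable_fun setT g by exact/measurable_EFinP.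
apply/integrable12ltyP.
  by apply/measurable_EFinP; exact: (measurableT_comp mg').
have I0 : (0 <= \int[m2]_x `|g x|%:E)%E by exact: integral_ge0.
rewrite -[X in (X < _)%E]/(\int[m1]_x cst (\int[m2]_y `|g y|%:E) x)%E.
rewrite integral_cst//= -ge0_fin_numE ?mule_ge0//.
by rewrite fin_numM// ?fin_num_measure// ge0_fin_numE.
Qed.

(** Integrability of every section, and not only of almost every one, makes the inner [fine] exact
    at each point. *)
Lemma Rintegral12 f : (m1 \x m2)%E.-integrable setT (EFin \o f) ->
  (forall x, m2.-integrable setT (fun y => (f (x, y))%:E)) ->
  \int[m1]_x \int[m2]_y f (x, y) = \int[(m1 \x m2)%E]_z f z.
Proof.
move=> If Ify; rewrite /Rintegral -integral12_prod_meas1//; congr fine.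
by apply: eq_integral => x _; rewrite fineK//; exact: integrable_fin_num.
Qed.

Lemma Rintegral21 f : (m1 \x m2)%E.-integrable setT (EFin \o f) ->
  (forall y, m1.-integrable setT (fun x => (f (x, y))%:E)) ->
  \int[m2]_y \int[m1]_x f (x, y) = \int[(m1 \x m2)%E]_z f z.
Proof.
move=> If Ifx; rewrite /Rintegral -integral21_prod_meas1//; congr fine.
by apply: eq_integral => y _; rewrite fineK//; exact: integrable_fin_num.
Qed.

Lemma prod_Rintegral_fst (g : T1 -> R) : m1.-integrable setT (EFin \o g) ->
  \int[(m1 \x m2)%E]_z g z.1 = fine (m2 setT) * \int[m1]_x g x.
Proof.
move=> Ig; rewrite -(@Rintegral12 (fun z => g z.1)); last 2 first.
- exact: prod_integrable_fst.
- by move=> x; exact: (finite_measure_integrable_cst m2 (g x) measurableT).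
by under eq_Rintegral do rewrite /= Rintegral_cst//; rewrite RintegralZr// mulrC.
Qed.

Lemma prod_Rintegral_snd (g : T2 -> R) : m2.-integrable setT (EFin \o g) ->
  \int[(m1 \x m2)%E]_z g z.2 = fine (m1 setT) * \int[m2]_x g x.
Proof.
move=> Ig; rewrite -(@Rintegral21 (fun z => g z.2)); last 2 first.
- exact: prod_integrable_snd.
- by move=> y; exact: (finite_measure_integrable_cst m1 (g y) measurableT).
by under eq_Rintegral do rewrite /= Rintegral_cst//; rewrite RintegralZr// mulrC.
Qed.

Lemma prod_Rintegral_cst (c : R) :
  \int[(m1 \x m2)%E]_z c = fine (m1 setT) * fine (m2 setT) * c.
Proof.
have I1 : m1.-integrable setT (EFin \o cst c) by exact: finite_measure_integrable_cst.
rewrite (prod_Rintegral_fst I1) Rintegral_cst//; ring.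
Qed.

Lemma prod_Rintegral_mul (f : T1 -> R) (g : T2 -> R) :
  m1.-integrable setT (EFin \o f) -> m2.-integrable setT (EFin \o g) ->
  (m1 \x m2)%E.-integrable setT (EFin \o (fun z => f z.1 * g z.2)) ->
  \int[(m1 \x m2)%E]_z (f z.1 * g z.2) = \int[m1]_x f x * \int[m2]_y g y.
Proof.
move=> If Ig Ifg; rewrite -(@Rintegral12 (fun z => f z.1 * g z.2))//=; last first.
  by move=> x; exact: (integrableZ_R (f x) Ig).
by under eq_Rintegral do rewrite RintegralZl//; rewrite RintegralZr.
Qed.

Lemma prod_integrable_cst (c : R) :
  (m1 \x m2)%E.-integrable setT (EFin \o (fun=> c)).
Proof.
have I1 : m1.-integrable setT (EFin \o cst c) by exact: finite_measure_integrable_cst.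
exact: (prod_integrable_fst I1).
Qed.

End ProductIntegrals.

(** * Euclidean structure and semiconvex potentials *)

Section Dotv.
Context {R : realType} {d : nat}.
Implicit Types x y z u v : 'rV[R]_d.

Lemma dotvC x y : dotv x y = dotv y x.
Proof. by apply: eq_bigr => k _; rewrite mulrC. Qed.

Lemma dotvDl x y z : dotv (x + y) z = dotv x z + dotv y z.
Proof. by rewrite -big_split; apply: eq_bigr => k _; rewrite mxE mulrDl. Qed.

Lemma dotvZl c x y : dotv (c *: x) y = c * dotv x y.
Proof. by rewrite mulr_sumr; apply: eq_bigr => k _; rewrite mxE mulrA. Qed.

Lemma dotvNl x y : dotv (- x) y = - dotv x y.
Proof. by rewrite -scaleN1r dotvZl mulN1r. Qed.

Lemma dotvBl x y z : dotv (x - y) z = dotv x z - dotv y z.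
Proof. by rewrite dotvDl dotvNl. Qed.

Lemma dotvDr x y z : dotv z (x + y) = dotv z x + dotv z y.
Proof. by rewrite dotvC dotvDl !(dotvC _ z). Qed.

Lemma dotvZr c x y : dotv y (c *: x) = c * dotv y x.
Proof. by rewrite dotvC dotvZl dotvC. Qed.

Lemma dotvNr x y : dotv y (- x) = - dotv y x.
Proof. by rewrite dotvC dotvNl dotvC. Qed.

Lemma dotv0l y : dotv 0 y = 0.
Proof. by rewrite -(scale0r 0) dotvZl mul0r. Qed.

Lemma dotv_suml (I : Type) (s : seq I) (f : I -> 'rV[R]_d) y :
  dotv (\sum_(i <- s) f i) y = \sum_(i <- s) dotv (f i) y.
Proof.
elim: s => [|i s IH]; first by rewrite !big_nil dotv0l.
by rewrite !big_cons dotvDl IH.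
Qed.

Lemma dotv_sumr (I : Type) (s : seq I) (f : I -> 'rV[R]_d) y :
  dotv y (\sum_(i <- s) f i) = \sum_(i <- s) dotv y (f i).
Proof. by rewrite dotvC dotv_suml; apply: eq_bigr => i _; rewrite dotvC. Qed.

Lemma sqnorm_ge0 x : 0 <= sqnorm x.
Proof. by apply: sumr_ge0 => k _; rewrite -expr2 sqr_ge0. Qed.

Lemma sqnormN x : sqnorm (- x) = sqnorm x.
Proof. by rewrite /sqnorm dotvNl dotvNr opprK. Qed.

Lemma sqnormZ c x : sqnorm (c *: x) = c ^+ 2 * sqnorm x.
Proof. by rewrite /sqnorm dotvZl dotvZr mulrA expr2. Qed.

Lemma sqnorm0 : sqnorm (0 : 'rV[R]_d) = 0.
Proof. exact: dotv0l. Qed.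

Lemma sqnormD x y : sqnorm (x + y) = sqnorm x + 2 * dotv x y + sqnorm y.
Proof. rewrite /sqnorm dotvDl !dotvDr (dotvC y x); ring. Qed.

Lemma sqnormB x y : sqnorm (x - y) = sqnorm x - 2 * dotv x y + sqnorm y.
Proof. rewrite sqnormD dotvNr sqnormN; ring. Qed.

Lemma sqnormB_le x y : sqnorm (x - y) <= 2 * sqnorm x + 2 * sqnorm y.
Proof.
have := sqnorm_ge0 (x + y); rewrite sqnormB sqnormD; lra.
Qed.

Lemma sqnormD_le x y : sqnorm (x + y) <= 2 * sqnorm x + 2 * sqnorm y.
Proof. by have := sqnormB_le x (- y); rewrite opprK sqnormN. Qed.

(** This is |e x - y|^2 >= 0 divided by e. A factor 1 + e close to 1 is what makes second moments
    continuous, and not merely bounded, under small transport costs. *)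
Lemma sqnormD_young (e : R) x y : 0 < e ->
  sqnorm (x + y) <= (1 + e) * sqnorm x + (1 + e^-1) * sqnorm y.
Proof.
move=> e0; have := sqnorm_ge0 (e *: x - y); rewrite sqnormB sqnormZ dotvZl => H.
rewrite sqnormD; have : 2 * dotv x y <= e * sqnorm x + e^-1 * sqnorm y; last lra.
rewrite -(ler_pM2l e0) mulrDr !mulrA mulfV ?gt_eqF// -expr2; lra.
Qed.

Lemma coord_sqr_le x k : x 0 k ^+ 2 <= sqnorm x.
Proof.
rewrite /sqnorm /dotv (bigD1 k)//= -expr2 lerDl.
by apply: sumr_ge0 => i _; rewrite -expr2 sqr_ge0.
Qed.

Lemma coord_norm_le x k : `|x 0 k| <= 1 + sqnorm x.
Proof.
have := coord_sqr_le x k; have : 0 <= (`|x 0 k| - 1) ^+ 2 by exact: sqr_ge0.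
rewrite sqrrB real_normK ?num_real// => H1 H2.
have := normr_ge0 (x 0 k); lra.
Qed.

Lemma sqnorm_eq0 x : sqnorm x = 0 -> x = 0.
Proof.
move=> x0; apply/rowP => k; rewrite mxE; apply/eqP; rewrite -sqrf_eq0.
by rewrite eq_le sqr_ge0 andbT -x0 coord_sqr_le.
Qed.

Lemma norm_sqr_le_sqnorm x : `|x| ^+ 2 <= sqnorm x.
Proof.
have [|] := boolP (`|x| == 0); first by move=> /eqP->; rewrite expr0n sqnorm_ge0.
move=> /mx_norm_neq0[[i k]]; rewrite ord1 -[mx_norm x]/`|x| => ->.
by rewrite real_normK ?num_real// coord_sqr_le.
Qed.

Lemma derive_grad (f : 'rV[R]_d -> R) x v : differentiable f x ->
  'D_v f x = dotv v (grad f x).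
Proof.
move=> df; rewrite deriveE// {1}(row_sum_delta v) linear_sum /dotv.
by apply: eq_bigr => k _; rewrite linearZ/= mxE deriveE.
Qed.

Lemma smooth_coord k : smooth (fun x : 'rV[R]_d => x 0 k).
Proof.
move=> j; have @f : {linear 'rV[R]_d -> R}.
  by exists (fun N : 'rV[R]_d => N 0 k); do 2![eexists]; do ?[constructor];
     rewrite ?mxE// => ? *; rewrite ?mxE//; move=> ?; rewrite !mxE.
apply: (@Ck_linear _ _ j f); exact: coord_continuous.
Qed.

Lemma smooth_sqnorm (V : normedModType R) (g : V -> 'rV[R]_d) x0 :
  (forall k, smooth (fun w => g w 0 k)) -> smooth (fun w => sqnorm (g w - x0)).
Proof.
move=> sg; apply: smooth_sum => k.
have : smooth (fun w => g w 0 k - x0 0 k) by apply: smoothB; [exact: sg|exact: smooth_cst].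
move=> s1; have := smoothM s1 s1.
by congr smooth; apply/funext => w; rewrite !mxE.
Qed.

Lemma derive_sqnorm x0 x v : 'D_v (fun z => sqnorm (z - x0)) x = 2 * dotv v (x - x0).
Proof.
have df : differentiable (fun z => sqnorm (z - x0)) x.
  by apply: smooth_differentiable; apply: smooth_sqnorm; exact: smooth_coord.
rewrite /derive.
apply: cvg_lim => //.
have h0 : (fun h : R => 2 * dotv v (x - x0) + h * sqnorm v) @ 0^' --> 2 * dotv v (x - x0).
  rewrite -[X in _ --> X]addr0; apply: cvgD; first exact: cvg_cst.
  rewrite -[X in _ --> X](mul0r (sqnorm v)); apply: cvgM; last exact: cvg_cst.
  exact: cvg_within.
apply: cvg_trans h0; apply: near_eq_cvg; near=> h.
have hn0 : h != 0 by near: h; exact: nbhs_dnbhs_neq.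
rewrite /= -addrA (sqnormD (h *: v)) sqnormZ dotvZl -![_ *: _]/(_ * _).
by field.
Unshelve. all: by end_near.
Qed.

End Dotv.

Section EvenPotential.
Context {R : realType} {d : nat} (f : 'rV[R]_d -> R) (k : R).
Implicit Types u v z : 'rV[R]_d.
Hypothesis df : forall z, differentiable f z.

Section Convex.
Hypothesis cf : convex_function (E := 'rV[R]_d) setT (fun z => f z - 2^-1 * k * sqnorm z).

(** Convexity between z and z + v; the quadratic part contributes s (1 - s) |v|^2, split here into
    its orders in s. *)
Lemma semiconvex_segment z v (s : R) : 0 <= s -> s <= 1 ->
  f (s *: v + z) - f z <= s * (f (z + v) - f z - 2^-1 * k * sqnorm v + 2^-1 * k * s * sqnorm v).
Proof.
move=> s0 s1; have := cf (Itv01 s0 s1) (in_setT (z + v)) (in_setT z).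
rewrite convRE /= /conv /= /onem.
rewrite (_ : s *: (z + v) + (1 - s) *: z = s *: v + z); last first.
  by rewrite scalerDr scalerBl scale1r [X in X + _]addrC -addrA subrKC.
rewrite !sqnormD sqnormZ dotvZl (dotvC z v); nra.
Qed.

(** The supporting inequality of a semiconvex function: divide the segment inequality by s and let s
    tend to 0. *)
Lemma semiconvex_derive z v : f z + 'D_v f z + 2^-1 * k * sqnorm v <= f (z + v).
Proof.
suff : 'D_v f z <= f (z + v) - f z - 2^-1 * k * sqnorm v by lra.
set M := 2^-1 * k * sqnorm v; apply/ler_addgt0Pr => e e0.
have : (fun h : R => h^-1 *: ((f \o shift z) (h *: v) - f z)) @ 0^' --> 'D_v f z.
  exact: (@diff_derivable _ _ _ f z v (df z)).
move=> /cvgrPdist_le /(_ (e / 2) (divr_gt0 e0 (ltr0n R 2))).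
move=> /nbhs_ballP[r /= r0 rP].
(* Small enough for three purposes: the difference quotient is within e/2 of the derivative, the
   segment inequality applies, and its remainder [s * M] is at most e/2. *)
pose s := Num.min (r / 2) (Num.min 1 (e / 2 / (`|M| + 1))).
have M1 : 0 < `|M| + 1 by rewrite ltr_wpDl.
have s0 : 0 < s by rewrite !lt_min ltr01 !divr_gt0.
have s1 : s <= 1 by rewrite !ge_min lexx orbT.
have sr : s <= r / 2 by rewrite ge_min lexx.
have sM : s * M <= e / 2.
  have : s <= e / 2 / (`|M| + 1) by rewrite !ge_min lexx !orbT.
  rewrite ler_pdivlMr// => H; apply: le_trans H.
  by rewrite ler_wpM2l ?(ltW s0)// (le_trans (ler_norm M))// lerDl.
have /rP : ball (0 : R) r s.
  by rewrite /ball/= sub0r normrN gtr0_norm// (le_lt_trans sr)// ltr_pdivrMr// ltr_pMr// ltr1n.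
move=> /(_ (lt0r_neq0 s0)); rewrite ler_norml => /andP[_].
rewrite -[_ *: (_ - _)]/(_ * _).
have := semiconvex_segment z v (ltW s0) s1; rewrite -/M.
rewrite -ler_pdivrMl// => H1 H2.
have : 2^-1 * k * s * sqnorm v = s * M by rewrite /M; ring.
by move=> H3; rewrite /= in H2; lra.
Qed.

End Convex.

Section Even.
Hypothesis fN : forall z, f (- z) = f z.

Lemma even_derive z v : 'D_v f (- z) = - 'D_v f z.
Proof.
transitivity ('D_(- v) f z); last by rewrite !deriveE// linearN.
rewrite /derive (_ : (fun h : R => h^-1 *: ((f \o shift (- z)) (h *: v) - f (- z))) =
  (fun h : R => h^-1 *: ((f \o shift z) (h *: (- v)) - f z)))//.
apply/funext => h /=.
by rewrite fN -[in LHS]fN opprD opprK scalerN.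
Qed.

Lemma even_grad z : grad f (- z) = - grad f z.
Proof. by apply/rowP => i; rewrite !mxE even_derive. Qed.

Lemma even_grad0 : grad f 0 = 0.
Proof.
have := even_grad 0; rewrite oppr0 => /eqP; rewrite -addr_eq0 -mulr2n -scaler_nat.
by rewrite scaler_eq0 pnatr_eq0 /= => /eqP.
Qed.

Hypothesis cf : convex_function (E := 'rV[R]_d) setT (fun z => f z - 2^-1 * k * sqnorm z).

(** Evenness makes the gradient vanish at 0, so that the supporting inequality there has no linear
    term. *)
Lemma even_semiconvex_ge z : f 0 + 2^-1 * k * sqnorm z <= f z.
Proof.
have := semiconvex_derive cf 0 z.
by rewrite derive_grad// even_grad0 dotvC dotv0l addr0 add0r.
Qed.

(** The supporting inequality at z in the direction -z reads f z - z . grad f z + k |z|^2 / 2 <= f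
    0; it is added to the lower bound of f by its value at 0. *)
Lemma even_semiconvex_grad z : k * sqnorm z <= dotv z (grad f z).
Proof.
have := semiconvex_derive cf z (- z); have := even_semiconvex_ge z.
rewrite subrr sqnormN derive_grad// dotvNl; lra.
Qed.

End Even.

(** The supporting inequality bounds the slope in the direction v by an increment of f, which the
    quadratic growth controls; v and -v give both signs. The vector v stays free, so that rescaling
    it trades its coefficient against that of |z|^2. *)
Lemma semiconvex_grad_growth (B : R) :
  convex_function (E := 'rV[R]_d) setT (fun z => f z - 2^-1 * k * sqnorm z) ->
  (forall z, `|f z| <= B * (1 + sqnorm z)) ->
  exists2 C, 0 <= C & forall z v, `|dotv v (grad f z)| <= C * (1 + sqnorm z + sqnorm v).
Proof.
move=> cf fB; have B0 : 0 <= B.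
  by have := le_trans (normr_ge0 _) (fB 0); rewrite sqnorm0 addr0 mulr1.
exists (3 * B + `|k|) => [|z v]; first by rewrite addr_ge0 ?mulr_ge0.
have key u : dotv u (grad f z) <= (3 * B + `|k|) * (1 + sqnorm z + sqnorm u).
  have := semiconvex_derive cf z u; rewrite derive_grad//.
  have := fB z; have := fB (z + u); have := sqnormD_le z u.
  have := sqnorm_ge0 z; have := sqnorm_ge0 u.
  move: (sqnorm z) (sqnorm u) (sqnorm (z + u)) (f z) (f (z + u)) => a b c p q.
  move=> b0 a0 cab; rewrite !ler_norml => /andP[_ q1] /andP[p1 _] H.
  have H1 : B * (1 + c) <= B * (1 + (2 * a + 2 * b)) by rewrite ler_wpM2l// lerD2l.
  have H2 : - (2^-1 * k * b) <= `|k| * b.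
    have : - k * b <= `|k| * b by rewrite ler_wpM2r// -normrN ler_norm.
    have : 0 <= `|k| * b by rewrite mulr_ge0.
    lra.
  have H3 : 0 <= `|k| * (1 + a) by rewrite mulr_ge0// addr_ge0.
  have H4 : 0 <= B * (1 + b) by rewrite mulr_ge0// addr_ge0.
  rewrite !mulrDl !mulrDr in H1 q1 p1 H2 H3 H4 *. lra.
rewrite ler_norml key andbT; have := key (- v); rewrite dotvNl sqnormN; lra.
Qed.

End EvenPotential.

(** * The modulus inequality *)

Section Modulus.
Context {R : realType} {n : nat}.
Implicit Types (m p : 'I_n -> R) (kappa : 'M[R]_n).

(** [fine] would send an infinite minimum to 0; an index satisfying [P] bounds it above, and a
    finite family of reals does not reach -oo. *)
Lemma minR_le (P : pred 'I_n) (F : 'I_n -> R) i : P i -> minR P F <= F i.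
Proof.
move=> Pi; rewrite /minR; set b := \big[_/_]_(_ < _ | _) _.
have bi : (b <= (F i)%:E)%E by rewrite /b; apply: bigmin_le_cond.
rewrite -lee_fin fineK// fin_numE; apply/andP; split; last first.
  by apply/eqP => bE; rewrite bE leye_eq in bi.
suff : (-oo < b)%E by rewrite ltNye.
by rewrite /b; apply: (big_ind (fun x => -oo < x)%E) => // [x y|j _];
  rewrite ?lt_min ?ltNyr// => -> ->.
Qed.

Context {d : nat}.

(** [D i j] stands for the double integral of |x - y|^2, [S i] and [M i] for second and first
    moments about the centre. The diagonal has no lower bound by [eta] and is treated apart, which
    is where the minimum with 0 in the modulus comes from. *)
Lemma modulus_inequality m p kappa (D : 'I_n -> 'I_n -> R) (S : 'I_n -> R)
    (M : 'I_n -> 'rV[R]_d) : (0 < n)%N ->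
  (forall j, 0 < m j) -> (forall j, 0 < p j) -> kappa^T = kappa ->
  (forall i j, D i j = p j * S i + p i * S j - 2 * dotv (M i) (M j)) ->
  (forall i j, 0 <= D i j) -> (forall i, 0 <= S i) ->
  \sum_i (m i)^-1 *: M i = 0 ->
  2 * lambda0 m p kappa * \sum_i (m i)^-1 * S i <= \sum_i \sum_j kappa i j * D i j.
Proof.
move=> n0 m0 p0 kS DE D0 S0 M0.
have mV0 i : 0 < (m i)^-1 by rewrite invr_gt0.
have DC i j : D i j = D j i by rewrite !DE dotvC; ring.
have kC i j : kappa i j = kappa j i by rewrite -[in LHS]kS mxE.
(* For a single species the centring forces M = 0, hence D = 2 p S, and equality holds. *)
rewrite /lambda0; case: ifPn => [n1|]; last first.
  rewrite -leqNgt => n1; have nE : n = 1%N by apply/eqP; rewrite eqn_leq n1.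
  move: (m) (p) kappa D S M m0 p0 kS DE D0 S0 M0 mV0 DC kC; rewrite {}nE.
  move=> m' p' ka D' S' M' m0 p0 kS DE D0 S0 M0 mV0 DC kC.
  rewrite !big_ord1 DE; move: M0; rewrite big_ord1 => /eqP.
  rewrite scaler_eq0 invr_eq0 gt_eqF//= => /eqP->; rewrite dotv0l.
  rewrite le_eqVlt; apply/orP; left; apply/eqP; field; exact: lt0r_neq0.
set L := minR _ _; pose e := eta m kappa.
pose A i := p i * Num.min 0 (m i * kappa i i - e i) +
   2^-1 * \sum_j p j * (e j + e i * (m i / m j)).
have LA i : L <= A i by exact: (@minR_le xpredT).
have ek i j : j != i -> e i <= kappa i j * m j.
  by move=> ji; apply: (@minR_le (fun j => j != i) (fun j => kappa i j * m j)).
have kge i j : j != i -> 2^-1 * (e i / m j + e j / m i) <= kappa i j.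
  move=> ji; have : e i / m j <= kappa i j by rewrite ler_pdivrMr// ek.
  have : e j / m i <= kappa i j by rewrite ler_pdivrMr// kC ek// eq_sym.
  lra.
(* Besides M j only the factor 1/m_j depends on j, so that the inner sum is the weighted centre of
   mass, which is 0. *)
have cross : \sum_i \sum_j e i / m j * dotv (M i) (M j) = 0.
  apply: big1 => i _; transitivity (e i * dotv (M i) (\sum_j (m j)^-1 *: M j)).
    rewrite dotv_sumr mulr_sumr; apply: eq_bigr => j _; rewrite dotvZr; ring.
  by rewrite M0 dotvC dotv0l mulr0.
(* By symmetry of D the two halves of the weight contribute equally; expanding D then leaves second
   moments only, and exchanging i and j collects them on S i. *)
have sumD : \sum_i \sum_j 2^-1 * (e i / m j + e j / m i) * D i j =
    \sum_i (m i)^-1 * S i * \sum_j p j * (e j + e i * (m i / m j)).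
  transitivity (\sum_i \sum_j e i / m j * D i j).
    transitivity (2^-1 * (\sum_i \sum_j e i / m j * D i j) +
                  2^-1 * (\sum_i \sum_j e j / m i * D i j)).
      rewrite !mulr_sumr -big_split; apply: eq_bigr => i _ /=.
      rewrite !mulr_sumr -big_split; apply: eq_bigr => j _ /=; ring.
    have -> : \sum_i \sum_j e j / m i * D i j = \sum_i \sum_j e i / m j * D i j.
      by rewrite exchange_big; do 2! (apply: eq_bigr => ? _); rewrite DC.
    by rewrite -mulrDl -[RHS]mul1r; congr (_ * _); field.
  transitivity (\sum_i \sum_j e i / m j * (p j * S i) +
                \sum_i \sum_j e i / m j * (p i * S j)).
    transitivity (\sum_i \sum_j e i / m j * D i j +
        2 * \sum_i \sum_j e i / m j * dotv (M i) (M j)).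
      by rewrite cross mulr0 addr0.
    rewrite mulr_sumr -!big_split.
    apply: eq_bigr => i _ /=; rewrite mulr_sumr -!big_split.
    apply: eq_bigr => j _ /=; rewrite DE; ring.
  rewrite [X in _ + X]exchange_big -big_split; apply: eq_bigr => i _ /=.
  rewrite mulr_sumr -big_split; apply: eq_bigr => j _ /=.
  by field; rewrite !lt0r_neq0.
apply: (@le_trans _ _ (\sum_i (2 * ((m i)^-1 * S i) * A i))).
  rewrite mulr_sumr; apply: ler_sum => i _.
  rewrite mulrAC ler_wpM2l// !mulr_ge0//; exact: ltW.
apply: (@le_trans _ _ (\sum_i \sum_j 2^-1 * (e i / m j + e j / m i) * D i j +
    \sum_i (kappa i i - e i / m i) * D i i)).
  rewrite sumD -big_split; apply: ler_sum => i _ /=; rewrite /A mulrDr [leLHS]addrC.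
  apply: lerD.
    rewrite le_eqVlt; apply/orP; left; apply/eqP; field; exact: lt0r_neq0.
  have Dii : D i i <= 2 * p i * S i by rewrite DE; have := sqnorm_ge0 (M i); rewrite /sqnorm; lra.
  have -> : kappa i i - e i / m i = (m i)^-1 * (m i * kappa i i - e i).
    by field; exact: lt0r_neq0.
  (* A nonnegative q is discarded using D i i >= 0; a negative one needs the upper bound 2 p i S i
     of D i i, obtained by dropping -2 |M i|^2. *)
  set q := _ - _; have Ki := mV0 i; have Di := D0 i i.
  have [q0|q0] := leP 0 q.
    by rewrite !mulr0 !mulr_ge0// ltW.
  have : (m i)^-1 * q * (2 * p i * S i) <= (m i)^-1 * q * D i i.
    by rewrite ler_wnM2l// pmulr_rle0// ltW.
  lra.
rewrite -big_split; apply: ler_sum => i _ /=.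
rewrite (bigD1 i)//= [leRHS](bigD1 i)//= addrAC lerD//.
  rewrite -mulrDl ler_wpM2r// le_eqVlt; apply/orP; left; apply/eqP.
  field; exact: lt0r_neq0.
by apply: ler_sum => j ji; rewrite ler_wpM2r// kge.
Qed.

End Modulus.

(** * Second moments *)

Section FinitePart.
Context d (T : measurableType d) (R : realType).
Implicit Types mu : {measure set T -> \bar R}.

(* A total version of [finm], equal to the zero measure on infinite measures. *)
Definition finpart mu : {finite_measure set T -> \bar R} :=
  match pselect (mu setT < +oo)%E with
  | left h => finm h
  | right _ => @mzero _ T R
  end.

Lemma finpartE mu : (mu setT < +oo)%E -> finpart mu = mu :> (set T -> \bar R).
Proof. by rewrite /finpart; case: pselect. Qed.

Lemma integral_finpart mu D (f : T -> \bar R) : (mu setT < +oo)%E ->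
  (\int[finpart mu]_(x in D) f x = \int[mu]_(x in D) f x)%E.
Proof. by rewrite /finpart; case: pselect. Qed.

Lemma Rintegral_finpart mu (f : T -> R) : (mu setT < +oo)%E ->
  \int[finpart mu]_x f x = \int[mu]_x f x.
Proof. by move=> h; rewrite /Rintegral integral_finpart. Qed.

End FinitePart.

Section SecondMoment.
Context {R : realType} {d : nat}.
Notation BV := (borel_rV R d).
Notation meas := {measure set BV -> \bar R}.
Notation fmeas := {finite_measure set BV -> \bar R}.
Implicit Types (a x y : 'rV[R]_d).

Definition has_mom2 (mu : meas) := (\int[mu]_x (sqnorm (x : 'rV[R]_d))%:E < +oo)%E.

Lemma mom2_integrable (mu : fmeas) (f : 'rV[R]_d -> R) (c : R) : has_mom2 mu ->
  measurable_fun setT (f : BV -> R) -> (forall x, `|f x| <= c * (1 + sqnorm x)) ->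
  mu.-integrable setT (EFin \o (f : BV -> R)).
Proof.
move=> mu2 mf fc; apply: (integrable_dominated mf fc).
apply: integrableZ_R; apply: integrableD_R.
  exact: finite_measure_integrable_cst.
apply: ge0_integrable mu2 => [|x]; last exact: sqnorm_ge0.
exact: measurable_sqnorm.
Qed.

Lemma mom2_prod_integrable (mu nu : fmeas) (f : 'rV[R]_d * 'rV[R]_d -> R) (c : R) :
  has_mom2 mu -> has_mom2 nu ->
  measurable_fun setT (f : BV * BV -> R) ->
  (forall x y, `|f (x, y)| <= c * (1 + sqnorm x + sqnorm y)) ->
  (mu \x nu)%E.-integrable setT (EFin \o (f : BV * BV -> R)).
Proof.
move=> mu2 nu2 mf fc.
apply: (@integrable_dominated _ _ _ _ _ (fun z : BV * BV =>
  c * (1 + sqnorm (z.1 : 'rV[R]_d) + sqnorm (z.2 : 'rV[R]_d)))) => //.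
  by case=> x y; exact: fc.
have ms : measurable_fun setT (fun x : BV => sqnorm (x : 'rV[R]_d)) by exact: measurable_sqnorm.
have s0 (x : BV) : 0 <= sqnorm (x : 'rV[R]_d) by exact: sqnorm_ge0.
apply: integrableZ_R; apply: integrableD_R; last first.
  by apply: (@prod_integrable_snd _ _ _ _ _ mu nu (fun x => sqnorm (x : 'rV[R]_d)));
    exact: ge0_integrable.
apply: integrableD_R; first exact: prod_integrable_cst.
by apply: (@prod_integrable_fst _ _ _ _ _ mu nu (fun x => sqnorm (x : 'rV[R]_d)));
  exact: ge0_integrable.
Qed.

Lemma measurable_prod_sub :
  measurable_fun setT ((fun z : BV * BV => (z.1 : 'rV[R]_d) - z.2) : _ -> BV).
Proof. by apply: measurable_sub_rV; [exact: measurable_fst|exact: measurable_snd]. Qed.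

Definition mom1 (mu : meas) a : 'rV[R]_d :=
  \row_(k < d) \int[mu]_x (((x : 'rV[R]_d) - a) 0 k).
Definition mom2 (mu : meas) a : R := \int[mu]_x sqnorm ((x : 'rV[R]_d) - a).

Lemma integrable_coord (mu : fmeas) a k : has_mom2 mu ->
  mu.-integrable setT (EFin \o (fun x : BV => ((x : 'rV[R]_d) - a) 0 k)).
Proof.
move=> mu2; apply: (@mom2_integrable _ _ (2 + 2 * sqnorm a)) => //.
  apply: (measurableT_comp (measurable_coord k)).
  by apply: measurable_sub_rV => //; exact: measurable_cst.
move=> x; apply: (le_trans (coord_norm_le _ _)).
have := sqnormB_le x a; have := sqnorm_ge0 x; have := sqnorm_ge0 a; nra.
Qed.

Lemma integrable_sqnorm (mu : fmeas) a : has_mom2 mu ->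
  mu.-integrable setT (EFin \o (fun x : BV => sqnorm ((x : 'rV[R]_d) - a))).
Proof.
move=> mu2; apply: (@mom2_integrable _ _ (2 + 2 * sqnorm a)) => //.
  by apply: measurable_sqnorm; apply: measurable_sub_rV => //; exact: measurable_cst.
move=> x; rewrite ger0_norm ?sqnorm_ge0//.
have := sqnormB_le x a; have := sqnorm_ge0 x; have := sqnorm_ge0 a; nra.
Qed.

Lemma mom2_ge0 (mu : meas) a : 0 <= mom2 mu a.
Proof. by apply: Rintegral_ge0 => x _; exact: sqnorm_ge0. Qed.

Lemma mom2E (mu : fmeas) a : has_mom2 mu ->
  (\int[mu]_x (sqnorm ((x : 'rV[R]_d) - a))%:E = (mom2 mu a)%:E)%E.
Proof.
move=> mu2; rewrite /mom2 /Rintegral fineK//; apply: integrable_fin_num => //.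
exact: integrable_sqnorm.
Qed.

Lemma prod_sqnorm_integrable (mu nu : fmeas) : has_mom2 mu -> has_mom2 nu ->
  (mu \x nu)%E.-integrable setT
    (EFin \o (fun z : BV * BV => sqnorm ((z.1 : 'rV[R]_d) - z.2))).
Proof.
move=> mu2 nu2; apply: (@mom2_prod_integrable _ _ (fun z => sqnorm (z.1 - z.2)) 2) => //.
  by apply: measurable_sqnorm; exact: measurable_prod_sub.
move=> x y /=; rewrite ger0_norm ?sqnorm_ge0//.
have := sqnormB_le x y; lra.
Qed.

Lemma prod_sqnormB (mu nu : fmeas) a : has_mom2 mu -> has_mom2 nu ->
  \int[(mu \x nu)%E]_z sqnorm ((z.1 : 'rV[R]_d) - z.2) =
  fine (nu setT) * mom2 mu a + fine (mu setT) * mom2 nu a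
   - 2 * dotv (mom1 mu a) (mom1 nu a).
Proof.
move=> mu2 nu2.
have I1 := integrable_sqnorm a mu2; have I2 := integrable_sqnorm a nu2.
have J1 := @prod_integrable_fst _ _ _ _ _ mu nu _ I1.
have J2 := @prod_integrable_snd _ _ _ _ _ mu nu _ I2.
have K k : (mu \x nu)%E.-integrable setT (EFin \o (fun z : BV * BV =>
    ((z.1 : 'rV[R]_d) - a) 0 k * ((z.2 : 'rV[R]_d) - a) 0 k)).
  apply: (@mom2_prod_integrable _ _ (fun z => (z.1 - a) 0 k * (z.2 - a) 0 k)
     (4 + 4 * sqnorm a)) => //.
    apply: measurable_funM; apply: (measurableT_comp (measurable_coord k)).
      by apply: measurable_sub_rV; [exact: measurable_fst|exact: measurable_cst].
    by apply: measurable_sub_rV; [exact: measurable_snd|exact: measurable_cst].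
  move=> x y /=; rewrite normrM.
  have h1 := coord_sqr_le (x - a) k; have h2 := coord_sqr_le (y - a) k.
  have h3 : `|(x - a) 0 k| * `|(y - a) 0 k| <= (x - a) 0 k ^+ 2 + (y - a) 0 k ^+ 2.
    rewrite -(real_normK (num_real ((x - a) 0 k))) -(real_normK (num_real ((y - a) 0 k))).
    have := sqr_ge0 (`|(x - a) 0 k| - `|(y - a) 0 k|).
    have := mulr_ge0 (normr_ge0 ((x - a) 0 k)) (normr_ge0 ((y - a) 0 k)).
    rewrite sqrrB mulr2n; lra.
  have := sqnormB_le x a; have := sqnormB_le y a.
  have := sqnorm_ge0 x; have := sqnorm_ge0 a; have := sqnorm_ge0 y; nra.
transitivity (\int[(mu \x nu)%E]_z (sqnorm ((z.1 : 'rV[R]_d) - a) +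
   sqnorm ((z.2 : 'rV[R]_d) - a) + (-2) * \sum_(k < d)
     (((z.1 : 'rV[R]_d) - a) 0 k * ((z.2 : 'rV[R]_d) - a) 0 k))).
  apply: eq_Rintegral => -[x y] _ /=.
  have -> : x - y = (x - a) - (y - a) by rewrite opprB addrA subrK.
  rewrite sqnormB /dotv; ring.
rewrite RintegralD//; last 2 first.
- exact: integrableD_R.
- by apply: integrableZ_R; exact: integrable_sum_R.
rewrite RintegralD//; congr (_ + _ + _).
- exact: (prod_Rintegral_fst nu I1).
- exact: (prod_Rintegral_snd mu I2).
rewrite RintegralZl//; last exact: integrable_sum_R.
rewrite Rintegral_sum// mulNr; congr (- (2 * _)).
apply: eq_bigr => k _; rewrite !mxE.
apply: (@prod_Rintegral_mul _ _ _ _ _ mu nu (fun x : BV => ((x : 'rV[R]_d) - a) 0 k)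
  (fun x : BV => ((x : 'rV[R]_d) - a) 0 k)) => //; exact: integrable_coord.
Qed.

End SecondMoment.

Section PSpace.
Context {R : realType} {d n : nat}.
Notation BV := (borel_rV R d).
Variables (m p : 'I_n -> R) (E : 'rV[R]_d).
Hypotheses (m0 : forall j, 0 < m j) (p0 : forall j, 0 < p j) (n0 : (0 < n)%N).
Implicit Types mu nu : 'I_n -> measure_rV R d.
Notation xo := (x_infty m p E).

Definition lyap mu : R := \sum_j (m j)^-1 * mom2 (mu j) xo.

Section InP.
Variable mu : 'I_n -> measure_rV R d.
Hypothesis Pmu : in_P m p E mu.

Lemma in_P_mass j : mu j setT = (p j)%:E. Proof. by case: Pmu. Qed.

Lemma in_P_finite j : (mu j setT < +oo)%E.
Proof. by rewrite in_P_mass ltry. Qed.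

Lemma in_P_mom2 j : has_mom2 (mu j). Proof. by case: Pmu => _ + _; exact. Qed.

Lemma finpart_mass j : finpart (mu j) setT = (p j)%:E.
Proof. by rewrite (finpartE (in_P_finite j)) in_P_mass. Qed.

Let finpart_mass_measure j :
  (finpart (mu j) : {measure set BV -> \bar R}) setT = (p j)%:E.
Proof. exact: finpart_mass. Qed.

Lemma finpart_mom2 j : has_mom2 (finpart (mu j)).
Proof. by rewrite /has_mom2 (integral_finpart _ _ (in_P_finite j)); exact: in_P_mom2. Qed.

Lemma mom2_finpart a j : mom2 (finpart (mu j)) a = mom2 (mu j) a.
Proof. exact: (Rintegral_finpart _ (in_P_finite j)). Qed.

Lemma mass_weight_gt0 : 0 < \sum_j p j / m j.
Proof.
rewrite (bigD1 (Ordinal n0))//= ltr_wpDr ?divr_gt0//.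
by apply: sumr_ge0 => j _; rewrite divr_ge0// ltW.
Qed.

(** [x_infty] is the point for which this holds: the left-hand side is E minus sum_j p_j / m_j times
    that point. *)
Lemma centered : \sum_i (m i)^-1 *: mom1 (finpart (mu i)) xo = 0.
Proof.
have [_ _ EE] := Pmu.
have mom1E i : mom1 (finpart (mu i)) xo =
    (\row_(k < d) \int[mu i]_x ((x : 'rV[R]_d) 0 k)) - p i *: xo.
  apply/rowP => k; rewrite !mxE.
  under eq_Rintegral do rewrite !mxE.
  have Ik : (finpart (mu i)).-integrable setT (EFin \o (fun x : BV => (x : 'rV[R]_d) 0 k)).
    have := integrable_coord 0 k (finpart_mom2 i).
    by apply: eq_integrable => // x _ /=; rewrite !mxE subr0.
  rewrite RintegralB//; last exact: finite_measure_integrable_cst.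
  rewrite Rintegral_finpart; last exact: in_P_finite.
  by rewrite Rintegral_cst// finpart_mass_measure mulrC.
under eq_bigr do rewrite mom1E scalerBr scalerA.
rewrite sumrB EE -scaler_suml /x_infty scalerA.
rewrite (eq_bigr (fun i => p i / m i)) => [|i _]; last by rewrite mulrC.
by rewrite mulfV ?gt_eqF ?mass_weight_gt0// scale1r subrr.
Qed.

Lemma lyap_ge0 : 0 <= lyap mu.
Proof. by apply: sumr_ge0 => j _; rewrite mulr_ge0 ?invr_ge0 ?(ltW (m0 j))// mom2_ge0. Qed.

Lemma modulus_lyap (kappa : 'M[R]_n) : kappa^T = kappa ->
  2 * lambda0 m p kappa * lyap mu <=
  \sum_i \sum_j kappa i j *
     \int[(finpart (mu i) \x finpart (mu j))%E]_z sqnorm ((z.1 : 'rV[R]_d) - z.2).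
Proof.
move=> kS.
rewrite /lyap; under eq_bigr do rewrite -mom2_finpart.
apply: (modulus_inequality (S := fun i => mom2 (finpart (mu i)) xo)
  (M := fun i => mom1 (finpart (mu i)) xo)) => //.
- by move=> i j; rewrite (prod_sqnormB xo (finpart_mom2 i) (finpart_mom2 j)) !finpart_mass.
- by move=> i j; apply: Rintegral_ge0 => z _; exact: sqnorm_ge0.
- by move=> i; exact: mom2_ge0.
- exact: centered.
Qed.

(** A vanishing second moment about a makes |x - a|^2 zero almost everywhere, so the complement of
    the point is null and carries none of the mass. *)
Lemma mom2_eq0_dirac j a : mom2 (mu j) a = 0 ->
  forall A : set BV, measurable A -> mu j A = ((p j)%:E * dirac (a : BV) A)%E.
Proof.
move=> S0 A mA.
have F2 := finpart_mom2 j; have finj := in_P_finite j.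
have := mom2E a F2; rewrite mom2_finpart S0 => I0.
pose N := ~` [set (a : BV)].
have mN : measurable N by apply: measurableC; exact: measurable_set1_rV.
have ms : measurable_fun setT (fun x : BV => (sqnorm ((x : 'rV[R]_d) - a))%:E).
  apply/measurable_EFinP; apply: measurable_sqnorm.
  by apply: measurable_sub_rV => //; exact: measurable_cst.
have muN : mu j N = 0.
  have : \forall x \ae finpart (mu j), setT x -> (sqnorm ((x : 'rV[R]_d) - a))%:E = 0%E.
    apply/(ae_eq_integral_abs _ measurableT ms); rewrite -[RHS]I0.
    by apply: eq_integral => x _; rewrite gee0_abs// lee_fin sqnorm_ge0.
  move=> [Z [mZ Z0 NZ]].
  apply/eqP; rewrite eq_le measure_ge0 andbT -(finpartE finj) -[leRHS]Z0.
  apply: le_measure; rewrite ?inE// => x Nx; apply: NZ => /= /(_ I) [] /sqnorm_eq0/eqP.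
  by rewrite subr_eq0 => /eqP; exact: Nx.
have split B : measurable B -> mu j B = (mu j (B `&` [set (a : BV)]) + mu j (B `&` N))%E.
  move=> mB; rewrite -measureU//.
  - by rewrite -setIUr setUCr setIT.
  - by apply: measurableI => //; exact: measurable_set1_rV.
  - exact: measurableI.
  - by rewrite setIACA setICr setI0.
have BN B : measurable B -> mu j (B `&` N) = 0.
  move=> mB; apply/eqP; rewrite eq_le measure_ge0 andbT -muN.
  by apply: le_measure; rewrite ?inE//; exact: measurableI.
rewrite (split _ mA) BN// adde0 diracE.
case: (boolP ((a : BV) \in A)) => [|] aA.
  rewrite mule1 -in_P_mass (split _ measurableT) BN// adde0 setTI.
  by congr (mu j _); apply/seteqP; split=> x /= => [[]//|->]; split=> //; exact/set_mem.
rewrite mule0 (_ : _ `&` _ = set0) ?measure0//.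
apply/seteqP; split=> x //= [Ax xa]; by move: aA; rewrite -xa => /negP; apply; exact/mem_set.
Qed.

End InP.

Notation muo := (mu_infty m p0 E).

Lemma lyap_eq0 mu : in_P m p E mu -> lyap mu = 0 -> same_measures mu muo.
Proof.
move=> Pmu L0 j A mA; apply: (mom2_eq0_dirac Pmu) => //.
have /eqP := L0; rewrite psumr_eq0; last first.
  by move=> i _; rewrite mulr_ge0 ?invr_ge0 ?(ltW (m0 i))// mom2_ge0.
move=> /allP /(_ j); rewrite mem_index_enum => /(_ isT).
by rewrite mulf_eq0 invr_eq0 gt_eqF//= => /eqP.
Qed.

Lemma Rintegral_mu_infty (f : 'rV[R]_d -> R) j :
  measurable_fun setT (f : BV -> R) -> \int[muo j]_x f (x : 'rV[R]_d) = p j * f xo.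
Proof.
move=> mf; have mf' : measurable_fun setT (EFin \o (f : BV -> R)) by exact/measurable_EFinP.
rewrite /Rintegral /mu_infty.
rewrite integralE !ge0_integral_mscale//; last 2 first.
- exact: measurable_funeneg.
- exact: measurable_funepos.
rewrite !integral_dirac//; last 2 first.
- exact: measurable_funeneg.
- exact: measurable_funepos.
rewrite diracT !mul1e funeposE funenegE /= -!EFin_max -!EFinM -EFinB /=.
rewrite -mulrBr; congr (_ * _).
by have [f0|f0] := leP (f xo) 0; have [f1|f1] := leP (- f xo) 0; lra.
Qed.

Lemma mu_infty_in_P : in_P m p E muo.
Proof.
split.
- by move=> j; rewrite -[LHS]/((p j)%:E * dirac (xo : BV) setT)%E diracT mule1.
- move=> j; rewrite ge0_integral_mscale//=; last 2 first.
  + by apply/measurable_EFinP; exact: measurable_sqnorm.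
  + by move=> x _; rewrite lee_fin sqnorm_ge0.
  rewrite integral_dirac//; last by apply/measurable_EFinP; exact: measurable_sqnorm.
  by rewrite diracT mul1e -EFinM ltry.
- transitivity (\sum_j (p j / m j) *: xo).
    apply: eq_bigr => j _; rewrite [p j / _]mulrC -scalerA; congr (_ *: _).
    apply/rowP => k; rewrite mxE [RHS]mxE.
    exact: (Rintegral_mu_infty j (@measurable_coord R d k)).
  by rewrite -scaler_suml /x_infty scalerA mulfV ?scale1r// gt_eqF// mass_weight_gt0.
Qed.

End PSpace.

(** * The transport distance *)

Section Transport.
Context {R : realType} {d : nat}.
Notation BV := (borel_rV R d).
Notation meas := {measure set BV -> \bar R}.
Notation cost gamma := (\int[gamma]_z (sqnorm (z.1 - z.2 : 'rV[R]_d))%:E)%E.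
Implicit Types mu nu : meas.

Lemma coupling_fst_integral mu nu gamma : couplings mu nu gamma ->
  forall f : 'rV[R]_d -> R, measurable_fun setT (f : BV -> R) -> (forall x, 0 <= f x) ->
  (\int[mu]_x (f x)%:E = \int[gamma]_z (f z.1)%:E)%E.
Proof.
move=> cg f mf f0.
apply: (@image_integral_ge0 _ _ _ _ R gamma mu (fun z : BV * BV => z.1)) => //.
  exact: measurable_fst.
by move=> A mA; have [/esym] := cg A mA.
Qed.

Lemma coupling_snd_integral mu nu gamma : couplings mu nu gamma ->
  forall f : 'rV[R]_d -> R, measurable_fun setT (f : BV -> R) -> (forall x, 0 <= f x) ->
  (\int[nu]_x (f x)%:E = \int[gamma]_z (f z.2)%:E)%E.
Proof.
move=> cg f mf f0.
apply: (@image_integral_ge0 _ _ _ _ R gamma nu (fun z : BV * BV => z.2)) => //.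
  exact: measurable_snd.
by move=> A mA; have [_ /esym] := cg A mA.
Qed.

Lemma measurable_cost : measurable_fun setT (fun z : BV * BV => sqnorm (z.1 - z.2 : 'rV[R]_d)).
Proof. by apply: measurable_sqnorm; exact: measurable_prod_sub. Qed.

Lemma cost_lty mu nu gamma : has_mom2 mu -> has_mom2 nu -> couplings mu nu gamma ->
  (cost gamma < +oo)%E.
Proof.
move=> mu2 nu2 cg.
have ms : measurable_fun setT (fun x : BV => sqnorm (x : 'rV[R]_d)) by exact: measurable_sqnorm.
have m1 : measurable_fun setT (fun z : BV * BV => (2 * sqnorm (z.1 : 'rV[R]_d))%:E).
  apply/measurable_EFinP; apply: measurable_funM; first exact: measurable_cst.
  by apply: (measurableT_comp ms).
have m2 : measurable_fun setT (fun z : BV * BV => (2 * sqnorm (z.2 : 'rV[R]_d))%:E).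
  apply/measurable_EFinP; apply: measurable_funM; first exact: measurable_cst.
  by apply: (measurableT_comp ms).
have s0 (x : BV) : 0 <= sqnorm (x : 'rV[R]_d) by exact: sqnorm_ge0.
apply: (@le_lt_trans _ _ (\int[gamma]_z ((2 * sqnorm (z.1 : 'rV[R]_d))%:E +
   (2 * sqnorm (z.2 : 'rV[R]_d))%:E))%E).
  apply: ge0_le_integral => //.
  - by move=> z _; rewrite lee_fin sqnorm_ge0.
  - by apply/measurable_EFinP; exact: measurable_cost.
  - exact: emeasurable_funD.
  - by move=> z _; rewrite lee_fin sqnormB_le.
rewrite ge0_integralD//; last 2 first.
- by move=> z _; rewrite lee_fin mulr_ge0.
- by move=> z _; rewrite lee_fin mulr_ge0.
have I1 := @coupling_fst_integral mu nu gamma cg _ ms s0.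
have I2 := @coupling_snd_integral mu nu gamma cg _ ms s0.
under eq_integral do rewrite EFinM.
under [X in (_ + X)%E]eq_integral do rewrite EFinM.
rewrite !ge0_integralZl//=; last 4 first.
- by apply/measurable_EFinP; exact: (measurableT_comp ms).
- by move=> z _; rewrite lee_fin.
- by apply/measurable_EFinP; exact: (measurableT_comp ms).
- by move=> z _; rewrite lee_fin.
rewrite -I1 -I2; apply: lte_add_pinfty; rewrite lte_mul_pinfty//.
Qed.

(** Both measures have mass c, so the marginals of their product are c times too large; hence the
    factor 1/c. *)
Lemma product_coupling (c : R) mu nu : 0 < c -> mu setT = c%:E -> nu setT = c%:E ->
  exists gamma, couplings mu nu gamma.
Proof.
move=> c0 muT nuT.
have mufin : (mu setT < +oo)%E by rewrite muT ltry.
have nufin : (nu setT < +oo)%E by rewrite nuT ltry.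
have c0' : 0 <= c^-1 by rewrite invr_ge0 ltW.
pose mu' := finpart mu; pose nu' := finpart nu.
pose g := mscale (NngNum c0') (mu' \x nu')%E : {measure set (BV * BV)%type -> \bar R}.
have gX A B : measurable A -> measurable B -> g (A `*` B) = (c^-1%:E * (mu A * nu B))%E.
  move=> mA mB; rewrite -(finpartE mufin) -(finpartE nufin).
  by rewrite -(product_measure1E mu' nu' mA mB).
have gT : (g setT < +oo)%E.
  by rewrite -setXTT gX// muT nuT -!EFinM ltry.
exists (finm gT) => A mA; rewrite finmE; split.
  by rewrite -setXT gX// nuT muleCA -EFinM mulVf ?gt_eqF// mule1.
by rewrite -setTX gX// muT muleA -EFinM mulVf ?gt_eqF// mul1e.
Qed.

(** The second marginal charges only a, so z.2 = a almost everywhere and the cost depends on the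
    first marginal alone. *)
Lemma cost_dirac mu (c : R) (hc : 0 <= c) (a : 'rV[R]_d) gamma :
  couplings mu (mscale (NngNum hc) (dirac (a : BV))) gamma ->
  cost gamma = (\int[mu]_x (sqnorm ((x : 'rV[R]_d) - a))%:E)%E.
Proof.
move=> cg.
have ms : measurable_fun setT (fun x : BV => sqnorm ((x : 'rV[R]_d) - a)).
  by apply: measurable_sqnorm; apply: measurable_sub_rV => //; exact: measurable_cst.
rewrite (coupling_fst_integral cg ms) => [|x]; last exact: sqnorm_ge0.
have mN : measurable (~` [set (a : BV)]) by apply: measurableC; exact: measurable_set1_rV.
apply: ae_eq_integral => //.
- by apply/measurable_EFinP; exact: measurable_cost.
- by apply/measurable_EFinP; exact: (measurableT_comp ms).
exists (snd @^-1` (~` [set (a : BV)])); split.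
- by rewrite -[X in measurable X]setTI; exact: measurable_snd.
- have [_ e] := cg _ mN; apply: (etrans e); rewrite -[LHS]/(c%:E * dirac (a : BV) (~` [set (a : BV)]))%E.
  rewrite diracE (_ : (_ \in _) = false) ?mule0//.
  by apply/negbTE/negP => /set_mem; exact.
- by move=> z /= Hz za; apply: Hz => _; rewrite za.
Qed.

(** The infimum runs over a set with a single value, and the product coupling shows that this set is
    not empty. *)
Lemma transport_cost_dirac mu (c : R) (hc : 0 <= c) (a : 'rV[R]_d) :
  0 < c -> mu setT = c%:E ->
  transport_cost mu (mscale (NngNum hc) (dirac (a : BV))) =
  (\int[mu]_x (sqnorm ((x : 'rV[R]_d) - a))%:E)%E.
Proof.
move=> c0 muT.
rewrite /transport_cost (_ : [set _ | _ in _] =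
  [set (\int[mu]_x (sqnorm ((x : 'rV[R]_d) - a))%:E)%E]) ?ereal_inf1//.
apply/seteqP; split=> [_ [g cg <-]|_ ->] /=; first exact: (cost_dirac cg).
have [|g cg] := @product_coupling c mu (mscale (NngNum hc) (dirac (a : BV))) c0 muT.
  by rewrite -[LHS]/(c%:E * dirac (a : BV) setT)%E diracT mule1.
by exists g => //; exact: (cost_dirac cg).
Qed.

End Transport.

Section WPfacts.
Context {R : realType} {d n : nat}.
Notation BV := (borel_rV R d).
Variables (m p : 'I_n -> R) (E : 'rV[R]_d).
Hypotheses (m0 : forall j, 0 < m j) (p0 : forall j, 0 < p j) (n0 : (0 < n)%N).
Implicit Types mu nu : 'I_n -> measure_rV R d.
Notation muo := (mu_infty m p0 E).

Lemma transport_cost_ge0 (mu nu : measure_rV R d) : (0 <= transport_cost mu nu)%E.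
Proof.
apply: le_ereal_inf_tmp => _ [g _ <-]; apply: integral_ge0 => z _.
by rewrite lee_fin sqnorm_ge0.
Qed.

Lemma WP_ge0 mu nu : 0 <= WP m mu nu.
Proof. exact: sqrtr_ge0. Qed.

Lemma WP_mu_infty mu : in_P m p E mu -> WP m mu muo = Num.sqrt (lyap m p E mu).
Proof.
move=> Pmu; rewrite /WP; congr Num.sqrt; apply: eq_bigr => j _; congr (_ * _).
rewrite /mu_infty transport_cost_dirac//; last exact: (in_P_mass Pmu).
Qed.

Lemma WP_sqr mu nu : WP m mu nu ^+ 2 =
  \sum_j (m j)^-1 * fine (transport_cost (mu j) (nu j)).
Proof.
rewrite sqr_sqrtr//; apply: sumr_ge0 => j _.
by rewrite mulr_ge0 ?invr_ge0 ?(ltW (m0 j))// fine_ge0// transport_cost_ge0.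
Qed.

(** The strict inequality leaves room above the infimum of each species, hence a coupling whose cost
    lies in between. *)
Lemma WP_coupling mu nu (r : R) : in_P m p E mu -> in_P m p E nu ->
  WP m mu nu < r -> forall j, exists2 gamma, couplings (mu j) (nu j) gamma &
  (\int[gamma]_z (sqnorm (z.1 - z.2 : 'rV[R]_d))%:E < (m j * r ^+ 2)%:E)%E.
Proof.
move=> Pmu Pnu Wr j.
have [g0 cg0] := product_coupling (p0 j) (in_P_mass Pmu j) (in_P_mass Pnu j).
(* [fine] would send an infinite cost to 0, so finiteness comes first, from the product coupling and
   the second moments. *)
have tcfin : transport_cost (mu j) (nu j) \is a fin_num.
  rewrite ge0_fin_numE ?transport_cost_ge0//.
  apply: le_lt_trans (cost_lty (in_P_mom2 Pmu j) (in_P_mom2 Pnu j) cg0).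
  by apply: ereal_inf_lbound; exists g0.
have tclt : (transport_cost (mu j) (nu j) < (m j * r ^+ 2)%:E)%E.
  rewrite -(fineK tcfin) lte_fin -ltr_pdivrMl//.
  apply: (@le_lt_trans _ _ (WP m mu nu ^+ 2)); last first.
    by rewrite ltrXn2r ?nnegrE// ?WP_ge0// (le_trans (WP_ge0 mu nu))// ltW.
  rewrite WP_sqr (bigD1 j)//= lerDl; apply: sumr_ge0 => i _.
  by rewrite mulr_ge0 ?invr_ge0 ?(ltW (m0 i))// fine_ge0// transport_cost_ge0.
by have [_ [g cg <-] gr] := ereal_inf_lt tclt; exists g.
Qed.

Lemma same_measures_WP mu mu' nu : same_measures mu mu' ->
  WP m mu nu = WP m mu' nu.
Proof.
move=> mm; rewrite /WP; congr Num.sqrt; apply: eq_bigr => j _.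
rewrite /transport_cost (_ : couplings (mu j) (nu j) = couplings (mu' j) (nu j))//.
by apply/seteqP; split=> g cg A mA; have := cg A mA; rewrite mm.
Qed.

End WPfacts.

Lemma prod_Rintegral_swap d1 d2 (T1 : measurableType d1) (T2 : measurableType d2)
    (R : realType) (m1 : {finite_measure set T1 -> \bar R})
    (m2 : {finite_measure set T2 -> \bar R}) (f : T1 * T2 -> R) :
  (m1 \x m2)%E.-integrable setT (EFin \o f) ->
  (m2 \x m1)%E.-integrable setT (EFin \o (fun z => f (z.2, z.1))) ->
  \int[(m2 \x m1)%E]_z f (z.2, z.1) = \int[(m1 \x m2)%E]_z f z.
Proof.
move=> If If'; rewrite /Rintegral -(integral12_prod_meas1 If).
by rewrite -(integral21_prod_meas1 If').
Qed.

(** * Energy and dissipation *)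

Section Potential.
Context {R : realType} {d n : nat}.
Notation BV := (borel_rV R d).
Variables (m p : 'I_n -> R) (E : 'rV[R]_d).
Hypotheses (m0 : forall j, 0 < m j) (p0 : forall j, 0 < p j) (n0 : (0 < n)%N).
Variables (W : 'rV[R]_d -> 'M[R]_n) (kappa : 'M[R]_n).
Hypothesis hW : admissible W kappa.
Implicit Types mu nu : 'I_n -> measure_rV R d.
Notation muo := (mu_infty m p0 E).
Notation xo := (x_infty m p E).
Notation Wij i j := (fun z : 'rV[R]_d => W z i j).

Let dW i j z : differentiable (Wij i j) z. Proof. by have [] := W_C1 hW i j. Qed.

Let cgW i j : continuous (grad (Wij i j)). Proof. by have [] := W_C1 hW i j. Qed.

Let WN i j z : W (- z) i j = W z i j. Proof. by rewrite (W_even hW). Qed.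

Let cW i j : convex_function (E := 'rV[R]_d) setT
  (fun z => W z i j - 2^-1 * kappa i j * sqnorm z).
Proof. exact: (W_convex hW). Qed.

Let WS z i j : W z i j = W z j i.
Proof. by rewrite -[in LHS](W_sym hW) mxE. Qed.

Lemma W_bound : exists2 B, 0 <= B & forall i j z, `|W z i j| <= B * (1 + sqnorm z).
Proof.
have [Wb WbP] := W_growth hW; exists (\sum_i \sum_j `|Wb i j|).
  by do 2 (apply: sumr_ge0 => ? _).
move=> i j z; apply: (le_trans (WbP z i j)); rewrite ler_wpM2r ?addr_ge0 ?sqnorm_ge0//.
rewrite (le_trans (ler_norm _))// (bigD1 i)//= (bigD1 j)//= -addrA lerDl.
by rewrite addr_ge0// sumr_ge0// => k _; rewrite sumr_ge0.
Qed.

Lemma gradW_bound : exists2 C, 0 <= C & forall i j z v,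
  `|dotv v (grad (Wij i j) z)| <= C * (1 + sqnorm z + sqnorm v).
Proof.
have [B B0 WB] := W_bound.
have H (ij : 'I_n * 'I_n) : exists C, 0 <= C /\ forall z v,
    `|dotv v (grad (Wij ij.1 ij.2) z)| <= C * (1 + sqnorm z + sqnorm v).
  have [C C0 CP] := semiconvex_grad_growth (dW ij.1 ij.2) (cW ij.1 ij.2) (WB ij.1 ij.2).
  by exists C.
have [C CP] := choice H.
exists (\sum_ij C ij) => [|i j z v]; first by apply: sumr_ge0 => ij _; have [] := CP ij.
have [_ /(_ z v) h] := CP (i, j); apply: (le_trans h).
rewrite ler_wpM2r ?addr_ge0 ?sqnorm_ge0// (bigD1 (i, j))//= lerDl.
by apply: sumr_ge0 => ij _; have [] := CP ij.
Qed.

Lemma gradW_sym i j z : grad (Wij i j) z = grad (Wij j i) z.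
Proof. by congr (grad _ _); apply/funext => y; exact: WS. Qed.

Lemma gradW_odd i j z : grad (Wij i j) (- z) = - grad (Wij i j) z.
Proof. by rewrite even_grad. Qed.

Lemma gradW0 i j : grad (Wij i j) 0 = 0.
Proof. by rewrite even_grad0. Qed.

Lemma measurable_gradW i j d1 (T : measurableType d1) (g : T -> 'rV[R]_d) :
  measurable_fun setT (g : T -> BV) ->
  measurable_fun setT ((fun z => grad (Wij i j) (g z)) : T -> BV).
Proof.
move=> mg; apply: measurable_fun_rV => k.
apply: (@measurableT_comp _ _ _ _ _ _ (fun x : BV => grad (Wij i j) x 0 k)) => //.
apply: measurable_continuous_rV => x.
apply: (@continuous_comp _ _ _ (grad (Wij i j)) (fun y => y 0 k)); first exact: cgW.
exact: coord_continuous.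
Qed.

Lemma measurable_W i j d1 (T : measurableType d1) (g : T -> 'rV[R]_d) :
  measurable_fun setT (g : T -> BV) -> measurable_fun setT (fun z => W (g z) i j).
Proof.
move=> mg; apply: (@measurableT_comp _ _ _ _ _ _ (fun x : BV => W x i j)) => //.
by apply: measurable_continuous_rV => x; apply: differentiable_continuous; exact: dW.
Qed.

Section Mu.
Variable mu : 'I_n -> measure_rV R d.
Hypothesis Pmu : in_P m p E mu.
Notation nu i := (finpart (mu i)).

Lemma W_integrable i j : (nu i \x nu j)%E.-integrable setT
  (EFin \o (fun z : BV * BV => W ((z.1 : 'rV[R]_d) - z.2) i j)).
Proof.
have [B B0 WB] := W_bound.
apply: (@mom2_prod_integrable _ _ _ _ (fun z => W (z.1 - z.2) i j) (2 * B)).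
- exact: finpart_mom2 Pmu i.
- exact: finpart_mom2 Pmu j.
- by apply: measurable_W; exact: measurable_prod_sub.
move=> x y; apply: (le_trans (WB _ _ _)) => /=; rewrite mulrAC [leRHS]mulrC ler_wpM2l//.
have := sqnormB_le x y; have := sqnorm_ge0 x; have := sqnorm_ge0 y; lra.
Qed.

Lemma W_section_integrable i j y : (nu i).-integrable setT
  (fun x : BV => (W ((x : 'rV[R]_d) - y) i j)%:E).
Proof.
have [B B0 WB] := W_bound.
apply: (@mom2_integrable _ _ _ (fun x => W (x - y) i j) (B * (2 + 2 * sqnorm y))).
- exact: finpart_mom2 Pmu i.
- by apply: measurable_W; apply: measurable_sub_rV => //; exact: measurable_cst.
move=> x; apply: (le_trans (WB _ _ _)) => /=; rewrite -mulrA ler_wpM2l//.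
have := sqnormB_le x y; have := sqnorm_ge0 x; have := sqnorm_ge0 y; nra.
Qed.

Lemma energyE : energy W mu =
  2^-1 * \sum_i \sum_j \int[(nu i \x nu j)%E]_z W ((z.1 : 'rV[R]_d) - z.2) i j.
Proof.
congr (_ * _); apply: eq_bigr => i _; apply: eq_bigr => j _.
rewrite -(@Rintegral21 _ _ _ _ _ (nu i) (nu j) (fun z => W (z.1 - z.2) i j)).
- rewrite (Rintegral_finpart _ (in_P_finite Pmu j)).
  by apply: eq_Rintegral => y _; rewrite (Rintegral_finpart _ (in_P_finite Pmu i)).
- exact: W_integrable.
- by move=> y; exact: W_section_integrable.
Qed.

(** The first term is the energy of [mu_infty], where only the values of W at 0 count. For a
    positive modulus the excess vanishes only with [lyap], whence uniqueness of the minimizer. *)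
Lemma energy_ge : 2^-1 * (\sum_i \sum_j p i * p j * W 0 i j) +
  2^-1 * (lambda0 m p kappa * lyap m p E mu) <= energy W mu.
Proof.
rewrite energyE -mulrDr ler_wpM2l//.
have h := modulus_lyap m0 p0 n0 Pmu (kappa_sym hW).
apply: (@le_trans _ _ (\sum_i \sum_j p i * p j * W 0 i j + 2^-1 * \sum_i \sum_j kappa i j *
  \int[(nu i \x nu j)%E]_z sqnorm ((z.1 : 'rV[R]_d) - z.2))); first by lra.
rewrite mulr_sumr -big_split; apply: ler_sum => i _ /=.
rewrite mulr_sumr -big_split; apply: ler_sum => j _ /=.
have IS := prod_sqnorm_integrable (finpart_mom2 Pmu i) (finpart_mom2 Pmu j).
have IC := prod_integrable_cst (nu i) (nu j) (W 0 i j).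
have -> : p i * p j * W 0 i j = \int[(nu i \x nu j)%E]_z W 0 i j.
  by rewrite (prod_Rintegral_cst (nu i) (nu j)) !(finpart_mass Pmu).
rewrite mulrA -RintegralZl// -RintegralD//; last exact: integrableZ_R.
apply: le_Rintegral => //.
- by apply: integrableD_R => //; exact: integrableZ_R.
- exact: W_integrable.
by move=> z _; exact: (even_semiconvex_ge (dW i j) (WN i j) (cW i j)).
Qed.

Section Field.
Variable u : 'rV[R]_d -> 'rV[R]_d.
Variable c : R.
Hypothesis mu_ : measurable_fun setT (u : BV -> BV).
Hypothesis uc : forall x, sqnorm (u x) <= c * (1 + sqnorm x).

Lemma pairing_integrable i j : (nu i \x nu j)%E.-integrable setT
  (EFin \o (fun z : BV * BV =>
     dotv (u z.1) (grad (Wij i j) ((z.1 : 'rV[R]_d) - z.2)))).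
Proof.
have [C C0 gC] := gradW_bound.
apply: (@mom2_prod_integrable _ _ _ _
  (fun z => dotv (u z.1) (grad (Wij i j) (z.1 - z.2))) (C * (2 + c))).
- exact: finpart_mom2 Pmu i.
- exact: finpart_mom2 Pmu j.
- apply: measurable_dotv; last by apply: measurable_gradW; exact: measurable_prod_sub.
  exact: (measurableT_comp mu_ measurable_fst).
move=> x y; apply: (le_trans (gC _ _ _ _)) => /=; rewrite -mulrA ler_wpM2l//.
have := sqnormB_le x y; have := sqnorm_ge0 x; have := sqnorm_ge0 y; have := uc x.
have c0 : 0 <= c.
  by have := le_trans (sqnorm_ge0 _) (uc 0); rewrite sqnorm0 addr0 mulr1.
nra.
Qed.

Lemma pairing_section_integrable i j v x : (nu j).-integrable setT
  (fun y : BV => (dotv v (grad (Wij i j) (x - (y : 'rV[R]_d))))%:E).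
Proof.
have [C C0 gC] := gradW_bound.
apply: (@mom2_integrable _ _ _ (fun y => dotv v (grad (Wij i j) (x - y)))
  (C * (2 + 2 * sqnorm x + sqnorm v))).
- exact: finpart_mom2 Pmu j.
- apply: measurable_dotv; first exact: measurable_cst.
  by apply: measurable_gradW; apply: measurable_sub_rV => //; exact: measurable_cst.
move=> y; apply: (le_trans (gC _ _ _ _)) => /=; rewrite -mulrA ler_wpM2l//.
have := sqnormB_le x y; have := sqnorm_ge0 x; have := sqnorm_ge0 y; have := sqnorm_ge0 v.
nra.
Qed.

Lemma dotv_drift i v x : dotv v (drift W mu i x) =
  \sum_j \int[nu j]_y dotv v (grad (Wij i j) (x - (y : 'rV[R]_d))).
Proof.
rewrite dotv_sumr; apply: eq_bigr => j _.
rewrite {2}/dotv Rintegral_sum => [|k].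
  apply: eq_bigr => k _; rewrite mxE RintegralZl//.
    by rewrite (Rintegral_finpart _ (in_P_finite Pmu j)).
  (* A coordinate of the gradient is its pairing with a basis vector, so its integrability is an
     instance of that of pairings. *)
  have := pairing_section_integrable i j (delta_mx 0 k) x.
  apply: eq_integrable => // y _; congr EFin.
  rewrite /dotv (bigD1 k)//= big1 ?addr0 => [|l lk]; first by rewrite mxE !eqxx mul1r.
  by rewrite mxE (negbTE lk) mul0r.
have := pairing_section_integrable i j (v 0 k *: delta_mx 0 k) x.
apply: eq_integrable => // y _; congr EFin.
rewrite dotvZl; congr (_ * _).
rewrite /dotv (bigD1 k)//= big1 ?addr0 => [|l lk]; first by rewrite mxE !eqxx mul1r.
by rewrite mxE (negbTE lk) mul0r.
Qed.

Lemma drift_pairing_integrable i : (nu i).-integrable setT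
  (EFin \o (fun x : BV => dotv (u x) (drift W mu i x))).
Proof.
have := @integrable_sum _ _ _ (nu i) setT measurableT _ (index_enum 'I_n) xpredT
  (fun j (x : BV) => fubini_F (nu j) (EFin \o (fun z : BV * BV =>
     dotv (u z.1) (grad (Wij i j) ((z.1 : 'rV[R]_d) - z.2)))) x)
  (fun j _ => integrable_fubini_F (pairing_integrable i j)).
apply: eq_integrable => // x _; rewrite /= dotv_drift -sumEFin.
apply: eq_bigr => j _; rewrite /Rintegral fineK//.
by apply: integrable_fin_num => //; exact: pairing_section_integrable.
Qed.

Lemma drift_pairing i : \int[mu i]_x dotv (u x) (drift W mu i x) =
  \sum_j \int[(nu i \x nu j)%E]_z dotv (u z.1) (grad (Wij i j) ((z.1 : 'rV[R]_d) - z.2)).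
Proof.
rewrite -(Rintegral_finpart _ (in_P_finite Pmu i)).
under eq_Rintegral do rewrite dotv_drift.
rewrite Rintegral_sum => [|j].
  apply: eq_bigr => j _.
  rewrite (Rintegral12 (pairing_integrable i j))// => x.
  exact: (pairing_section_integrable i j (u x) x).
have := integrable_fubini_F (pairing_integrable i j).
apply: eq_integrable => // x _; rewrite /= /Rintegral fineK//.
by apply: integrable_fin_num => //; exact: pairing_section_integrable.
Qed.

End Field.

(** Exchange the particles (i, x) and (j, y): [W] is symmetric in its indices and its gradients are
    odd, so adding the two pairings makes the centre drop out and leaves z . grad W_ij z at z = x -
    y, to which the convexity bound applies. *)
Lemma dissipation_ge :
  2 * lambda0 m p kappa * lyap m p E mu <=
  \sum_i \sum_j \int[(nu i \x nu j)%E]_z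
    dotv (2 *: ((z.1 : 'rV[R]_d) - xo)) (grad (Wij i j) ((z.1 : 'rV[R]_d) - z.2)).
Proof.
apply: (le_trans (modulus_lyap m0 p0 n0 Pmu (kappa_sym hW))).
have mu1 : measurable_fun setT ((fun x : 'rV[R]_d => x - xo) : BV -> BV).
  by apply: measurable_sub_rV => //; exact: measurable_cst.
have u1c x : sqnorm (x - xo) <= (2 + 2 * sqnorm xo) * (1 + sqnorm x).
  have := sqnormB_le x xo; have := sqnorm_ge0 x; have := sqnorm_ge0 xo; nra.
have I1 i j := pairing_integrable mu1 u1c i j.
pose T i j := \int[(nu i \x nu j)%E]_z
  dotv ((z.1 : 'rV[R]_d) - xo) (grad (Wij i j) ((z.1 : 'rV[R]_d) - z.2)).
have I2 i j : (nu i \x nu j)%E.-integrable setT (EFin \o (fun z : BV * BV =>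
    dotv ((z.2 : 'rV[R]_d) - xo) (grad (Wij j i) ((z.2 : 'rV[R]_d) - z.1)))).
  have [C C0 gC] := gradW_bound.
  apply: (@mom2_prod_integrable _ _ _ _
    (fun z => dotv (z.2 - xo) (grad (Wij j i) (z.2 - z.1))) (C * (4 + 2 * sqnorm xo))).
  - exact: finpart_mom2 Pmu i.
  - exact: finpart_mom2 Pmu j.
  - apply: measurable_dotv; first exact: (measurableT_comp mu1 measurable_snd).
    by apply: measurable_gradW; apply: measurable_sub_rV; [exact: measurable_snd|exact: measurable_fst].
  move=> x y; apply: (le_trans (gC _ _ _ _)) => /=; rewrite -mulrA ler_wpM2l//.
  have := sqnormB_le y x; have := sqnorm_ge0 x; have := sqnorm_ge0 y.
  have := sqnormB_le y xo; have := sqnorm_ge0 xo; nra.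
have TC i j : T j i = - \int[(nu i \x nu j)%E]_z
    dotv ((z.2 : 'rV[R]_d) - xo) (grad (Wij i j) ((z.1 : 'rV[R]_d) - z.2)).
  rewrite /T -(prod_Rintegral_swap (I1 j i) (I2 i j)) /=.
  rewrite -[RHS]mulN1r -RintegralZl//.
    apply: eq_Rintegral => z _; rewrite mulN1r -dotvNr -gradW_odd gradW_sym.
    by rewrite opprB.
  have := integrableZ_R (-1) (I2 i j); apply: eq_integrable => // z _ /=; congr EFin.
  by rewrite mulN1r -dotvNr -gradW_odd gradW_sym opprB.
have -> : \sum_i \sum_j \int[(nu i \x nu j)%E]_z
    dotv (2 *: ((z.1 : 'rV[R]_d) - xo)) (grad (Wij i j) ((z.1 : 'rV[R]_d) - z.2)) =
    \sum_i \sum_j (T i j + T j i).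
  transitivity (\sum_i \sum_j (T i j + T i j)).
    apply: eq_bigr => i _; apply: eq_bigr => j _.
    have -> : T i j + T i j = 2 * T i j by ring.
    rewrite /T -RintegralZl//; last exact: (I1 i j).
    by apply: eq_Rintegral => z _; rewrite dotvZl.
  transitivity (\sum_i \sum_j T i j + \sum_i \sum_j T j i).
    rewrite [X in _ + X]exchange_big -big_split.
    by apply: eq_bigr => i _; rewrite -big_split.
  by rewrite -big_split; apply: eq_bigr => i _; rewrite -big_split.
apply: ler_sum => i _; apply: ler_sum => j _.
have IS := prod_sqnorm_integrable (finpart_mom2 Pmu i) (finpart_mom2 Pmu j).
have I2' : (nu i \x nu j)%E.-integrable setT (EFin \o (fun z : BV * BV =>
    dotv ((z.2 : 'rV[R]_d) - xo) (grad (Wij i j) ((z.1 : 'rV[R]_d) - z.2)))).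
  have := integrableZ_R (-1) (I2 i j); apply: eq_integrable => // z _ /=; congr EFin.
  by rewrite mulN1r -dotvNr -gradW_odd gradW_sym opprB.
rewrite (TC i j) /T -(RintegralB measurableT (I1 i j) I2') -(RintegralZl _ measurableT IS); apply: le_Rintegral => //.
- exact: integrableZ_R.
- exact: (integrableB _ (I1 i j) I2').
move=> z _; rewrite -dotvBl opprB addrA subrK.
exact: (even_semiconvex_grad (dW i j) (WN i j) (cW i j)).
Qed.

End Mu.

Lemma energy_mu_infty : energy W muo = 2^-1 * \sum_i \sum_j p i * p j * W 0 i j.
Proof.
congr (_ * _); apply: eq_bigr => i _; apply: eq_bigr => j _.
under eq_Rintegral => y _.
  rewrite (Rintegral_mu_infty m E p0 (f := fun x => W (x - (y : 'rV[R]_d)) i j)); last first.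
    by apply: measurable_W; apply: measurable_sub_rV => //; exact: measurable_cst.
  over.
rewrite (Rintegral_mu_infty m E p0 (f := fun y => p i * W (xo - y) i j)); last first.
  apply: measurable_funM; first exact: measurable_cst.
  by apply: measurable_W; apply: measurable_sub_rV => //; exact: measurable_cst.
by rewrite subrr mulrCA mulrA.
Qed.

End Potential.

(** * Continuity along curves *)

Section SubquadraticModulus.
Context {R : realType} {d : nat}.
Notation V := 'rV[R]_d.
Implicit Types z w : V * V.

Definition sq2 z := sqnorm z.1 + sqnorm z.2.

Lemma sq2_ge0 z : 0 <= sq2 z.
Proof. by rewrite addr_ge0 ?sqnorm_ge0. Qed.

Lemma continuous_sqnorm : continuous (sqnorm : V -> R).
Proof.
have -> : sqnorm = fun x : V => sqnorm (x - 0) by apply/funext => x; rewrite subr0.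
by apply: continuous_smooth; apply: smooth_sqnorm; exact: smooth_coord.
Qed.

Lemma compact_sqnorm_le (r : R) : compact [set x : V | sqnorm x <= r].
Proof.
apply: bounded_closed_compact.
  exists (1 + `|r|); split; first exact: num_real.
  move=> M rM x /= xr; have := norm_sqr_le_sqnorm x; have := normr_ge0 x.
  have := ler_norm r; move: (`|r|) (`|x|) rM => r' x' rM r'r x0 x2.
  by apply: ltW; rewrite ltNge; apply/negP => Mx; nra.
rewrite (_ : [set x | _] = sqnorm @^-1` [set y | y <= r])//.
by apply: closed_comp; [move=> x _; exact: continuous_sqnorm|exact: closed_le].
Qed.

(** Uniform continuity with only z confined to a compact set: w may lie outside, as the partner of z
    under a coupling may. *)
Lemma continuous_modulus (K : V * V -> R) (r e : R) : continuous K -> 0 < e ->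
  exists2 dl, 0 < dl & forall z w, sq2 z <= r -> sq2 (z - w) < dl ->
    `|K z - K w| <= e.
Proof.
move=> cK e0; pose A := [set x : V | sqnorm x <= r].
have cA : compact (A `*` A) by apply: compact_setX; exact: compact_sqnorm_le.
pose P (dl : R) z := forall w, sq2 (z - w) < dl -> `|K z - K w| <= e.
have : \forall dl \near 0^'+, A `*` A `<=` P dl.
  move/compact_near_coveringP : cA; apply=> x Ax.
  have /cvgrPdist_lt /(_ (e / 2)) := cK x; rewrite divr_gt0// => /(_ isT).
  move=> /nbhs_ballP[q /= q0 xq].
  near=> y dl => w yw.
  (* [sq2] is a squared distance, hence the square; one half of the radius is spent on y and the
     other on w. *)
  have dlq : dl <= (q / 2) ^+ 2 by near: dl; apply: nbhs_right_le; rewrite exprn_gt0// divr_gt0.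
  have yx : ball x (q / 2) y by near: y; apply: nbhsx_ballx; rewrite divr_gt0.
  have wy : ball y (q / 2) w.
    have H (u : V) : sqnorm u <= sq2 (y - w) -> `|u| < q / 2.
      move=> uyw; have := norm_sqr_le_sqnorm u => h.
      rewrite -(@ltr_pXn2r _ 2)// ?nnegrE//; last by rewrite ltW ?divr_gt0.
      by apply: (le_lt_trans h); apply: (le_lt_trans uyw); apply: lt_le_trans dlq.
    split; rewrite -ball_normE /=; apply: H.
      by rewrite lerDl sqnorm_ge0.
    by rewrite lerDr sqnorm_ge0.
  have xw : ball x q w by rewrite (splitr q); exact: ball_triangle yx wy.
  have xy : ball x q y by apply: le_ball yx; rewrite ler_pdivrMr// ler_peMr ?ltW// ltr1n.
  rewrite -(subrKA (K x)) (le_trans (ler_normD _ _))// (splitr e) lerD//.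
    by rewrite distrC ltW// xq.
  by rewrite ltW// xq.
move=> [q /= q0 qP]; exists (q / 2); first by rewrite divr_gt0.
move=> z w zr; apply: (qP (q / 2)).
- by rewrite /= sub0r normrN gtr0_norm ?divr_gt0// ltr_pdivrMr// ltr_pMr// ltr1n.
- by rewrite /= divr_gt0.
- split => /=; apply: le_trans zr; by rewrite ?lerDl ?lerDr sqnorm_ge0.
Unshelve. all: by end_near.
Qed.

(* A continuous function of subquadratic growth is, up to [e] times second
   moments, Lipschitz with respect to the squared distance: integrated against
   a coupling this bounds the variation of its integral by transport costs. *)
Lemma subquadratic_modulus (K : V * V -> R) (e : R) : continuous K -> 0 < e ->
  (forall h, 0 < h -> exists2 C, 0 <= C & forall z, `|K z| <= h * sq2 z + C) ->
  exists2 C, 0 <= C & forall z w,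
    `|K z - K w| <= e * (1 + sq2 z + sq2 w) + C * sq2 (z - w).
Proof.
move=> cK e0 gK; have [C1 C10 KC1] := gK _ (divr_gt0 e0 (ltr0n R 2)).
(* Beyond this radius C1 is at most e / 2 times [sq2], so the constant of the growth bound is
   absorbed. *)
pose r := 2 * C1 / e.
have [dl dl0 Kdl] := continuous_modulus r cK e0.
(* When [sq2 (z - w)] is at least dl, this term alone covers the constants C1 of both points. *)
exists (2 * C1 / dl); first by rewrite divr_ge0 ?mulr_ge0// ltW.
have sq2C z w : sq2 (z - w) = sq2 (w - z).
  by rewrite /sq2 /= -(opprB w.1) -(opprB w.2) !sqnormN.
have key z w : sq2 z <= r ->
    `|K z - K w| <= e * (1 + sq2 z + sq2 w) + 2 * C1 / dl * sq2 (z - w).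
  move=> zr; have := sq2_ge0 z; have := sq2_ge0 w; have := sq2_ge0 (z - w).
  have D0 : 0 <= 2 * C1 / dl by rewrite divr_ge0 ?mulr_ge0// ltW.
  have [near|far] := ltP (sq2 (z - w)) dl.
    have := Kdl z w zr near; nra.
  have h1 : 2 * C1 <= 2 * C1 / dl * sq2 (z - w).
    by rewrite mulrAC ler_pdivlMr// ler_wpM2l ?mulr_ge0.
  have := ler_normB (K z) (K w); have := KC1 z; have := KC1 w; nra.
move=> z w; have [zr|zr] := leP (sq2 z) r; first exact: key.
have [wr|wr] := leP (sq2 w) r.
  by have := key w z wr; rewrite distrC (sq2C w z); lra.
have D0 : 0 <= 2 * C1 / dl * sq2 (z - w).
  by rewrite mulr_ge0 ?sq2_ge0// divr_ge0 ?mulr_ge0// ltW.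
have h q : r < q -> C1 <= e / 2 * q.
  move=> rq; have : r * (e / 2) <= q * (e / 2) by rewrite ler_wpM2r ?divr_ge0 ?ltW.
  have -> : r * (e / 2) = C1 by rewrite /r; field; exact: lt0r_neq0.
  lra.
have := h _ zr; have := h _ wr.
have := ler_normB (K z) (K w); have := KC1 z; have := KC1 w; nra.
Qed.

End SubquadraticModulus.

(** * Product measures with coupled factors *)

Section CoupledDifference.
Context {R : realType} {d : nat}.
Notation BV := (borel_rV R d).
Notation fmeas := {finite_measure set BV -> \bar R}.
Notation cplg := {finite_measure set (BV * BV)%type -> \bar R}.
Notation V := 'rV[R]_d.
Notation rcost gamma := (\int[gamma]_z sqnorm (z.1 - z.2 : V)).

Section One.
Variables (mu nu : fmeas) (gamma : cplg).
Hypotheses (mu2 : has_mom2 mu) (nu2 : has_mom2 nu) (cg : couplings mu nu gamma).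

Lemma coupling_mass : fine (gamma setT) = fine (mu setT).
Proof. by have [+ _] := cg measurableT; rewrite preimage_setT => ->. Qed.

Lemma coupling_fst_integrable (f : BV -> R) : mu.-integrable setT (EFin \o f) ->
  gamma.-integrable setT (EFin \o (fun z => f z.1)).
Proof.
apply: (@image_integrable _ _ _ _ R gamma mu fst) => [|A mA]; first exact: measurable_fst.
by have [/esym] := cg mA.
Qed.

Lemma coupling_snd_integrable (f : BV -> R) : nu.-integrable setT (EFin \o f) ->
  gamma.-integrable setT (EFin \o (fun z => f z.2)).
Proof.
apply: (@image_integrable _ _ _ _ R gamma nu snd) => [|A mA]; first exact: measurable_snd.
by have [_ /esym] := cg mA.
Qed.

Lemma coupling_fst_Rintegral (f : BV -> R) : mu.-integrable setT (EFin \o f) ->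
  \int[gamma]_z f z.1 = \int[mu]_x f x.
Proof.
move=> If; apply/esym; apply: (@image_Rintegral _ _ _ _ R gamma mu fst) => [|A mA|//].
  exact: measurable_fst.
by have [/esym] := cg mA.
Qed.

Lemma coupling_snd_Rintegral (f : BV -> R) : nu.-integrable setT (EFin \o f) ->
  \int[gamma]_z f z.2 = \int[nu]_x f x.
Proof.
move=> If; apply/esym; apply: (@image_Rintegral _ _ _ _ R gamma nu snd) => [|A mA|//].
  exact: measurable_snd.
by have [_ /esym] := cg mA.
Qed.

Lemma coupling_cost_integrable :
  gamma.-integrable setT (EFin \o (fun z : BV * BV => sqnorm (z.1 - z.2 : V))).
Proof.
apply: ge0_integrable; first exact: measurable_cost.
  by move=> z; exact: sqnorm_ge0.
exact: cost_lty mu2 nu2 cg.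
Qed.

Lemma coupling_mom2_le a (e : R) : 0 < e ->
  mom2 mu a <= (1 + e) * mom2 nu a + (1 + e^-1) * rcost gamma /\
  mom2 nu a <= (1 + e) * mom2 mu a + (1 + e^-1) * rcost gamma.
Proof.
move=> e0; have I1 := integrable_sqnorm a mu2; have I2 := integrable_sqnorm a nu2.
have J1 := coupling_fst_integrable I1; have J2 := coupling_snd_integrable I2.
have Jc := coupling_cost_integrable.
have E1 := coupling_fst_Rintegral I1; have E2 := coupling_snd_Rintegral I2.
rewrite /= in E1 E2; rewrite /mom2 -E1 -E2.
split.
  rewrite -!RintegralZl// -RintegralD//; last 2 first.
  - exact: integrableZ_R.
  - exact: integrableZ_R.
  apply: le_Rintegral => //.
    by apply: integrableD_R; exact: integrableZ_R.
  move=> z _ /=; have := sqnormD_young (z.2 - a) (z.1 - z.2) e0.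
  by rewrite addrC addrA subrK.
rewrite -!RintegralZl// -RintegralD//; last 2 first.
- exact: integrableZ_R.
- exact: integrableZ_R.
apply: le_Rintegral => //.
  by apply: integrableD_R; exact: integrableZ_R.
move=> z _ /=; have := sqnormD_young (z.1 - a) (z.2 - z.1) e0.
by rewrite addrC addrA subrK -(sqnormN (z.2 - z.1)) opprB.
Qed.

End One.

Section Two.
Variables (mu1 nu1 mu2 nu2 : fmeas) (g1 g2 : cplg).
Hypotheses (hm1 : has_mom2 mu1) (hn1 : has_mom2 nu1).
Hypotheses (hm2 : has_mom2 mu2) (hn2 : has_mom2 nu2).
Hypotheses (c1 : couplings mu1 nu1 g1) (c2 : couplings mu2 nu2 g2).
Let phi (z : (BV * BV) * (BV * BV)) : BV * BV := (z.1.1, z.2.1).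
Let psi (z : (BV * BV) * (BV * BV)) : BV * BV := (z.1.2, z.2.2).

Let mphi : measurable_fun setT phi.
Proof.
apply: measurable_fun_pair.
  exact: (measurableT_comp measurable_fst measurable_fst).
exact: (measurableT_comp measurable_fst measurable_snd).
Qed.

Let mpsi : measurable_fun setT psi.
Proof.
apply: measurable_fun_pair.
  exact: (measurableT_comp measurable_snd measurable_fst).
exact: (measurableT_comp measurable_snd measurable_snd).
Qed.

Let phiE A : measurable A -> (mu1 \x mu2)%E A = (g1 \x g2)%E (phi @^-1` A).
Proof.
move=> mA; rewrite -[RHS]/(pushforward (g1 \x g2)%E phi A).
apply: product_measure_unique => // X Y mX mY; rewrite /pushforward.
have [eX _] := c1 mX; have [eY _] := c2 mY.
transitivity (g1 (fst @^-1` X) * g2 (fst @^-1` Y))%E; last first.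
  by congr (_ * _)%E; [exact: eX|exact: eY].
apply: (product_measure1E g1 g2).
- by rewrite -[X in measurable X]setTI; exact: measurable_fst.
- by rewrite -[X in measurable X]setTI; exact: measurable_fst.
Qed.

Let psiE A : measurable A -> (nu1 \x nu2)%E A = (g1 \x g2)%E (psi @^-1` A).
Proof.
move=> mA; rewrite -[RHS]/(pushforward (g1 \x g2)%E psi A).
apply: product_measure_unique => // X Y mX mY; rewrite /pushforward.
have [_ eX] := c1 mX; have [_ eY] := c2 mY.
transitivity (g1 (snd @^-1` X) * g2 (snd @^-1` Y))%E; last first.
  by congr (_ * _)%E; [exact: eX|exact: eY].
apply: (product_measure1E g1 g2).
- by rewrite -[X in measurable X]setTI; exact: measurable_snd.
- by rewrite -[X in measurable X]setTI; exact: measurable_snd.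
Qed.

(** The product of the two couplings, with coordinates regrouped by [phi] and [psi], couples mu1 x
    mu2 with nu1 x nu2. Integrating the modulus against it separates the factors, since each
    nonconstant term splits into parts that depend on one pair. *)
Lemma coupled_difference (K : V * V -> R) (e C : R) :
  (mu1 \x mu2)%E.-integrable setT (EFin \o (K : BV * BV -> R)) ->
  (nu1 \x nu2)%E.-integrable setT (EFin \o (K : BV * BV -> R)) ->
  (forall z w, `|K z - K w| <= e * (1 + sq2 z + sq2 w) + C * sq2 (z - w)) ->
  `|\int[(mu1 \x mu2)%E]_z K z - \int[(nu1 \x nu2)%E]_z K z| <=
    e * (fine (mu1 setT) * fine (mu2 setT) +
         fine (mu2 setT) * (mom2 mu1 0 + mom2 nu1 0) +
         fine (mu1 setT) * (mom2 mu2 0 + mom2 nu2 0)) +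
    C * (fine (mu2 setT) * rcost g1 + fine (mu1 setT) * rcost g2).
Proof.
move=> I1 I2 HK.
have J1 := image_integrable mphi phiE I1; have J2 := image_integrable mpsi psiE I2.
rewrite (image_Rintegral mphi phiE I1) (image_Rintegral mpsi psiE I2).
rewrite -RintegralB//.
apply: (le_trans (le_normr_Rintegral _ _)) => //; first exact: (integrableB _ J1 J2).
pose a (z : BV * BV) : R := e * (sqnorm (z.1 - 0 : V) + sqnorm (z.2 - 0 : V)) +
   C * sqnorm (z.1 - z.2 : V).
have Ia (mu nu : fmeas) (g : cplg) : has_mom2 mu -> has_mom2 nu -> couplings mu nu g ->
    g.-integrable setT (EFin \o a).
  move=> h h' cg; apply: integrableD_R; last first.
    by apply: integrableZ_R; exact: coupling_cost_integrable h h' cg.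
  apply: integrableZ_R; apply: integrableD_R.
    exact: (coupling_fst_integrable cg (integrable_sqnorm 0 h)).
  exact: (coupling_snd_integrable cg (integrable_sqnorm 0 h')).
have Ea (mu nu : fmeas) (g : cplg) : has_mom2 mu -> has_mom2 nu -> couplings mu nu g ->
    \int[g]_z a z = e * (mom2 mu 0 + mom2 nu 0) + C * rcost g.
  move=> h h' cg.
  have Jc := coupling_cost_integrable h h' cg.
  have J1' := coupling_fst_integrable cg (integrable_sqnorm 0 h).
  have J2' := coupling_snd_integrable cg (integrable_sqnorm 0 h').
  rewrite /a RintegralD//; last 2 first.
  - by apply: integrableZ_R; exact: integrableD_R.
  - exact: integrableZ_R.
  rewrite !RintegralZl//; last exact: integrableD_R.
  congr (_ * _ + _); rewrite RintegralD//; congr (_ + _).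
    exact: (coupling_fst_Rintegral cg (integrable_sqnorm 0 h)).
  exact: (coupling_snd_Rintegral cg (integrable_sqnorm 0 h')).
have IA := prod_integrable_fst g2 (Ia _ _ _ hm1 hn1 c1).
have IB := prod_integrable_snd g1 (Ia _ _ _ hm2 hn2 c2).
have IE := prod_integrable_cst g1 g2 e.
apply: (@le_trans _ _ (\int[(g1 \x g2)%E]_z (e + a z.1 + a z.2))).
  apply: le_Rintegral => //.
  - exact: integrable_norm (integrableB _ J1 J2).
  - by apply: integrableD_R => //; exact: integrableD_R.
  move=> z _; apply: (le_trans (HK _ _)); rewrite /a /sq2 /= !subr0; lra.
rewrite RintegralD//; last exact: integrableD_R.
rewrite RintegralD//.
rewrite (prod_Rintegral_fst g2 (Ia _ _ _ hm1 hn1 c1)).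
rewrite (prod_Rintegral_snd g1 (Ia _ _ _ hm2 hn2 c2)).
rewrite (prod_Rintegral_cst g1 g2) (Ea _ _ _ hm1 hn1 c1) (Ea _ _ _ hm2 hn2 c2).
rewrite (coupling_mass c1) (coupling_mass c2); lra.
Qed.

End Two.

End CoupledDifference.

(** * Moments and pairings along a curve *)

Section Curves.
Context {R : realType} {d n : nat}.
Notation BV := (borel_rV R d).
Notation V := 'rV[R]_d.
Variables (m p : 'I_n -> R) (E : 'rV[R]_d).
Hypotheses (m0 : forall j, 0 < m j) (p0 : forall j, 0 < p j) (n0 : (0 < n)%N).
Implicit Types mu nu : 'I_n -> measure_rV R d.
Notation rcost gamma := (\int[gamma]_z sqnorm (z.1 - z.2 : V)).

(** Oriented from mu to nu, as couplings are. Continuity in time is therefore stated as a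
    disjunction of the two orders, according to which time comes first. *)
Definition W2_near mu nu (r : R) : Prop := forall j, exists2 gamma,
  couplings (mu j) (nu j) gamma &
  (\int[gamma]_z (sqnorm (z.1 - z.2 : V))%:E < r%:E)%E.

Lemma W2_near_finpart mu nu r j : in_P m p E mu -> in_P m p E nu ->
  W2_near mu nu r -> exists2 gamma,
  couplings (finpart (mu j)) (finpart (nu j)) gamma & rcost gamma <= r.
Proof.
move=> Pmu Pnu /(_ j)[g cg cr]; exists g.
  move=> A mA; have [e1 e2] := cg A mA; split.
    apply: (etrans e1); apply/esym.
    exact: (congr1 (fun f => f A) (finpartE (in_P_finite Pmu j))).
  apply: (etrans e2); apply/esym.
  exact: (congr1 (fun f => f A) (finpartE (in_P_finite Pnu j))).
rewrite -lee_fin /Rintegral fineK ?(ltW cr)// ge0_fin_numE; first exact: lt_trans (ltry r).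
by apply: integral_ge0 => z _; rewrite lee_fin sqnorm_ge0.
Qed.

Lemma mom2_near mu nu r j a e : in_P m p E mu -> in_P m p E nu ->
  W2_near mu nu r \/ W2_near nu mu r -> 0 < e ->
  mom2 (mu j) a <= (1 + e) * mom2 (nu j) a + (1 + e^-1) * r.
Proof.
move=> Pmu Pnu H e0; have e1 : 0 <= 1 + e^-1 by rewrite addr_ge0// invr_ge0 ltW.
rewrite -(mom2_finpart Pmu) -(mom2_finpart Pnu); case: H => H.
  have [g cg gr] := W2_near_finpart j Pmu Pnu H.
  have [+ _] := coupling_mom2_le (finpart_mom2 Pmu j) (finpart_mom2 Pnu j) cg a e0.
  by move=> h; apply: (le_trans h); rewrite lerD2l ler_wpM2l.
have [g cg gr] := W2_near_finpart j Pnu Pmu H.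
have [_] := coupling_mom2_le (finpart_mom2 Pnu j) (finpart_mom2 Pmu j) cg a e0.
by move=> h; apply: (le_trans h); rewrite lerD2l ler_wpM2l.
Qed.

Lemma pairing_near (K : V * V -> R) i j (M e : R) : continuous K -> 0 <= M -> 0 < e ->
  (forall h, 0 < h -> exists2 C, 0 <= C & forall z, `|K z| <= h * sq2 z + C) ->
  (forall mu, in_P m p E mu -> (finpart (mu i) \x finpart (mu j))%E.-integrable setT
      (EFin \o (K : BV * BV -> R))) ->
  exists2 r, 0 < r & forall mu nu, in_P m p E mu -> in_P m p E nu ->
    W2_near mu nu r -> (forall k, mom2 (mu k) 0 <= M) -> (forall k, mom2 (nu k) 0 <= M) ->
    `|\int[(finpart (mu i) \x finpart (mu j))%E]_z K z -
      \int[(finpart (nu i) \x finpart (nu j))%E]_z K z| <= e.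
Proof.
move=> cK M0 e0 gK IK.
(* [A] and [B] majorise the factors that [coupled_difference] puts on the modulus and on the
   transport costs. The added 1 makes them positive, and each part costs e/2. *)
pose A := p i * p j + p j * (M + M) + p i * (M + M) + 1.
have pi0 := p0 i; have pj0 := p0 j.
have A0 : 0 < A by rewrite /A; nra.
have eA0 : 0 < e / 2 / A by rewrite !divr_gt0.
have [C C0 HC] := subquadratic_modulus cK eA0 gK.
pose B := C * (p j + p i) + 1.
have B0 : 0 < B by rewrite /B; nra.
exists (e / 2 / B); first by rewrite !divr_gt0.
move=> mu nu Pmu Pnu H Mmu Mnu.
have [g1 c1 r1] := W2_near_finpart i Pmu Pnu H.
have [g2 c2 r2] := W2_near_finpart j Pmu Pnu H.
have h := coupled_difference (finpart_mom2 Pmu i) (finpart_mom2 Pnu i)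
  (finpart_mom2 Pmu j) (finpart_mom2 Pnu j) c1 c2 (IK _ Pmu) (IK _ Pnu) HC.
rewrite !(finpart_mass Pmu) /= !(mom2_finpart Pmu) !(mom2_finpart Pnu) in h.
apply: (le_trans h); rewrite [leRHS](splitr e); apply: lerD.
  apply: (@le_trans _ _ (e / 2 / A * A)); last by rewrite divfK// lt0r_neq0.
  apply: ler_wpM2l; first exact: ltW.
  have := Mmu i; have := Mmu j; have := Mnu i; have := Mnu j; rewrite /A.
  move: (mom2 _ _) (mom2 _ _) (mom2 _ _) (mom2 _ _) => a b c' d' h1 h2 h3 h4; nra.
apply: (@le_trans _ _ (B * (e / 2 / B))); last by rewrite mulrC divfK// lt0r_neq0.
have eB : 0 < e / 2 / B by rewrite !divr_gt0.
apply: (@le_trans _ _ (C * (p j + p i) * (e / 2 / B))).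
  rewrite -mulrA ler_wpM2l// mulrDl lerD// ler_wpM2l// ltW//.
by rewrite ler_wpM2r ?(ltW eB)// /B lerDl.
Qed.

Section Curve.
Variable mu : R -> 'I_n -> measure_rV R d.
Hypothesis Pmu : forall t : R, 0 <= t -> in_P m p E (mu t).
Notation within0 t := (within [set s : R | 0 <= s] (nbhs (t : R))).
Hypothesis mu_cont : forall t r : R, 0 <= t -> 0 < r -> \forall s \near within0 t,
  W2_near (mu s) (mu t) r \/ W2_near (mu t) (mu s) r.

Lemma curve_mom2_cvg t j a : 0 <= t ->
  mom2 (mu s j) a @[s --> within0 t] --> mom2 (mu t j) a.
Proof.
move=> t0; apply/cvgrPdist_le => e e0; set S := mom2 (mu t j) a.
have S0 : 0 <= S by exact: mom2_ge0.
(* Fitted to the a priori bound 2 S + 2 on nearby moments, which comes from the comparison with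
   parameter 1 and r <= 1; then h (2 S + 2) = e/2. *)
pose h := e / 2 / (2 * S + 2).
have h0 : 0 < h by rewrite !divr_gt0// ltr_wpDl// mulr_ge0.
have h1 : 0 < 1 + h^-1 by rewrite addr_gt0// invr_gt0.
pose r := Num.min 1 (e / 2 / (1 + h^-1)).
have r0 : 0 < r by rewrite lt_min ltr01 !divr_gt0.
near=> s.
have s0 : 0 <= s by near: s; exact: withinT.
have H : W2_near (mu s) (mu t) r \/ W2_near (mu t) (mu s) r by near: s; exact: mu_cont.
have H' : W2_near (mu t) (mu s) r \/ W2_near (mu s) (mu t) r by rewrite or_comm.
have a1 := mom2_near j a (Pmu s0) (Pmu t0) H ltr01.
have a2 := mom2_near j a (Pmu s0) (Pmu t0) H h0.
have a3 := mom2_near j a (Pmu t0) (Pmu s0) H' h0.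
rewrite -/S in a1 a2 a3 *; move: (mom2 (mu s j) a) a1 a2 a3 => X; rewrite invr1 => a1 a2 a3.
have r1 : r <= 1 by rewrite ge_min lexx.
have re : (1 + h^-1) * r <= e / 2.
  by rewrite mulrC -ler_pdivlMr// ge_min lexx orbT.
have hS : h * (2 * S + 2) = e / 2.
  by rewrite /h divfK// gt_eqF// ltr_wpDl// mulr_ge0.
by rewrite ler_norml; apply/andP; split; nra.
Unshelve. all: by end_near.
Qed.

Lemma curve_lyap_cvg t : 0 <= t ->
  lyap m p E (mu s) @[s --> within0 t] --> lyap m p E (mu t).
Proof.
move=> t0; apply: cvg_big => [|j _]; first exact: add_continuous.
by apply: cvgM; [exact: cvg_cst|exact: curve_mom2_cvg].
Qed.

Lemma curve_pairing_cvg (K : V * V -> R) i j t : 0 <= t -> continuous K ->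
  (forall h, 0 < h -> exists2 C, 0 <= C & forall z, `|K z| <= h * sq2 z + C) ->
  (forall nu, in_P m p E nu -> (finpart (nu i) \x finpart (nu j))%E.-integrable setT
      (EFin \o (K : BV * BV -> R))) ->
  \int[(finpart (mu s i) \x finpart (mu s j))%E]_z K z @[s --> within0 t] -->
  \int[(finpart (mu t i) \x finpart (mu t j))%E]_z K z.
Proof.
move=> t0 cK gK IK; apply/cvgrPdist_le => e e0.
pose M := \sum_k mom2 (mu t k) 0.
have M0 : 0 <= M by apply: sumr_ge0 => k _; exact: mom2_ge0.
(* Near t the moments are at most twice those at t plus 2, by the comparison with parameter 1; this
   bound is fixed before the radius is chosen. *)
have M20 : 0 <= 2 * M + 2 by rewrite addr_ge0// mulr_ge0.
have kM k : mom2 (mu t k) 0 <= M.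
  by rewrite /M (bigD1 k)//= lerDl sumr_ge0// => l _; exact: mom2_ge0.
have [r r0 Hr] := pairing_near cK M20 e0 gK IK.
pose q := Num.min r 1.
have q0 : 0 < q by rewrite lt_min r0 ltr01.
near=> s.
have s0 : 0 <= s by near: s; exact: withinT.
have H : W2_near (mu s) (mu t) q \/ W2_near (mu t) (mu s) q by near: s; exact: mu_cont.
have W2_mono mu' nu' : W2_near mu' nu' q -> W2_near mu' nu' r.
  move=> h k; have [g cg gq] := h k; exists g => //.
  by rewrite (lt_le_trans gq)// lee_fin ge_min lexx.
have kMt k : mom2 (mu t k) 0 <= 2 * M + 2 by have := kM k; lra.
have kMs k : mom2 (mu s k) 0 <= 2 * M + 2.
  have := mom2_near k 0 (Pmu s0) (Pmu t0) H ltr01; rewrite invr1.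
  have : q <= 1 by rewrite ge_min lexx orbT.
  have := kM k; nra.
case: H => /W2_mono H; last exact: (Hr _ _ (Pmu t0) (Pmu s0) H kMt kMs).
by rewrite distrC; exact: (Hr _ _ (Pmu s0) (Pmu t0) H kMs kMt).
Unshelve. all: by end_near.
Qed.

End Curve.

End Curves.

(** * The truncated weak formulation *)

Section TruncatedSquare.
Context {R : realType} {d : nat}.
Notation V := 'rV[R]_d.
Variable xo : V.
Implicit Types (th : R) (x v : V).

(* A smooth compactly supported truncation of [sqnorm (x - xo)], recovered as [th]
   tends to 0. *)
Definition tsq th x : R := th^-1 * tid (th * sqnorm (x - xo)).

Definition tsq_grad th x : V := (2 * 'D_1 tid (th * sqnorm (x - xo))) *: (x - xo).

Lemma smooth_tsq (U : normedModType R) (g : U -> V) th :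
  (forall k, smooth (fun w => g w 0 k)) -> smooth (fun w => tsq th (g w)).
Proof.
move=> sg; apply: smoothM; first exact: smooth_cst.
apply: smooth_comp1; first exact: smooth_tid.
by apply: smoothM; [exact: smooth_cst|exact: smooth_sqnorm].
Qed.

Lemma tsqE th x : 0 < th -> tsq th x = sqnorm (x - xo) * cutoff (th * sqnorm (x - xo)).
Proof. by move=> th0; rewrite /tsq /tid mulrA mulKf// gt_eqF. Qed.

Lemma tsq_ge0 th x : 0 < th -> 0 <= tsq th x.
Proof. by move=> th0; rewrite tsqE// mulr_ge0 ?sqnorm_ge0// cutoff_ge0. Qed.

Lemma tsq_le th x : 0 < th -> tsq th x <= sqnorm (x - xo).
Proof.
move=> th0; rewrite tsqE// ler_piMr ?sqnorm_ge0// cutoff_le1// mulr_ge0 ?sqnorm_ge0//.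
exact: ltW.
Qed.

Lemma tsq_out th x : 0 < th -> th^-1 <= sqnorm (x - xo) -> tsq th x = 0.
Proof.
move=> th0 xth; rewrite tsqE// cutoff_ge1 ?mulr0//.
by rewrite -(ler_pM2l th0) mulfV ?gt_eqF// in xth.
Qed.

Lemma grad_tsq th x : 0 < th -> grad (tsq th) x = tsq_grad th x.
Proof.
move=> th0; apply/rowP => k; rewrite !mxE.
have sq : smooth (fun y : V => sqnorm (y - xo)).
  by apply: smooth_sqnorm; exact: smooth_coord.
have s1 : smooth (fun y : V => th * sqnorm (y - xo)).
  by apply: smoothM => //; exact: smooth_cst.
have d1 : derivable (tid : R -> R) (th * sqnorm (x - xo)) 1.
  by apply: diff_derivable; exact: smooth_differentiable smooth_tid.
rewrite (_ : tsq th = th^-1 *: (fun y => tid (th * sqnorm (y - xo))))//.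
rewrite deriveZ/=; last first.
  apply: diff_derivable; apply: smooth_differentiable.
  by apply: smooth_comp1 => //; exact: smooth_tid.
rewrite derive_comp1//; last exact: smooth_differentiable.
rewrite (_ : (fun y => th * sqnorm (y - xo)) = th *: (fun y => sqnorm (y - xo)))//.
rewrite deriveZ/=; last by apply: diff_derivable; exact: smooth_differentiable.
rewrite derive_sqnorm /dotv (bigD1 k)//= big1 ?addr0 => [|l lk]; last first.
  by rewrite mxE (negbTE lk) mul0r.
rewrite !mxE !eqxx mul1r -![_ *: _]/(_ * _).
by field; exact: lt0r_neq0.
Qed.

Lemma measurable_tsq th : measurable_fun setT (tsq th : borel_rV R d -> R).
Proof.
apply: measurable_continuous_rV; apply: continuous_smooth.
by apply: (@smooth_tsq V id); exact: smooth_coord.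
Qed.

Lemma continuous_dtid : continuous ('D_1 (tid : R -> R)).
Proof. exact: (continuous_smooth (@smooth_derive R R tid 1 smooth_tid)). Qed.

Lemma continuous_tsq_coef th : continuous (fun x => 2 * 'D_1 tid (th * sqnorm (x - xo))).
Proof.
have c1 : continuous (fun x : V => th * sqnorm (x - xo)).
  apply: continuous_smooth; apply: smoothM; first exact: smooth_cst.
  by apply: smooth_sqnorm; exact: smooth_coord.
apply: (@CkM R V 0); first exact: (Ck_cst 0).
move=> x; apply: (@continuous_comp _ _ _ (fun x => th * sqnorm (x - xo)) ('D_1 tid)).
  exact: c1.
exact: continuous_dtid.
Qed.

Lemma continuous_tsq_grad_coord th k : continuous (fun x => tsq_grad th x 0 k).
Proof.
have -> : (fun x => tsq_grad th x 0 k) = (fun x =>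
    2 * 'D_1 tid (th * sqnorm (x - xo)) * (x 0 k - xo 0 k)).
  by apply/funext => x; rewrite !mxE.
apply: (@CkM R V 0); first exact: continuous_tsq_coef.
by apply: continuous_smooth; apply: smoothB; [exact: smooth_coord|exact: smooth_cst].
Qed.

Lemma measurable_tsq_grad th :
  measurable_fun setT (tsq_grad th : borel_rV R d -> borel_rV R d).
Proof.
apply: measurable_fun_rV => k; apply: measurable_continuous_rV.
exact: continuous_tsq_grad_coord.
Qed.

(** The constant does not depend on [th], as domination requires when [th] tends to 0. *)
Lemma tsq_grad_bound : exists2 c, 0 <= c & forall th x, 0 < th ->
  sqnorm (tsq_grad th x) <= c * sqnorm (x - xo).
Proof.
have [K K0 HK] := @derive_tid_bound R; exists (4 * K ^+ 2) => [|th x th0].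
  by rewrite mulr_ge0// sqr_ge0.
rewrite sqnormZ ler_wpM2r ?sqnorm_ge0// exprMn.
rewrite (_ : 2 ^+ 2 = 4 :> R) ?ler_wpM2l//; last by rewrite expr2; lra.
set D := 'D_1 tid _; rewrite -(real_normK (num_real D)) lerXn2r ?nnegrE// HK//.
by rewrite mulr_ge0 ?sqnorm_ge0// ltW.
Qed.

Lemma tsq_grad_out th x : 0 < th -> th^-1 < sqnorm (x - xo) -> tsq_grad th x = 0.
Proof.
move=> th0 xth; rewrite /tsq_grad derive_tid_out ?mulr0 ?scale0r//.
by rewrite -(ltr_pM2l th0) mulfV ?gt_eqF// in xth.
Qed.

Notation thN := (fun N : nat => N.+1%:R^-1 : R).

Let thN_cvg (s : R) : thN N * s @[N --> \oo] --> (0 : R).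
Proof. by rewrite -(mul0r s); apply: cvgM; [exact: cvg_harmonic|exact: cvg_cst]. Qed.

Lemma tsq_cvg x : tsq (thN N) x @[N --> \oo] --> sqnorm (x - xo).
Proof.
have h : sqnorm (x - xo) * cutoff (thN N * sqnorm (x - xo)) @[N --> \oo] -->
    sqnorm (x - xo) * 1.
  apply: cvgM; first exact: cvg_cst.
  have cc : cutoff r @[r --> (0 : R)] --> (1 : R).
    by have := @continuous_smooth R R _ (@smooth_cutoff R) (0 : R); rewrite /continuous_at cutoff0.
  apply: (@cvg_comp _ _ _ (fun N => thN N * sqnorm (x - xo)) cutoff) cc.
  exact: thN_cvg.
rewrite mulr1 in h.
have -> : (fun N => tsq (thN N) x) =
    (fun N => sqnorm (x - xo) * cutoff (thN N * sqnorm (x - xo))).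
  by apply/funext => N; rewrite tsqE// invr_gt0.
exact: h.
Qed.

Lemma tsq_grad_cvg x v :
  dotv (tsq_grad (thN N) x) v @[N --> \oo] --> dotv (2 *: (x - xo)) v.
Proof.
have h : 2 * 'D_1 tid (thN N * sqnorm (x - xo)) * dotv (x - xo) v @[N --> \oo] -->
    2 * 1 * dotv (x - xo) v.
  apply: cvgM; last exact: cvg_cst.
  apply: cvgM; first exact: cvg_cst.
  have cc : 'D_1 tid r @[r --> (0 : R)] --> (1 : R).
    by have := @continuous_dtid (0 : R); rewrite /continuous_at derive_tid0.
  apply: (@cvg_comp _ _ _ (fun N => thN N * sqnorm (x - xo)) ('D_1 tid)) cc.
  exact: thN_cvg.
rewrite mulr1 -dotvZl in h.
have -> : (fun N => dotv (tsq_grad (thN N) x) v) =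
    (fun N => 2 * 'D_1 tid (thN N * sqnorm (x - xo)) * dotv (x - xo) v).
  by apply/funext => N; rewrite dotvZl.
exact: h.
Qed.

End TruncatedSquare.

(** * Products of a time weight and the truncated square *)

Section TestFunction.
Context {R : realType} {d : nat}.
Notation V := 'rV[R]_d.
Variables (xo : V) (a : R -> R) (s0 s1 th : R).
Hypotheses (sa : smooth a) (s00 : 0 < s0) (th0 : 0 < th).
Hypothesis a_out : forall t, t < s0 \/ s1 < t -> a t = 0.

Definition tfun (z : R * V) : R := a z.1 * tsq xo th z.2.

Lemma smooth_fst : smooth (fst : R * V -> R).
Proof.
move=> k; apply: (@Ck_linear _ _ k (fst : {linear (R * V)%type -> R})).
by move=> z; exact: cvg_fst.
Qed.

Lemma smooth_snd_coord k : smooth (fun z : R * V => z.2 0 k).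
Proof.
move=> j; have @f : {linear (R * V)%type -> R}.
  by exists (fun z : R * V => z.2 0 k); do 2![eexists]; do ?[constructor];
     rewrite ?mxE// => ? *; rewrite ?mxE//; move=> ?; rewrite !mxE.
apply: (@Ck_linear _ _ j f) => z.
apply: (@continuous_comp _ _ _ (snd : R * V -> V) (fun x : V => x 0 k)).
  exact: cvg_snd.
exact: coord_continuous.
Qed.

Lemma test_function_tfun : test_function tfun.
Proof.
(* A compact set that contains every point where both factors are nonzero; being closed, it also
   contains the support. *)
pose B := `[s0, s1]%classic `*` [set x : V | sqnorm (x - xo) <= th^-1].
have cB : compact B.
  apply: compact_setX; first exact: segment_compact.
  apply: (subclosed_compact _ (@compact_sqnorm_le R d (2 * th^-1 + 2 * sqnorm xo))).
    rewrite (_ : [set x | _] = (fun x => sqnorm (x - xo)) @^-1` [set y | y <= th^-1])//.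
    apply: closed_comp; last exact: closed_le.
    move=> x _; have : smooth (fun x : V => sqnorm (x - xo)).
      by apply: smooth_sqnorm; exact: smooth_coord.
    by move=> /continuous_smooth; exact.
  move=> x /= h; have := sqnormD_le (x - xo) xo; rewrite subrK; lra.
have clB : closed B.
  by apply: compact_closed => //; exact: norm_hausdorff.
have sB : tsupport tfun `<=` B.
  rewrite [X in _ `<=` X]((closure_id B).1 clB); apply: closureS => z /=.
  rewrite /tfun mulf_eq0 negb_or => /andP[az bz]; split => /=.
    rewrite in_itv/= !leNgt; apply/andP; split; apply/negP => h;
      by move: az; rewrite a_out ?eqxx//; [left + right].
  by rewrite leNgt; apply/negP => /ltW h; move: bz; rewrite tsq_out ?eqxx.
split.
- apply: smoothM; first by apply: smooth_comp1 => //; exact: smooth_fst.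
  by apply: smooth_tsq; exact: smooth_snd_coord.
- by apply: subclosed_compact sB => //; exact: closed_closure.
- move=> z /sB[/=]; rewrite in_itv/= => /andP[h _] _; exact: lt_le_trans h.
Qed.

Lemma dt_tfun t x : dt tfun t x = 'D_1 a t * tsq xo th x.
Proof.
rewrite /dt derive1E /tfun /=.
rewrite (_ : (fun s => _) = a * cst (tsq xo th x))// deriveM//; last first.
  by apply: diff_derivable; exact: smooth_differentiable.
by rewrite derive_cst scaler0 add0r mulrC.
Qed.

Lemma gradx_tfun t x : gradx tfun t x = a t *: tsq_grad xo th x.
Proof.
apply/rowP => k; rewrite !mxE.
rewrite (_ : (fun z => tfun (t, z)) = a t *: (tsq xo th))// deriveZ; last first.
  apply: diff_derivable; apply: smooth_differentiable.
  by apply: (@smooth_tsq _ _ _ V id); exact: smooth_coord.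
have := congr1 (fun w : V => w 0 k) (grad_tsq xo x th0).
by rewrite /= !mxE => ->.
Qed.

End TestFunction.

Section RealDominated.
Context d (T : measurableType d) (R : realType) (mu : {measure set T -> \bar R}).
Variables (D : set T) (mD : measurable D).

Lemma Rdominated_convergence (f_ : nat -> T -> R) (f g : T -> R) :
  (forall N, measurable_fun D (f_ N)) ->
  (forall x, D x -> f_ N x @[N --> \oo] --> f x) ->
  mu.-integrable D (EFin \o g) ->
  (forall N x, D x -> `|f_ N x| <= g x) ->
  mu.-integrable D (EFin \o f) /\
  \int[mu]_(x in D) f_ N x @[N --> \oo] --> \int[mu]_(x in D) f x.
Proof.
move=> mf_ cf Ig fg.
have mf : measurable_fun D f.
  by apply: (measurable_fun_cvg mf_) => x Dx; exact: cf.
have [||||If _ h] := @dominated_convergence _ _ _ mu D mD (fun N => EFin \o f_ N)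
    (EFin \o f) (EFin \o g) _ _ _ Ig _.
- by move=> N; apply/measurable_EFinP; exact: mf_.
- exact/measurable_EFinP.
- by apply: aeW => x Dx; apply: cvg_EFin; [exact: nearW|exact: cf].
- by apply: aeW => x N Dx; rewrite lee_fin; exact: fg.
split=> //; apply: (cvg_comp _ _ h).
rewrite /Rintegral; have /fineK <- := integrable_fin_num mD If.
exact: fine_cvg.
Qed.

End RealDominated.

Section Truncated.
Context {R : realType} {d n : nat}.
Notation BV := (borel_rV R d).
Notation V := 'rV[R]_d.
Variables (m p : 'I_n -> R) (E : V).
Hypotheses (m0 : forall j, 0 < m j) (p0 : forall j, 0 < p j) (n0 : (0 < n)%N).
Variables (W : V -> 'M[R]_n) (kappa : 'M[R]_n).
Hypothesis hW : admissible W kappa.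
Notation xo := (x_infty m p E).
Notation Wij i j := (fun z : V => W z i j).
Implicit Types (th : R) (mu : 'I_n -> measure_rV R d).

Definition obs th mu i : R := \int[mu i]_x tsq xo th x.

(** The drift is itself an integral; as one integral over a product measure, the transport term
    falls under the continuity result for pairings. *)
Definition flux th mu i j : R := \int[(finpart (mu i) \x finpart (mu j))%E]_z
  dotv (tsq_grad xo th z.1) (grad (Wij i j) ((z.1 : V) - z.2)).

Definition flux_lim mu i j : R := \int[(finpart (mu i) \x finpart (mu j))%E]_z
  dotv (2 *: ((z.1 : V) - xo)) (grad (Wij i j) ((z.1 : V) - z.2)).

Lemma tsq_grad_growth : exists2 c, 0 <= c & forall th x, 0 < th ->
  sqnorm (tsq_grad xo th x) <= c * (1 + sqnorm x).
Proof.
have [c c0 hc] := tsq_grad_bound xo; exists (c * (2 + 2 * sqnorm xo)).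
  by rewrite mulr_ge0// addr_ge0// mulr_ge0// sqnorm_ge0.
move=> th x th0; apply: (le_trans (hc _ _ th0)); rewrite -mulrA ler_wpM2l//.
have := sqnormB_le x xo; have := sqnorm_ge0 x; have := sqnorm_ge0 xo; nra.
Qed.

Section Static.
Variable mu : 'I_n -> measure_rV R d.
Hypothesis Pmu : in_P m p E mu.

Lemma tsq_integrable th i : 0 < th ->
  (finpart (mu i)).-integrable setT (EFin \o (tsq xo th : BV -> R)).
Proof.
move=> th0; apply: (integrable_dominated (measurable_tsq xo th) _
  (integrable_sqnorm xo (finpart_mom2 Pmu i))).
by move=> x; rewrite ger0_norm ?tsq_ge0// tsq_le.
Qed.

Lemma obs_ge0 th i : 0 < th -> 0 <= obs th mu i.
Proof. by move=> th0; apply: Rintegral_ge0 => x _; exact: tsq_ge0. Qed.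

Lemma obs_le th i : 0 < th -> obs th mu i <= mom2 (mu i) xo.
Proof.
move=> th0; rewrite /obs -(mom2_finpart Pmu) -(Rintegral_finpart _ (in_P_finite Pmu i)).
apply: le_Rintegral => //; first exact: tsq_integrable.
  exact: integrable_sqnorm (finpart_mom2 Pmu i).
by move=> x _; exact: tsq_le.
Qed.

Lemma inner_integral (a a' th : R) i : 0 < th ->
  \int[mu i]_x (a' * tsq xo th x -
     m i * dotv (a *: tsq_grad xo th x) (drift W mu i x)) =
  a' * obs th mu i - m i * a * \sum_j flux th mu i j.
Proof.
move=> th0; have [c c0 hc] := tsq_grad_growth.
have gm := measurable_tsq_grad xo th; have gc x := hc th x th0.
have fi := in_P_finite Pmu i.
have I1 := tsq_integrable i th0.
have I2 := drift_pairing_integrable hW Pmu gm gc i.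
rewrite /obs /flux -(drift_pairing hW Pmu gm gc) -!(Rintegral_finpart _ fi).
rewrite -RintegralZl// -RintegralZl// -RintegralB//; last 2 first.
- exact: integrableZ_R.
- exact: integrableZ_R.
by apply: eq_Rintegral => x _; rewrite dotvZl mulrA.
Qed.

Notation thN := (fun N : nat => N.+1%:R^-1 : R).

Lemma obs_cvg i : obs (thN N) mu i @[N --> \oo] --> mom2 (mu i) xo.
Proof.
rewrite -(mom2_finpart Pmu).
under eq_fun do rewrite /obs -(Rintegral_finpart _ (in_P_finite Pmu i)).
have [] // := @Rdominated_convergence _ _ _ (finpart (mu i)) setT measurableT
  (fun N => tsq xo (thN N) : BV -> R) (fun x => sqnorm ((x : V) - xo))
  (fun x => sqnorm ((x : V) - xo)).
- by move=> N; exact: measurable_tsq.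
- by move=> x _; exact: tsq_cvg.
- exact: integrable_sqnorm (finpart_mom2 Pmu i).
- by move=> N x _; rewrite ger0_norm ?tsq_ge0 ?invr_gt0// tsq_le// invr_gt0.
Qed.

Lemma sqnorm_weight_integrable i j (c : R) :
  (finpart (mu i) \x finpart (mu j))%E.-integrable setT
   (EFin \o (fun z : BV * BV => 1 + c * sqnorm ((z.1 : V) - xo) + 2 * sqnorm ((z.2 : V) - xo))).
Proof.
apply: integrableD_R.
  apply: integrableD_R; first exact: prod_integrable_cst.
  apply: integrableZ_R; exact: (prod_integrable_fst _ (integrable_sqnorm xo (finpart_mom2 Pmu i))).
apply: integrableZ_R; exact: (prod_integrable_snd _ (integrable_sqnorm xo (finpart_mom2 Pmu j))).
Qed.

End Static.

Lemma flux_pointwise_bound : exists C c : R, [/\ 0 <= C, 0 <= c & forall th x y i j, 0 < th ->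
  `|dotv (tsq_grad xo th x) (grad (Wij i j) (x - y))| <=
  C * (1 + (2 + c) * sqnorm (x - xo) + 2 * sqnorm (y - xo))].
Proof.
have [C C0 gC] := gradW_bound hW; have [c c0 hc] := tsq_grad_bound xo.
exists C, c; split=> // th x y i j th0; apply: (le_trans (gC _ _ _ _)).
rewrite ler_wpM2l//; have := hc th x th0.
have := sqnormB_le (x - xo) (y - xo); rewrite opprB addrA subrK.
have := sqnorm_ge0 (x - xo); nra.
Qed.

Lemma measurable_flux th i j : measurable_fun setT (fun z : BV * BV =>
  dotv (tsq_grad xo th z.1) (grad (Wij i j) ((z.1 : V) - z.2))).
Proof.
apply: measurable_dotv.
  exact: (measurableT_comp (measurable_tsq_grad xo th) measurable_fst).
by apply: (measurable_gradW hW); exact: measurable_prod_sub.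
Qed.

Lemma flux_bound : exists B c : R, [/\ 0 <= B, 0 <= c & forall mu, in_P m p E mu ->
  forall th i j, 0 < th -> `|flux th mu i j| <=
  B * (p i * p j + (2 + c) * (p j * mom2 (mu i) xo) + 2 * (p i * mom2 (mu j) xo))].
Proof.
have [C [c [C0 c0 hC]]] := flux_pointwise_bound; exists C, c; split=> // mu Pmu th i j th0.
have Iw := sqnorm_weight_integrable Pmu i j (2 + c).
have I1 : (finpart (mu i) \x finpart (mu j))%E.-integrable setT (EFin \o (fun z : BV * BV =>
    dotv (tsq_grad xo th z.1) (grad (Wij i j) ((z.1 : V) - z.2)))).
  apply: (integrable_dominated (measurable_flux th i j) _ (integrableZ_R C Iw)).
  by case=> x y; exact: hC.
apply: (le_trans (le_normr_Rintegral _ _)) => //.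
apply: (le_trans (le_Rintegral _ (integrable_norm I1) (integrableZ_R C Iw) _)) => //.
  by case=> x y _; exact: hC.
rewrite RintegralZl// ler_wpM2l//.
have J1 := integrable_sqnorm xo (finpart_mom2 Pmu i).
have J2 := integrable_sqnorm xo (finpart_mom2 Pmu j).
have K1 := prod_integrable_fst (finpart (mu j)) J1.
have K2 := prod_integrable_snd (finpart (mu i)) J2.
have Kc := prod_integrable_cst (finpart (mu i)) (finpart (mu j)) 1.
rewrite RintegralD//; last 2 first.
- by apply: integrableD_R => //; exact: integrableZ_R.
- exact: integrableZ_R.
rewrite RintegralD//; last exact: integrableZ_R.
rewrite !RintegralZl//.
rewrite (prod_Rintegral_fst (finpart (mu j)) J1) (prod_Rintegral_snd (finpart (mu i)) J2).
rewrite (prod_Rintegral_cst (finpart (mu i)) (finpart (mu j))) !(finpart_mass Pmu) /= mulr1.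
by rewrite -(mom2_finpart Pmu xo i) -(mom2_finpart Pmu xo j).
Qed.

Lemma flux_cvg mu i j : in_P m p E mu ->
  flux (N.+1%:R^-1) mu i j @[N --> \oo] --> flux_lim mu i j.
Proof.
move=> Pmu; have [C [c [C0 c0 hC]]] := flux_pointwise_bound.
have Iw := sqnorm_weight_integrable Pmu i j (2 + c).
have [] // := @Rdominated_convergence _ _ _ (finpart (mu i) \x finpart (mu j))%E setT measurableT
  (fun N (z : BV * BV) => dotv (tsq_grad xo (N.+1%:R^-1) z.1) (grad (Wij i j) ((z.1 : V) - z.2)))
  (fun z => dotv (2 *: ((z.1 : V) - xo)) (grad (Wij i j) ((z.1 : V) - z.2)))
  (fun z => C * (1 + (2 + c) * sqnorm ((z.1 : V) - xo) + 2 * sqnorm ((z.2 : V) - xo))).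
- by move=> N; exact: measurable_flux.
- by move=> z _; exact: tsq_grad_cvg.
- exact: integrableZ_R.
- by move=> N [x y] _; apply: hC; rewrite invr_gt0.
Qed.

Lemma continuous_flux_kernel th i j : continuous (fun z : V * V =>
  dotv (tsq_grad xo th z.1) (grad (Wij i j) (z.1 - z.2))).
Proof.
apply: (@Ck_sum R (V * V)%type _ _ 0) => k; apply: (@CkM R (V * V)%type 0).
  move=> z; apply: (@continuous_comp _ _ _ (fst : V * V -> V) (fun x => tsq_grad xo th x 0 k)).
    exact: cvg_fst.
  exact: continuous_tsq_grad_coord.
move=> z; apply: (@continuous_comp _ _ _ (fun z : V * V => z.1 - z.2) (fun x => grad (Wij i j) x 0 k)).
  exact: sub_continuous.
move=> x; apply: (@continuous_comp _ _ _ (grad (Wij i j)) (fun y => y 0 k)).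
  by have [_] := W_C1 hW i j; exact.
exact: coord_continuous.
Qed.

(** The truncated field is bounded, and the bound on [grad W] holds for all multiples of it: applied
    to r times the field and divided by r, it has a coefficient of order C / r on the quadratic
    term. *)
Lemma subquadratic_flux_kernel th i j : 0 < th -> forall h, 0 < h ->
  exists2 C, 0 <= C & forall z : V * V,
   `|dotv (tsq_grad xo th z.1) (grad (Wij i j) (z.1 - z.2))| <= h * sq2 z + C.
Proof.
move=> th0 h h0; have [C C0 gC] := gradW_bound hW; have [c c0 hc] := tsq_grad_bound xo.
pose U := c * th^-1.
have U0 : 0 <= U by rewrite mulr_ge0// invr_ge0 ltW.
have uU x : sqnorm (tsq_grad xo th x) <= U.
  have [hx|hx] := leP (sqnorm (x - xo)) th^-1.
    by apply: (le_trans (hc _ _ th0)); rewrite ler_wpM2l.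
  by rewrite tsq_grad_out// sqnorm0.
(* The coefficient of [sq2 z] becomes 2 C / r, which is at most h; the 1 keeps r positive when C =
   0. *)
pose r := (2 * C + 1) / h.
have r0 : 0 < r by rewrite divr_gt0// ltr_wpDl// mulr_ge0.
exists (C / r + C * r * U).
  apply: addr_ge0; first by rewrite divr_ge0 ?(ltW r0).
  by rewrite mulr_ge0 ?(mulr_ge0 C0 (ltW r0)).
move=> z; have := gC i j (z.1 - z.2) (r *: tsq_grad xo th z.1).
rewrite dotvZl normrM (gtr0_norm r0) sqnormZ -ler_pdivlMl// => H.
apply: (le_trans H); rewrite ler_pdivrMl//.
have -> : r * (h * sq2 z + (C / r + C * r * U)) = (2 * C + 1) * sq2 z + C + C * r ^+ 2 * U.
  by rewrite /r; field; rewrite !lt0r_neq0// ltr_wpDl// mulr_ge0.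
have h1 : C * sqnorm (z.1 - z.2) <= C * (2 * sq2 z).
  by rewrite ler_wpM2l// /sq2 mulrDr sqnormB_le.
have h2 : C * (r ^+ 2 * sqnorm (tsq_grad xo th z.1)) <= C * (r ^+ 2 * U).
  by rewrite ler_wpM2l// ler_wpM2l// sqr_ge0.
have := sq2_ge0 z; lra.
Qed.

End Truncated.

Lemma Rintegral_sub_support d (T : measurableType d) (R : realType)
    (mu : {measure set T -> \bar R}) (D I : set T) (f : T -> R) :
  I `<=` D -> (forall x, ~ I x -> f x = 0) ->
  \int[mu]_(x in D) f x = \int[mu]_(x in I) f x.
Proof.
move=> ID f0; rewrite Rintegral_mkcond [RHS]Rintegral_mkcond; congr Rintegral.
apply/funext => x; rewrite /patch; case: ifPn => xD; case: ifPn => xI //.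
  by apply: f0 => /mem_set; apply/negP.
by move: xD; rewrite mem_set//; apply: ID; exact/set_mem.
Qed.

Lemma cvg_within_ge0 (R : realType) (f : R -> R) (t l : R) : 0 < t ->
  f s @[s --> within [set s : R | 0 <= s] (nbhs t)] --> l -> f s @[s --> t] --> l.
Proof.
move=> t0 fl A /fl h; have {}h : \forall s \near t, 0 <= s -> A (f s) by exact: h.
suff : \forall s \near t, A (f s) by [].
near=> s; apply: (near h s) => //; apply: ltW; near: s; exact: lt_nbhsr.
Unshelve. all: by end_near.
Qed.

(** * The differential inequality in integrated form *)

Section WeakInequality.
Context {R : realType} {d n : nat}.
Notation BV := (borel_rV R d).
Notation V := 'rV[R]_d.
Variables (m p : 'I_n -> R) (E : V).
Hypotheses (m0 : forall j, 0 < m j) (p0 : forall j, 0 < p j) (n0 : (0 < n)%N).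
Variables (W : V -> 'M[R]_n) (kappa : 'M[R]_n).
Hypothesis hW : admissible W kappa.
Notation xo := (x_infty m p E).
Notation lam := (lambda0 m p kappa).
Variable mu : R -> 'I_n -> measure_rV R d.
Hypothesis Pmu : forall t : R, 0 <= t -> in_P m p E (mu t).
Notation within0 t := (within [set s : R | 0 <= s] (nbhs (t : R))).
Hypothesis mu_cont : forall t r : R, 0 <= t -> 0 < r -> \forall s \near within0 t,
  W2_near (mu s) (mu t) r \/ W2_near (mu t) (mu s) r.
Notation obs := (obs m p E).
Notation flux := (flux m p E W).
Notation flux_lim := (flux_lim m p E W).

Lemma curve_mom2_continuous (t : R) j a : 0 < t ->
  mom2 (mu s j) a @[s --> t] --> mom2 (mu t j) a.
Proof.
move=> t0; apply: cvg_within_ge0 => //.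
exact: (curve_mom2_cvg Pmu mu_cont (ltW t0)).
Qed.

Lemma curve_obs_continuous (th : R) i (t : R) : 0 < th -> 0 < t ->
  obs th (mu s) i @[s --> t] --> obs th (mu t) i.
Proof.
move=> th0 t0; apply: cvg_within_ge0 => //.
(* A single integral is turned into a pairing of species i with itself, the idle variable
   contributing the mass p_i. *)
have obsE s : 0 <= s -> obs th (mu s) i = (p i)^-1 *
    \int[(finpart (mu s i) \x finpart (mu s i))%E]_z tsq xo th z.1.
  move=> s0; rewrite (prod_Rintegral_fst _ (tsq_integrable (Pmu s0) i th0)).
  rewrite (finpart_mass (Pmu s0)) /= mulKf ?gt_eqF//.
  by rewrite (Rintegral_finpart _ (in_P_finite (Pmu s0) i)).
rewrite obsE; last exact: ltW.
apply: (@cvg_trans _ ((p i)^-1 *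
    \int[(finpart (mu s i) \x finpart (mu s i))%E]_z tsq xo th z.1 @[s --> within0 t])).
  by apply: near_eq_cvg; near=> s; rewrite obsE//; near: s; exact: withinT.
apply: cvgM; first exact: cvg_cst.
apply: (curve_pairing_cvg p0 Pmu mu_cont (K := fun z => tsq xo th z.1)); first exact: ltW.
- move=> z; apply: (@continuous_comp _ _ _ (fst : V * V -> V) (tsq xo th)).
    exact: cvg_fst.
  apply: continuous_smooth.
  by apply: (@smooth_tsq _ _ _ V id); exact: smooth_coord.
- move=> h h0; exists th^-1 => [|z]; first by rewrite invr_ge0 ltW.
  rewrite ger0_norm ?tsq_ge0//.
  have hz : 0 <= h * sq2 z by rewrite mulr_ge0 ?sq2_ge0// ltW.
  rewrite ler_wpDl//; have [hx|hx] := leP (sqnorm (z.1 - xo)) th^-1.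
    exact: le_trans (tsq_le _ _ th0) hx.
  by rewrite (tsq_out th0 (ltW hx)) invr_ge0 ltW.
- by move=> nu Pnu; exact: (prod_integrable_fst _ (tsq_integrable Pnu i th0)).
Unshelve. all: by end_near.
Qed.

Lemma curve_flux_continuous (th : R) i j (t : R) : 0 < th -> 0 < t ->
  flux th (mu s) i j @[s --> t] --> flux th (mu t) i j.
Proof.
move=> th0 t0; apply: cvg_within_ge0 => //.
apply: (curve_pairing_cvg p0 Pmu mu_cont (K := fun z => dotv (tsq_grad xo th z.1)
  (grad (fun z => W z i j) (z.1 - z.2)))); first exact: ltW.
- exact: (@continuous_flux_kernel R d n m p E W kappa hW th i j).
- exact: (@subquadratic_flux_kernel R d n m p E W kappa hW th i j th0).
move=> nu Pnu; have [c c0 hc] := tsq_grad_growth m p E.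
exact: (pairing_integrable hW Pnu (measurable_tsq_grad xo th) (fun x => hc th x th0)).
Qed.

Hypothesis hsol : solves m W mu.

Section Weight.
Variables (a : R -> R) (s0 s1 : R).
Hypotheses (sa : smooth a) (a_ge0 : forall t, 0 <= a t) (s00 : 0 < s0).
Hypothesis a_out : forall t, t < s0 \/ s1 < t -> a t = 0.
Notation da := ('D_1 a).
Notation I := `[s0, s1]%classic.

Let a_cont : continuous a. Proof. exact: continuous_smooth. Qed.

Let da_cont : continuous da.
Proof. exact: (continuous_smooth (@smooth_derive R R a 1 sa)). Qed.

Let da_out t : t < s0 \/ s1 < t -> da t = 0.
Proof.
case=> h; apply: (@derive_near_cst _ _ _ 0); near=> s; apply: a_out.
  by left; near: s; exact: lt_nbhsl.
by right; near: s; exact: lt_nbhsr.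
Unshelve. all: by end_near.
Qed.

Let Igt0 t : I t -> 0 < t.
Proof. by rewrite /= in_itv/= => /andP[h _]; exact: lt_le_trans h. Qed.

Let notI t : ~ I t -> t < s0 \/ s1 < t.
Proof.
move=> h; have [ts|st] := ltP t s0; first by left.
by right; rewrite ltNge; apply/negP => ts; apply: h; rewrite /= in_itv/= st.
Qed.

Let continuous_integrable (f : R -> R) : (forall t : R, 0 < t -> f s @[s --> t] --> f t) ->
  (@lebesgue_measure R).-integrable I (EFin \o f).
Proof.
move=> cf; apply: continuous_compact_integrable; first exact: segment_compact.
by apply: continuous_in_subspaceT => t /set_mem/Igt0; exact: cf.
Qed.

Definition rate th i (t : R) : R :=
  da t * obs th (mu t) i - m i * a t * \sum_j flux th (mu t) i j.

Lemma rate_continuous (th : R) i (t : R) : 0 < th -> 0 < t -> rate th i s @[s --> t] --> rate th i t.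
Proof.
move=> th0 t0; apply: cvgB; apply: cvgM; [exact: da_cont|exact: curve_obs_continuous| |].
  by apply: cvgM; [exact: cvg_cst|exact: a_cont].
by apply: cvg_big => [|j _]; [exact: add_continuous|exact: curve_flux_continuous].
Qed.

Lemma rate_integral0 th i : 0 < th -> \int[lebesgue_measure]_(t in I) rate th i t = 0.
Proof.
move=> th0; have := hsol i (test_function_tfun xo sa s00 th0 a_out); move=> <-.
rewrite -(@Rintegral_sub_support _ _ R (@lebesgue_measure R) `]0, +oo[%classic).
- apply: eq_Rintegral => t; rewrite inE/= in_itv/= andbT => t0.
  rewrite /rate -(inner_integral hW (Pmu (ltW t0)) (a t) (da t) i th0).
  by apply: eq_Rintegral => x _; rewrite dt_tfun// gradx_tfun.
- by move=> t /Igt0 t0; rewrite /= in_itv/= t0.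
- move=> t /notI h; rewrite /rate a_out// da_out//; ring.
Qed.

(** [U] is the limit of the truncated rates. These are continuous in time, hence measurable; [U]
    inherits measurability as a pointwise limit and the zero integral by domination. *)
Lemma weak_inequality : exists2 U : R -> R,
  (@lebesgue_measure R).-integrable I (EFin \o U) /\ \int[lebesgue_measure]_(t in I) U t = 0 &
  forall t, I t -> U t <= (da t - 2 * lam * a t) * lyap m p E (mu t).
Proof.
pose U_ N t := \sum_i (m i)^-1 * rate (N.+1%:R^-1) i t.
pose S i t := mom2 (mu t i) xo.
pose U t := \sum_i (m i)^-1 * (da t * S i t - m i * a t * \sum_j flux_lim (mu t) i j).
have [B [c [B0 c0 hB]]] := @flux_bound R d n m p E W kappa hW.
(* Majorises the rates for all N, by bounds free of the truncation; as second moments are continuous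
   in time, it is integrable on the compact interval. *)
pose g t := \sum_i (m i)^-1 * (`|da t| * S i t + m i * `|a t| *
  \sum_j B * (p i * p j + (2 + c) * (p j * S i t) + 2 * (p i * S j t))).
have thN0 N : 0 < N.+1%:R^-1 :> R by rewrite invr_gt0.
have mI : measurable I by exact: measurable_itv.
have rate_int N i : (@lebesgue_measure R).-integrable I (EFin \o rate (N.+1%:R^-1) i).
  by apply: continuous_integrable => t; exact: rate_continuous.
have U_cont N (t : R) : 0 < t -> U_ N s @[s --> t] --> U_ N t.
  move=> t0; apply: cvg_big => [|i _]; first exact: add_continuous.
  by apply: cvgM; [exact: cvg_cst|exact: rate_continuous].
have S_cont i (t : R) : 0 < t -> S i s @[s --> t] --> S i t.
  by move=> t0; exact: curve_mom2_continuous.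
have g_int : (@lebesgue_measure R).-integrable I (EFin \o g).
  apply: continuous_integrable => t t0.
  apply: cvg_big => [|i _]; first exact: add_continuous.
  apply: cvgM; first exact: cvg_cst.
  apply: cvgD; apply: cvgM.
  - by apply: cvg_norm; exact: da_cont.
  - exact: S_cont.
  - by apply: cvgM; [exact: cvg_cst|apply: cvg_norm; exact: a_cont].
  apply: cvg_big => [|j _]; first exact: add_continuous.
  apply: cvgM; first exact: cvg_cst.
  apply: cvgD; last first.
    by do 2 (apply: cvgM; first exact: cvg_cst); exact: S_cont.
  apply: cvgD; first exact: cvg_cst.
  by do 2 (apply: cvgM; first exact: cvg_cst); exact: S_cont.
have [||||IU cU] := @Rdominated_convergence _ _ _ (@lebesgue_measure R) I mI U_ U g.
- move=> N; have := continuous_integrable (U_cont N).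
  by move=> /integrableP[/measurable_EFinP].
- move=> t /Igt0 t0; apply: cvg_big => [|i _]; first exact: add_continuous.
  apply: cvgM; first exact: cvg_cst.
  apply: cvgB; apply: cvgM; [exact: cvg_cst| |exact: cvg_cst|].
    exact: (obs_cvg (Pmu (ltW t0))).
  apply: cvg_big => [|j _]; first exact: add_continuous.
  exact: (@flux_cvg R d n m p E W kappa hW (mu t) i j (Pmu (ltW t0))).
- exact: g_int.
- move=> N t /Igt0 t0; have Pt := Pmu (ltW t0).
  apply: (le_trans (ler_norm_sum _ _ _)); apply: ler_sum => i _.
  rewrite normrM (gtr0_norm (x := (m i)^-1)) ?invr_gt0// ler_wpM2l ?invr_ge0 ?(ltW (m0 i))//.
  apply: (le_trans (ler_normB _ _)); apply: lerD.
    rewrite normrM ler_wpM2l// ger0_norm ?obs_ge0//.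
    exact: obs_le.
  rewrite !normrM (gtr0_norm (m0 i)) ler_wpM2l//.
    by rewrite mulr_ge0// ltW.
  apply: (le_trans (ler_norm_sum _ _ _)); apply: ler_sum => j _; exact: hB.
exists U.
  split=> //; apply: (cvg_unique _ cU) => //.
  have -> : (fun N => \int[lebesgue_measure]_(t in I) U_ N t) = fun=> 0.
    have mIL : measurable (I : set (measurableTypeR R)) by exact: measurable_itv.
    apply/funext => N; rewrite /U_ Rintegral_sum_in// => [|i].
      apply: big1 => i _; rewrite (RintegralZl _ mIL (rate_int N i)).
      by rewrite rate_integral0 ?mulr0.
    exact: (integrableZl mIL (m i)^-1 (rate_int N i)).
  exact: cvg_cst.
move=> t /Igt0 t0; have Pt := Pmu (ltW t0).
(* The weights 1/m_i of [lyap] cancel the mobilities m_i and leave the double sum of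
   [dissipation_ge]. *)
have -> : U t = da t * lyap m p E (mu t) - a t * \sum_i \sum_j flux_lim (mu t) i j.
  rewrite /U /lyap !mulr_sumr -sumrB; apply: eq_bigr => i _; rewrite /S; field.
  exact: lt0r_neq0.
have := dissipation_ge m0 p0 n0 hW Pt => h.
have : a t * (2 * lam * lyap m p E (mu t)) <= a t * \sum_i \sum_j flux_lim (mu t) i j.
  by rewrite ler_wpM2l.
lra.
Qed.

End Weight.

End WeakInequality.

(** * Exponential decay *)

Section SmoothTime.
Context {R : realType}.

Lemma Rintegral_derive (F : R -> R) (a b : R) : a < b -> smooth F ->
  (@lebesgue_measure R).-integrable `[a, b] (EFin \o 'D_1 F) /\
  \int[lebesgue_measure]_(t in `[a, b]) 'D_1 F t = F b - F a.
Proof.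
move=> ab sF.
have cD : continuous ('D_1 F) := continuous_smooth (@smooth_derive R R F 1 sF).
have cF : continuous F := continuous_smooth sF.
split.
  apply: continuous_compact_integrable; first exact: segment_compact.
  exact: continuous_subspaceT.
rewrite /Rintegral (@continuous_FTC2 R ('D_1 F) F a b ab)//.
- exact: continuous_subspaceT.
- split.
  + by move=> t _; apply: diff_derivable; exact: smooth_differentiable.
  + by apply: cvg_at_right_filter; exact: cF.
  + by apply: cvg_at_left_filter; exact: cF.
- by move=> t _; rewrite derive1E.
Qed.

Lemma smooth_expRM (k : R) : smooth (fun t : R => expR (k * t)).
Proof.
apply: (@smooth_comp1 R R expR); first exact: smooth_expR.
by apply: smoothM; [exact: smooth_cst|exact: smooth_id].
Qed.

Lemma derive_expRM (k t : R) : 'D_1 (fun t : R => expR (k * t)) t = k * expR (k * t).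
Proof.
rewrite (derive_comp1 (g := expR) (u := fun t : R => k * t)); last 2 first.
- exact: derivable_expR.
- apply: smooth_differentiable.
  by apply: smoothM; [exact: smooth_cst|exact: smooth_id].
have -> : 'D_1 (fun t : R => k * t) t = k.
  have -> : (fun t : R => k * t) = k *: id by [].
  rewrite deriveZ; last exact: derivable_id.
  by rewrite derive_id -[_ *: _]/(_ * _) mulr1.
by rewrite derive_val.
Qed.

Lemma derive_weighted (k : R) (e F G : R -> R) (t : R) :
  derivable e t 1 -> derivable F t 1 -> derivable G t 1 -> 'D_1 e t = k * e t ->
  'D_1 (fun t => e t * (F t - G t)) t - k * (e t * (F t - G t)) =
  e t * ('D_1 F t - 'D_1 G t).
Proof.
move=> de dF dG De.
have -> : 'D_1 (fun t => e t * (F t - G t)) t =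
    e t *: 'D_1 (F - G) t + (F t - G t) *: 'D_1 e t.
  exact: (deriveM de (derivableB dF dG)).
rewrite (deriveB dF dG) De -![_ *: _]/(_ * _).
by move: (e t) (F t) (G t) ('D_1 F t) ('D_1 G t) => *; ring.
Qed.

Definition ramp (t0 dl t : R) : R := step ((t - t0) / dl).

Lemma smooth_ramp t0 dl : smooth (ramp t0 dl).
Proof.
apply: (@smooth_comp1 R R step); first exact: smooth_step.
apply: smoothM; last exact: smooth_cst.
by apply: smoothB; [exact: smooth_id|exact: smooth_cst].
Qed.

Lemma derive_ramp t0 dl t : 'D_1 (ramp t0 dl) t = dl^-1 * 'D_1 step ((t - t0) / dl).
Proof.
have su : smooth (fun t : R => (t - t0) / dl).
  apply: smoothM; last exact: smooth_cst.
  by apply: smoothB; [exact: smooth_id|exact: smooth_cst].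
have ds : derivable (step : R -> R) ((t - t0) / dl) 1.
  by apply: diff_derivable; exact: smooth_differentiable smooth_step.
have -> : 'D_1 (ramp t0 dl) t =
    'D_1 (fun t : R => (t - t0) / dl) t * 'D_1 step ((t - t0) / dl).
  exact: (@derive_comp1 R R step (fun t : R => (t - t0) / dl) t 1 ds
    (smooth_differentiable t su)).
congr (_ * _).
have -> : (fun t : R => (t - t0) / dl) = dl^-1 *: (id - cst t0).
  by apply/funext => s; rewrite mulrC.
have d1 : derivable (id - cst t0 : R -> R) t 1.
  by apply: derivableB; [exact: derivable_id|exact: derivable_cst].
rewrite deriveZ// deriveB; [|exact: derivable_id|exact: derivable_cst].
by rewrite derive_id derive_cst subr0 -[_ *: _]/(_ * _) mulr1.
Qed.

Lemma derive_ramp_ge0 t0 dl t : 0 < dl -> 0 <= 'D_1 (ramp t0 dl) t.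
Proof.
by move=> dl0; rewrite derive_ramp mulr_ge0 ?invr_ge0 ?(ltW dl0)// derive_step_ge0.
Qed.

Lemma derive_ramp_out t0 dl t : 0 < dl -> dl < `|t - t0| -> 'D_1 (ramp t0 dl) t = 0.
Proof.
move=> dl0 h; rewrite derive_ramp derive_step_out ?mulr0//.
move: h; rewrite ltr_normr => /orP[h|h]; [right|left].
  by rewrite ltr_pdivlMr// mul1r.
rewrite ltr_pdivrMr// mul0r; lra.
Qed.

Lemma ramp_le0 t0 dl t : 0 < dl -> t <= t0 -> ramp t0 dl t = 0.
Proof. by move=> dl0 h; rewrite /ramp step_le0// ler_pdivrMr// mul0r subr_le0. Qed.

Lemma ramp_ge1 t0 dl t : 0 < dl -> t0 + dl <= t -> ramp t0 dl t = bmp 1.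
Proof. by move=> dl0 h; rewrite /ramp step_ge1// ler_pdivlMr// mul1r lerBrDl. Qed.

(** This makes the difference of an earlier and a later ramp a nonnegative weight. *)
Lemma ramp_antitone t0 t1 dl t : 0 < dl -> t0 <= t1 -> ramp t1 dl t <= ramp t0 dl t.
Proof.
by move=> dl0 h; apply: step_homo; rewrite ler_pM2r ?invr_gt0// lerD2l lerN2.
Qed.

(* An opaque form of [ramp]: unfolding it down to [expR] makes unification
   diverge. *)
Lemma ramp_exists : exists (r : R -> R -> R -> R) (h : R), 0 < h /\
  forall dl, 0 < dl -> [/\ forall t0, smooth (r t0 dl),
    forall t0 t, 0 <= 'D_1 (r t0 dl) t,
    forall t0 t, dl < `|t - t0| -> 'D_1 (r t0 dl) t = 0,
    forall t0 t, (t <= t0 -> r t0 dl t = 0) /\ (t0 + dl <= t -> r t0 dl t = h) &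
    forall t0 t1 t, t0 <= t1 -> r t1 dl t <= r t0 dl t].
Proof.
exists ramp, (bmp 1); split; first exact: bmp_gt0.
move=> dl dl0; split.
- by move=> t0; exact: smooth_ramp.
- by move=> t0 t; exact: derive_ramp_ge0.
- by move=> t0 t; exact: derive_ramp_out.
- by move=> t0 t; split; [exact: ramp_le0|exact: ramp_ge1].
- by move=> t0 t1 t; exact: ramp_antitone.
Qed.

(* The test weight is a smooth approximation of [expR (k t)] times the indicator
   of [[t0, t1]]: its derivative charges a neighbourhood of [t0] positively and
   one of [t1] negatively, which contradicts [H t0 < H t1]. *)
Lemma weak_gronwall (k : R) (F : R -> R) (t0 t1 : R) :
  (forall t : R, 0 < t -> F s @[s --> t] --> F t) ->
  (forall (a : R -> R) (s0 s1 : R), smooth a -> (forall t, 0 <= a t) -> 0 < s0 ->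
    (forall t, t < s0 \/ s1 < t -> a t = 0) ->
    exists2 U : R -> R,
      (@lebesgue_measure R).-integrable `[s0, s1] (EFin \o U) /\
      \int[lebesgue_measure]_(t in `[s0, s1]) U t = 0 &
      forall t, `[s0, s1]%classic t -> U t <= ('D_1 a t - k * a t) * F t) ->
  0 < t0 -> t0 < t1 -> expR (k * t1) * F t1 <= expR (k * t0) * F t0.
Proof.
move=> cF weak t00 t01; pose H t := expR (k * t) * F t.
rewrite -/(H t0) -/(H t1).
have cH (t : R) : 0 < t -> H s @[s --> t] --> H t.
  move=> tt; apply: cvgM; last exact: cF.
  exact: (continuous_smooth (smooth_expRM k)).
rewrite leNgt; apply/negP => H01.
have t10 : 0 < t1 := lt_trans t00 t01.
(* c is the midpoint of the two values and e a quarter of the gap: values within e of [H t0] are at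
   most c - e, those within e of [H t1] at least c + e. *)
pose c := (H t0 + H t1) / 2; pose e := (H t1 - H t0) / 4.
have e0 : 0 < e by rewrite /e; lra.
have near_dist (t : R) : 0 < t -> exists2 dl, 0 < dl & forall s, `|s - t| <= dl ->
    `|H t - H s| <= e.
  move=> tt; have := cH t tt.
  move=> /cvgrPdist_le /(_ e e0) /nbhs_ballP[q /= q0 hq].
  exists (q / 2); first by rewrite divr_gt0.
  move=> s hs; apply: hq; rewrite /ball/= distrC (le_lt_trans hs)//.
  by rewrite ltr_pdivrMr// ltr_pMr// ltr1n.
have [d0 d00 h0] := near_dist _ t00; have [d1 d10 h1] := near_dist _ t10.
pose dl := Num.min d0 d1.
have dl0 : 0 < dl by rewrite lt_min d00 d10.
have HH0 s : `|s - t0| <= dl -> H s <= c - e.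
  move=> hs; have /h0 : `|s - t0| <= d0 by rewrite (le_trans hs)// ge_min lexx.
  by rewrite ler_norml /c => /andP[+ _]; rewrite /e; lra.
have HH1 s : `|s - t1| <= dl -> c + e <= H s.
  move=> hs; have /h1 : `|s - t1| <= d1 by rewrite (le_trans hs)// ge_min lexx orbT.
  by rewrite ler_norml /c => /andP[_]; rewrite /e; lra.
have [r [h [h_gt0 /(_ dl dl0)[sr r_ge0 r_out r_val r_anti]]]] := ramp_exists.
pose b := fun t => r t0 dl t - r t1 dl t.
have sb : smooth b by apply: smoothB; exact: sr.
pose a := fun t => expR (k * t) * b t.
have se := smooth_expRM k.
have sa : smooth a by exact: smoothM.
have a_ge0 t : 0 <= a t.
  by rewrite mulr_ge0 ?expR_ge0// subr_ge0 r_anti// ltW.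
have a_out t : t < t0 \/ t1 + dl < t -> a t = 0.
  case=> hs; rewrite /a /b.
    by rewrite !(r_val _ _).1 ?subrr ?mulr0// ltW// (lt_trans hs).
  rewrite !(r_val _ _).2 ?subrr ?mulr0// ltW//.
  by rewrite (lt_trans _ hs)// ltrD2r.
have daE (t : R) : 'D_1 a t - k * a t =
    expR (k * t) * ('D_1 (r t0 dl) t - 'D_1 (r t1 dl) t).
  apply: (@derive_weighted k (fun t : R => expR (k * t))
    (r t0 dl) (r t1 dl) t).
  - by apply: diff_derivable; exact: smooth_differentiable se.
  - by apply: diff_derivable; exact: smooth_differentiable (sr t0).
  - by apply: diff_derivable; exact: smooth_differentiable (sr t1).
  - exact: derive_expRM.
have [U [IU U0] Ule] := weak a t0 (t1 + dl) sa a_ge0 t00 a_out.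
have t0s : t0 < t1 + dl by rewrite (lt_trans t01)// ltrDl.
have [I0 E0] := Rintegral_derive t0s (sr t0).
have [I1 E1] := Rintegral_derive t0s (sr t1).
have mI : measurable (`[t0, t1 + dl]%classic : set (measurableTypeR R)) by exact: measurable_itv.
(* The exponential is an integrating factor: (a' - k a) F is [H] times the difference of the ramp
   derivatives, and each of these lives where [H] is on a known side of c. *)
have Uneg t : `[t0, t1 + dl]%classic t ->
    U t <= (c - e) * 'D_1 (r t0 dl) t - (c + e) * 'D_1 (r t1 dl) t.
  move=> It; apply: (le_trans (Ule t It)).
  rewrite daE.
  have -> : expR (k * t) * ('D_1 (r t0 dl) t - 'D_1 (r t1 dl) t) *
    F t =
    H t * 'D_1 (r t0 dl) t - H t * 'D_1 (r t1 dl) t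
    by rewrite /H; move: (expR _) ('D_1 (r t0 dl) t) ('D_1 (r t1 dl) t)
      (F t) => x y z w; ring.
  apply: lerB.
    have [ht|ht] := leP `|t - t0| dl; last by rewrite r_out// !mulr0.
    by rewrite ler_wpM2r ?r_ge0// HH0.
  have [ht|ht] := leP `|t - t1| dl; last by rewrite r_out// !mulr0.
  by rewrite ler_wpM2r ?r_ge0// HH1.
have : \int[lebesgue_measure]_(t in `[t0, t1 + dl]) U t <=
    \int[lebesgue_measure]_(t in `[t0, t1 + dl])
     ((c - e) * 'D_1 (r t0 dl) t - (c + e) * 'D_1 (r t1 dl) t).
  apply: le_Rintegral => //.
  exact: (integrableB mI (integrableZl mI _ I0) (integrableZl mI _ I1)).
rewrite U0 RintegralB//; last 2 first.
- exact: (integrableZl mI _ I0).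
- exact: (integrableZl mI _ I1).
(* Both ramps rise by h over the interval, so the right-hand side is (c - e) h - (c + e) h < 0,
   while the left-hand side is 0. *)
rewrite (RintegralZl _ mI I0) (RintegralZl _ mI I1) E0 E1.
rewrite !(r_val _ (t1 + dl)).2//; last by rewrite lerD2r ltW.
rewrite !(r_val _ t0).1 ?(ltW t01)// !subr0 -mulrBl leNgt => /negP; apply.
by rewrite pmulr_llt0// opprD addrACA subrr add0r -opprD oppr_lt0 addr_gt0.
Qed.

End SmoothTime.

Section Decay.
Context {R : realType} {d n : nat}.
Notation BV := (borel_rV R d).
Notation V := 'rV[R]_d.
Variables (m p : 'I_n -> R) (E : V).
Hypotheses (m0 : forall j, 0 < m j) (p0 : forall j, 0 < p j) (n0 : (0 < n)%N).
Variables (W : V -> 'M[R]_n) (kappa : 'M[R]_n).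
Hypothesis hW : admissible W kappa.
Notation xo := (x_infty m p E).
Notation lam := (lambda0 m p kappa).
Variable mu : R -> 'I_n -> measure_rV R d.
Hypothesis Pmu : forall t : R, 0 <= t -> in_P m p E (mu t).
Notation within0 t := (within [set s : R | 0 <= s] (nbhs (t : R))).
Hypothesis mu_cont : forall t r : R, 0 <= t -> 0 < r -> \forall s \near within0 t,
  W2_near (mu s) (mu t) r \/ W2_near (mu t) (mu s) r.
Hypothesis hsol : solves m W mu.

Definition wlyap (t : R) : R := expR (2 * lam * t) * lyap m p E (mu t).

Lemma wlyap_cvg (t : R) : 0 <= t -> wlyap s @[s --> within0 t] --> wlyap t.
Proof.
move=> t0; apply: cvgM; last exact: (curve_lyap_cvg Pmu mu_cont t0).
apply: cvg_within_filter.
apply: (@continuous_comp _ _ _ (fun s : R => 2 * lam * s) expR).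
  exact: mulrl_continuous.
exact: continuous_expR.
Qed.

Lemma wlyap_nonincreasing (t0 t1 : R) : 0 < t0 -> t0 < t1 -> wlyap t1 <= wlyap t0.
Proof.
apply: (weak_gronwall (F := fun t => lyap m p E (mu t))) => [t t0'|a s0 s1 sa a0 s00 a_out].
  exact: cvg_within_ge0 t0' (curve_lyap_cvg Pmu mu_cont (ltW t0')).
exact: (weak_inequality m0 p0 n0 hW Pmu mu_cont hsol sa a0 s00 a_out).
Qed.

Lemma lyap_decay (t : R) : 0 <= t ->
  lyap m p E (mu t) <= expR (- (2 * lam * t)) * lyap m p E (mu 0).
Proof.
rewrite le_eqVlt => /predU1P[<-|t0]; first by rewrite mulr0 oppr0 expR0 mul1r.
suff : wlyap t <= wlyap 0.
  by rewrite /wlyap mulr0 expR0 mul1r expRN mulrC -ler_pdivlMr ?expR_gt0// mulrC.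
(* Test functions see positive times only: the monotonicity stops short of 0 and is extended there
   by right continuity of [wlyap]. *)
rewrite leNgt; apply/negP => h.
have /cvgrPdist_lt /(_ (wlyap t - wlyap 0)) := wlyap_cvg (lexx 0).
rewrite subr_gt0 => /(_ h) /nbhs_ballP[q /= q0 hq].
pose s := Num.min (q / 2) (t / 2).
have s0 : 0 < s by rewrite lt_min !divr_gt0.
have sq : s < q by rewrite (le_lt_trans (_ : s <= q / 2))// ?ge_min ?lexx// ltr_pdivrMr// ltr_pMr// ltr1n.
have st : s < t.
  by rewrite (le_lt_trans (_ : s <= t / 2))// ?ge_min ?lexx ?orbT// ltr_pdivrMr// ltr_pMr// ltr1n.
have := wlyap_nonincreasing s0 st.
have : `|wlyap 0 - wlyap s| < wlyap t - wlyap 0.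
  by apply: hq; [rewrite /ball/= sub0r normrN gtr0_norm|exact: ltW].
by rewrite ltr_norml => /andP[h1 h2] h3; lra.
Qed.

End Decay.

(** * Curves with square-integrable speed *)

Section AbsolutelyContinuous.
Context {R : realType}.

(** From |phi| <= h phi^2 + 1/(4 h): the first term is made small by the choice of h on all
    subintervals alike, the second by the length of the interval. *)
Lemma square_integrable_modulus (phi : R -> R) (T e : R) : 0 < T -> 0 < e ->
  measurable_fun `[0, T] phi ->
  (\int[lebesgue_measure]_(r in `[0%R, T]) ((phi r) ^+ 2)%:E < +oo)%E ->
  exists2 dl, 0 < dl & forall s t, 0 <= s -> s <= t -> t <= T -> t - s < dl ->
    \int[lebesgue_measure]_(r in `[s, t]) phi r < e.
Proof.
move=> T0 e0 mphi phioo; pose J := `[0, T]%classic : set (measurableTypeR R).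
have mJ : measurable J by exact: measurable_itv.
have Iphi2 : (@lebesgue_measure R).-integrable J (EFin \o (fun r => phi r ^+ 2)).
  apply/integrableP; split.
    by apply/measurable_EFinP; exact: measurable_funX.
  by under eq_integral do rewrite /= ger0_norm ?sqr_ge0//.
pose M := \int[lebesgue_measure]_(r in J) phi r ^+ 2.
have M0 : 0 <= M by apply: Rintegral_ge0 => r _; exact: sqr_ge0.
(* Then h M is at most e/2, and the length 2 h e chosen below makes the other term smaller than 2 h
   e / (4 h) = e/2. *)
pose h := e / 2 / (M + 1).
have h0 : 0 < h by rewrite !divr_gt0// ltr_wpDl.
exists (2 * h * e); first by rewrite (mulr_gt0 _ e0)// mulr_gt0.
move=> s t s0 st tT tsd; pose I := `[s, t]%classic : set (measurableTypeR R).
have mI : measurable I by exact: measurable_itv.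
have IJ : I `<=` J.
  move=> r; rewrite /I /J /= !in_itv/= => /andP[sr rt].
  by rewrite (le_trans s0 sr) (le_trans rt tT).
have Iphi2I : (@lebesgue_measure R).-integrable I (EFin \o (fun r => phi r ^+ 2)).
  exact: (integrableS mJ mI IJ Iphi2).
have muI : (@lebesgue_measure R I = (t - s)%:E)%E.
  rewrite /I lebesgue_measure_itv/= lte_fin; case: ifPn => [_|]; first by rewrite EFinB.
  rewrite -leNgt => ts; have -> : s = t by apply: le_anti; rewrite st ts.
  by rewrite subrr.
have Icst (k : R) : (@lebesgue_measure R).-integrable I (EFin \o cst k).
  apply: measurable_bounded_integrable => //.
    have muIy : ((t - s)%:E < +oo)%E by rewrite ltry.
    by move: muIy; rewrite -muI.
  exact: bounded_cst.
have Ihphi : (@lebesgue_measure R).-integrable I (EFin \o (fun r => h * phi r ^+ 2 + (4 * h)^-1)).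
  exact: (integrableD mI (integrableZl mI h Iphi2I) (Icst _)).
have young r : `|phi r| <= h * phi r ^+ 2 + (4 * h)^-1.
  have h4 : 0 < 4 * h by exact: mulr_gt0.
  rewrite -(ler_pM2l h4) mulrDr mulfV ?gt_eqF//.
  have := sqr_ge0 (2 * h * `|phi r| - 1); rewrite -(real_normK (num_real (phi r))); nra.
have Iphi : (@lebesgue_measure R).-integrable I (EFin \o phi).
  apply: le_integrable Ihphi => //.
    by apply/measurable_EFinP; exact: (measurable_funS mJ IJ).
  move=> r _ /=; rewrite lee_fin (le_trans (young r))// ler_norm//.
apply: (@le_lt_trans _ _ (h * M + (4 * h)^-1 * (t - s))).
  apply: (@le_trans _ _ (\int[lebesgue_measure]_(r in I) (h * phi r ^+ 2 + (4 * h)^-1))).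
    apply: le_Rintegral => // r _; exact: le_trans (ler_norm _) (young r).
  rewrite (RintegralD mI (integrableZl mI h Iphi2I) (Icst _)).
  rewrite (RintegralZl _ mI Iphi2I) (Rintegral_cst _ mI).
  have -> : fine (lebesgue_measure I) = t - s by exact: (congr1 fine muI).
  rewrite lerD2r ler_wpM2l ?(ltW h0)// /M /Rintegral fine_le//.
  - exact: integrable_fin_num Iphi2I.
  - exact: integrable_fin_num Iphi2.
  - apply: ge0_subset_integral => //.
      by apply/measurable_EFinP; exact: measurable_funX.
    by move=> r _; rewrite lee_fin sqr_ge0.
rewrite (splitr e); apply: ler_ltD.
  by rewrite /h mulrAC ler_pdivrMr ?ltr_wpDl// ler_wpM2l ?divr_ge0 ?(ltW e0)// lerDl.
have h4 : 0 < 4 * h by exact: mulr_gt0.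
rewrite ltr_pdivrMl//.
by apply: (lt_le_trans tsd); rewrite le_eqVlt; apply/orP; left; apply/eqP; field.
Qed.

End AbsolutelyContinuous.

(** * Stationarity of the minimizer *)

Section PartialDerivatives.
Context {R : realType} {U V : normedModType R}.
Implicit Type phi : U * V -> R.

Lemma derive_partial1 phi t x v : 'D_v (fun s => phi (s, x)) t = 'D_(v, 0) phi (t, x).
Proof.
rewrite /derive (_ : (fun h : R => h^-1 *: (((fun s => phi (s, x)) \o shift t) (h *: v) -
  phi (t, x))) = (fun h => h^-1 *: ((phi \o shift (t, x)) (h *: (v, 0)) - phi (t, x))))//.
by apply/funext => h /=; rewrite -[h *: (v, 0)]/(h *: v, h *: 0) scaler0
  -[(h *: v, 0) + (t, x)]/(h *: v + t, 0 + x) add0r.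
Qed.

Lemma derive_partial2 phi t x v : 'D_v (fun y => phi (t, y)) x = 'D_(0, v) phi (t, x).
Proof.
rewrite /derive (_ : (fun h : R => h^-1 *: (((fun y => phi (t, y)) \o shift x) (h *: v) -
  phi (t, x))) = (fun h => h^-1 *: ((phi \o shift (t, x)) (h *: (0, v)) - phi (t, x))))//.
by apply/funext => h /=; rewrite -[h *: (0, v)]/(h *: 0, h *: v) scaler0
  -[(0, h *: v) + (t, x)]/(0 + t, h *: v + x) add0r.
Qed.

Lemma pairl_continuous (x : V) : continuous (fun s : U => (s, x)).
Proof. by move=> s; apply: cvg_pair; [exact: cvg_id|exact: cvg_cst]. Qed.

Lemma open_near_pairl (A : set (U * V)) t x : open A -> A (t, x) ->
  \forall s \near t, A (s, x).
Proof.
by move=> oA Atx; apply: (pairl_continuous (x := x)); exact: open_nbhs_nbhs.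
Qed.

Lemma smooth_partial1 phi x : smooth phi -> smooth (fun s => phi (s, x)).
Proof.
move=> + k; elim: k phi => [|k IH] phi sphi.
  move=> s; apply: (@continuous_comp _ _ _ (fun s : U => (s, x)) phi).
    exact: pairl_continuous.
  exact: (continuous_smooth sphi).
split=> [s|v].
  apply: (@differentiable_comp _ _ _ _ (fun s : U => (s, x)) phi).
    by apply: differentiable_pair => //; exact: differentiable_cst.
  exact: smooth_differentiable.
have -> : (fun s => 'D_v (fun s => phi (s, x)) s) = fun s => 'D_(v, 0) phi (s, x).
  by apply/funext => s; rewrite derive_partial1.
exact: (IH (fun z => 'D_(v, 0) phi z) (@smooth_derive R _ phi (v, 0) sphi)).
Qed.

Lemma continuous_partial2 phi t : continuous phi -> continuous (fun y => phi (t, y)).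
Proof.
move=> cphi y; apply: (@continuous_comp _ _ _ (fun y : V => (t, y)) phi).
  by apply: cvg_pair; [exact: cvg_cst|exact: cvg_id].
exact: cphi.
Qed.

End PartialDerivatives.

Section Final.
Context {R : realType} {d n : nat}.
Notation BV := (borel_rV R d).
Notation V := 'rV[R]_d.
Variables (m p : 'I_n -> R) (E : V).
Hypotheses (m0 : forall j, 0 < m j) (p0 : forall j, 0 < p j) (n0 : (0 < n)%N).
Notation xo := (x_infty m p E).
Notation within0 t := (within [set s : R | 0 <= s] (nbhs (t : R))).

Lemma WP_near (r : R) : 0 < r -> exists2 q, 0 < q &
  forall mu nu, in_P m p E mu -> in_P m p E nu -> WP m mu nu < q -> W2_near mu nu r.
Proof.
move=> r0; pose S := \sum_j m j.
have S0 : 0 < S.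
  rewrite /S (bigD1 (Ordinal n0))//= ltr_wpDr ?m0//.
  by apply: sumr_ge0 => j _; exact: ltW.
(* q <= 1 and q S <= r give m_j q^2 <= r for all species at once. *)
pose q := Num.min 1 (r / S).
have q0 : 0 < q by rewrite lt_min ltr01 divr_gt0.
exists q => // mu nu Pmu Pnu Wq j.
have [g cg gq] := WP_coupling m0 p0 Pmu Pnu Wq j.
exists g => //; apply: (lt_le_trans gq); rewrite lee_fin.
have q1 : q <= 1 by rewrite ge_min lexx.
have qr : q * S <= r by rewrite -ler_pdivlMr// ge_min lexx orbT.
have mS : m j <= S.
  by rewrite /S (bigD1 j)//= lerDl; apply: sumr_ge0 => k _; exact: ltW.
have := m0 j; nra.
Qed.

Lemma AC2_W2_continuous (mu : R -> 'I_n -> measure_rV R d) :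
  (forall t : R, 0 <= t -> in_P m p E (mu t)) -> AC2_loc m mu ->
  forall t r : R, 0 <= t -> 0 < r -> \forall s \near within0 t,
    W2_near (mu s) (mu t) r \/ W2_near (mu t) (mu s) r.
Proof.
move=> Pmu ac t r t0 r0; have [q q0 hq] := WP_near r0.
have T0 : 0 < t + 1 by rewrite ltr_wpDl.
have [phi [mphi phi2 hphi]] := ac _ T0.
have [dl dl0 hdl] := square_integrable_modulus T0 q0 mphi phi2.
near=> s.
have s0 : 0 <= s by near: s; exact: withinT.
have sd : `|t - s| < dl.
  by near: s; apply: cvg_within; exact: (@nbhsx_ballx _ R t _ dl0).
have s1 : s <= t + 1.
  have : `|t - s| < 1 by near: s; apply: cvg_within; exact: (@nbhsx_ballx _ R t _ ltr01).
  by rewrite ltr_norml => /andP[h _]; lra.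
have [st|ts] := leP s t.
  left; apply: hq; [exact: Pmu|exact: Pmu|].
  have tT : t <= t + 1 by rewrite lerDl.
  apply: (le_lt_trans (hphi s t s0 st tT)); apply: hdl => //.
  by rewrite (le_lt_trans (ler_norm _)).
right; apply: hq; [exact: Pmu|exact: Pmu|].
apply: (le_lt_trans (hphi t s t0 (ltW ts) s1)); apply: hdl => //; first exact: ltW.
by rewrite (le_lt_trans (ler_norm _))// distrC.
Unshelve. all: by end_near.
Qed.

(** The image of each measure on the diagonal is a coupling of zero cost; this gives the continuity
    of constant curves. *)
Lemma W2_near_refl mu (r : R) : in_P m p E mu -> 0 < r -> W2_near mu mu r.
Proof.
move=> Pmu r0 j.
have mphi : measurable_fun setT (fun x : BV => (x, x)).
  by apply: measurable_fun_pair; exact: measurable_id.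
have [g gE] : exists g : {measure set (BV * BV)%type -> \bar R},
    forall A, measurable A -> g A = mu j ((fun x : BV => (x, x)) @^-1` A).
  by exists (measure_function_pushforward__canonical__measure_function_Measure (mu j) mphi).
have gT : (g setT < +oo)%E by rewrite gE// preimage_setT; exact: (in_P_finite Pmu).
exists (finm gT) => [A mA|].
  by rewrite /= !gE//; [rewrite -[X in measurable X]setTX; exact: measurableX
    |rewrite -[X in measurable X]setXT; exact: measurableX].
have -> : (\int[finm gT]_z (sqnorm (z.1 - z.2 : V))%:E = 0)%E; last by rewrite lte_fin.
have -> := @image_integral_ge0 _ _ _ _ R (mu j) g _ mphi gE
  (fun z : BV * BV => sqnorm (z.1 - z.2 : V)) measurable_cost (fun=> sqnorm_ge0 _).
by apply: integral0_eq => x _ /=; rewrite subrr sqnorm0.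
Qed.

Variables (W : V -> 'M[R]_n) (kappa : 'M[R]_n).
Hypothesis hW : admissible W kappa.
Notation lam := (lambda0 m p kappa).
Notation muo := (mu_infty m p0 E).

Lemma drift_mu_infty i x :
  drift W muo i x = \sum_j p j *: grad (fun z => W z i j) (x - xo).
Proof.
apply: eq_bigr => j _; apply/rowP => k; rewrite mxE [RHS]mxE.
rewrite (Rintegral_mu_infty m E p0 (f := fun y => grad (fun z => W z i j) (x - y) 0 k))//.
apply: (measurableT_comp (measurable_coord k)).
by apply: (measurable_gradW hW); apply: measurable_sub_rV => //; exact: measurable_cst.
Qed.

Lemma drift_x_infty i : drift W muo i xo = 0.
Proof.
rewrite drift_mu_infty; apply: big1 => j _.
by rewrite subrr (gradW0 hW) scaler0.
Qed.

(** All the mass sits where the drift vanishes, so that only the time derivative of the test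
    function at that point remains; it integrates to 0 by compactness of the support. *)
Lemma stationary_mu_infty : stationary m p E W muo.
Proof.
split; first exact: mu_infty_in_P.
move=> i phi [sphi cphi phi_pos].
have mD t (v : R * V) : measurable_fun setT (fun x : BV => 'D_v phi (t, x)).
  apply: measurable_continuous_rV.
  apply: (@continuous_partial2 R R V (fun z => 'D_v phi z) t).
  exact: continuous_smooth (smooth_derive v sphi).
have dtE t x : dt phi t x = 'D_(1, 0) phi (t, x).
  by rewrite /dt derive1E derive_partial1.
have gE t x k : gradx phi t x 0 k = 'D_(0, delta_mx 0 k) phi (t, x).
  by rewrite mxE derive_partial2.
have mdt t : measurable_fun setT (fun x : BV => dt phi t x).
  rewrite (_ : (fun x : BV => _) = fun x : BV => 'D_(1, 0) phi (t, x)); first exact: mD.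
  by apply/funext => x; exact: dtE.
have mgx t k : measurable_fun setT (fun x : BV => gradx phi t x 0 k).
  rewrite (_ : (fun x : BV => _) = fun x : BV => 'D_(0, delta_mx 0 k) phi (t, x)); first exact: mD.
  by apply/funext => x; exact: gE.
(* Evaluating an integral against a Dirac mass asks for a measurable integrand, hence the explicit
   form of the drift away from [xo] too. *)
have inner t : \int[muo i]_x (dt phi t x -
    m i * dotv (gradx phi t x) (drift W muo i x)) = p i * dt phi t xo.
  rewrite (Rintegral_mu_infty m E p0 (f := fun x => dt phi t x -
    m i * dotv (gradx phi t x) (drift W muo i x))).
    by rewrite drift_x_infty dotvC dotv0l mulr0 subr0.
  apply: measurable_funB; first exact: mdt.
  apply: measurable_funM; first exact: measurable_cst.
  apply: measurable_dotv.
    by apply: measurable_fun_rV => k; exact: mgx.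
  apply: measurable_fun_rV => k.
  rewrite (_ : (fun x : BV => _) = fun x : BV => \sum_j p j * grad (fun z => W z i j) (x - xo) 0 k).
    apply: measurable_sum => j.
    apply: measurable_funM; first exact: measurable_cst.
    apply: (measurableT_comp (measurable_coord k)).
    by apply: (measurable_gradW hW); apply: measurable_sub_rV => //; exact: measurable_cst.
  by apply/funext => x; rewrite drift_mu_infty summxE; apply: eq_bigr => j _; rewrite mxE.
under eq_Rintegral do rewrite inner.
pose F (t : R) := p i * phi (t, xo).
have sF : smooth F by apply: smoothM; [exact: smooth_cst|exact: smooth_partial1].
have dF t : 'D_1 F t = p i * dt phi t xo.
  have d1 : derivable (fun s : R => phi (s, xo)) t 1.
    by apply: diff_derivable; exact: smooth_differentiable (smooth_partial1 xo sphi).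
  by rewrite dtE -derive_partial1; exact: (deriveZ (p i) d1).
have F0 t : ~ tsupport phi (t, xo) -> F t = 0.
  move=> h; rewrite /F; suff -> : phi (t, xo) = 0 by rewrite mulr0.
  by apply: contrapT => h'; apply: h; apply: subset_closure; apply/eqP.
have dF0 t : ~ tsupport phi (t, xo) -> 'D_1 F t = 0.
  move=> h; apply: (@derive_near_cst _ _ _ 0).
  have op : open (~` tsupport phi) by apply: closed_openC; exact: closed_closure.
  have := open_near_pairl op h.
  by apply: filterS => s; exact: F0.
have out t : t <= 0 -> ~ tsupport phi (t, xo).
  by move=> t0 /phi_pos /=; rewrite ltNge t0.
have [b b0 outb] : exists2 b, 0 < b & forall t, b <= t -> ~ tsupport phi (t, xo).
  have /compact_bounded[M [_ /(_ (`|M| + 1))]] : compact (fst @` tsupport phi).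
    apply: continuous_compact => //; apply: continuous_subspaceT => z; exact: cvg_fst.
  rewrite (le_lt_trans (ler_norm M)) ?ltrDl// => /(_ isT) HM.
  exists (`|M| + 2); first by rewrite ltr_wpDl.
  move=> t tM ht; have /= := HM t (ex_intro2 _ _ _ ht erefl).
  by move=> /(le_trans (ler_norm t)); lra.
transitivity (\int[lebesgue_measure]_(t in `]0, +oo[) 'D_1 F t).
  by apply: eq_Rintegral => t _; rewrite dF.
have [_ E1] := Rintegral_derive b0 sF.
have F'0 t : ~ `]0, b]%classic t -> 'D_1 F t = 0.
  rewrite /= in_itv/= => h; apply: dF0; have [t0|t0] := leP t 0; first exact: out.
  apply: outb; have [//|tb] := leP b t.
  by case: h; rewrite t0 ltW.
(* The integrals over the positive half-line and over [0, b] agree, because the derivative vanishes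
   at nonpositive times and from b on. *)
rewrite (@Rintegral_sub_support _ _ R (@lebesgue_measure R) _ `]0, b]%classic)//; last first.
  by move=> t /=; rewrite !in_itv/= => /andP[->].
rewrite -(@Rintegral_sub_support _ _ R (@lebesgue_measure R) `[0, b]%classic)//; last first.
  by move=> t /=; rewrite !in_itv/= => /andP[/ltW-> ->].
by rewrite E1 !F0 ?subr0//; [exact: out|exact: outb].
Qed.

End Final.

Theorem corollary2p11 (R : realType) (d n : nat) (hd : (0 < d)%N) (hn : (0 < n)%N)
    (m p : 'I_n -> R) (hm : forall j, 0 < m j) (hp : forall j, 0 < p j)
    (E : 'rV[R]_d) (W : 'rV[R]_d -> 'M[R]_n) (kappa : 'M[R]_n)
    (hW : admissible W kappa) (hlambda : 0 < lambda0 m p kappa) :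
  [/\ minimizer m p E W (mu_infty m hp E) /\
      (forall mu : 'I_n -> measure_rV R d,
         minimizer m p E W mu -> same_measures mu (mu_infty m hp E)),
      stationary m p E W (mu_infty m hp E) /\
      (forall mu : 'I_n -> measure_rV R d,
         stationary m p E W mu -> same_measures mu (mu_infty m hp E)) &
      forall (mu0 : 'I_n -> measure_rV R d) (mu : R -> 'I_n -> measure_rV R d),
        in_P m p E mu0 -> gradient_flow m p E W mu0 mu ->
        forall t : R, 0 <= t ->
          WP m (mu t) (mu_infty m hp E) <=
          expR (- lambda0 m p kappa * t) * WP m mu0 (mu_infty m hp E)].
Proof.
have Poo : in_P m p E (mu_infty m hp E) by exact: mu_infty_in_P.
split; [split| split|].
- split=> // nu Pnu; have := energy_ge hm hp hn hW Pnu.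
  rewrite (energy_mu_infty m E hp hW); apply: le_trans.
  by rewrite lerDl !mulr_ge0 ?lyap_ge0// ltW.
- move=> mu [Pmu min]; apply: (lyap_eq0 hm hp Pmu); apply/eqP.
  rewrite eq_le lyap_ge0// andbT leNgt; apply/negP => l0.
  have := min _ Poo; have := energy_ge hm hp hn hW Pmu.
  rewrite (energy_mu_infty m E hp hW) => h1 /(le_trans h1).
  by apply/negP; rewrite -ltNge ltrDl !mulr_gt0.
- exact: (stationary_mu_infty E hm hp hn hW).
- move=> mu [Pmu sol]; apply: (lyap_eq0 hm hp Pmu); apply/eqP.
  rewrite eq_le lyap_ge0// andbT leNgt; apply/negP => l0.
  (* The constant curve is admissible for the decay estimate; at time 1 this reads L <= e^(-2
     lambda0) L, which is impossible for L > 0. *)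
  have cst (t r : R) : 0 <= t -> 0 < r -> \forall s \near
      within [set s : R | 0 <= s] (nbhs t), W2_near mu mu r \/ W2_near mu mu r.
    by move=> _ r0; apply: nearW => s; left; exact: (W2_near_refl Pmu).
  have := lyap_decay hm hp hn hW (fun _ _ => Pmu) cst sol ler01.
  apply/negP; rewrite -ltNge gtr_pMl// -expR0 ltr_expR oppr_lt0.
  by rewrite !mulr_gt0.
move=> mu0 mu Pmu0 [Pmu ac mu00 sol] t t0.
(* The initial value agrees with mu0 on Borel sets only, which is all that couplings see. *)
rewrite -(same_measures_WP m _ mu00) !WP_mu_infty//; last 2 first.
- exact: Pmu.
- exact: Pmu.
(* The distance is the square root of [lyap], so the rate 2 lambda0 is halved. *)
have -> : expR (- lambda0 m p kappa * t) =
    Num.sqrt (expR (- (2 * lambda0 m p kappa * t))).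
  rewrite -[LHS]ger0_norm ?expR_ge0// -sqrtr_sqr -expRM_natl; congr (Num.sqrt (expR _)).
  by rewrite mulNr mulrN mulrA.
rewrite -sqrtrM ?expR_ge0// ler_wsqrtr//.
exact: (lyap_decay hm hp hn hW Pmu (AC2_W2_continuous hm hp hn Pmu ac) sol t0).
Qed.
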